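(* Let Assumption (A) below hold (no sign restriction on $M$). Then for $\eta\in\{-1,1\}$ and all $i\in\mathcal D$, $$P(\eta R>t\mid X_0=i)\sim K_i^{(\eta)}t^{-\alpha}L(t),$$ where $\mathbf K^{(\eta)}=(K_i^{(\eta)})_{i\in\mathcal D}\in B_b$ is $$\mathbf K^{(\eta)}=\tfrac12\Big((I-G)^{-1}(\mathbf q^{(1)}+\mathbf q^{(-1)})+\eta\,(I-G_1+G_{-1})^{-1}(\mathbf q^{(1)}-\mathbf q^{(-1)})\Big),$$ with $\mathbf q^{(\eta)}=(q_i^{(\eta)})_{i\in\mathcal D}$.
   Context: Let $\mathcal D$ be a countable set and $(X_n)_{n\in\mathbb Z}$ a stationary irreducible Markov chain on $\mathcal D$. Let $(Q_{n,i},M_{n,i})_{n\in\mathbb Z,i\in\mathcal D}$ be independent $\mathbb R^2$-valued random pairs, independent of $(X_n)$, such that for each fixed $i$ the pairs $(Q_{n,i},M_{n,i})_{n\in\mathbb Z}$ are i.i.d. Set $Q_n=Q_{n,X_n}$, $M_n=M_{n,X_n}$, and let $R=Q_0+\sum_{n\ge1}Q_{-n}\prod_{i=0}^{n-1}M_{-i}$ be the stationary solution of $R_n=Q_n+M_nR_{n-1}$. $L$ slowly varying means $L(\lambda t)\sim L(t)$ for all $\lambda>0$; $f\sim g$ means $f(t)/g(t)\to1$ as $t\to\infty$. Assumption (A): there is $\alpha>0$ such that (A1) there is a slowly varying $L$ and constants $q_i^{(\eta)}\ge0$, $i\in\mathcal D$, $\eta\in\{-1,1\}$, with $P(\eta Q_{n,i}>t)/(t^{-\alpha}L(t))\to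 q_i^{(\eta)}$ uniformly in $i$; moreover $\sum_j q^{(1)}_j>0$ and $\sup_j\max\{q^{(1)}_j,q^{(-1)}_j\}<\infty$; (A2) there is $\beta>\alpha$ with $\sup_i E|M_{0,i}|^\beta<\infty$; (A3) with $m_i^{(\eta)}=E(|M_{0,i}|^\alpha\mathbf 1_{\{\eta M_{0,i}>0\}})$ and $m_i=m_i^{(1)}+m_i^{(-1)}$, $\sup_i m_i<1$; (A4) $\lim_{\varepsilon\to0+}P(M_{1,i}\le\varepsilon)=P(M_{1,i}\le0)$ uniformly in $i$. $B_b$ is the space of bounded real sequences indexed by $\mathcal D$ with the sup norm. $H(i,j)=P(X_n=j\mid X_{n+1}=i)$; $G_\eta(i,j)=m_i^{(\eta)}H(i,j)$ for $\eta\in\{-1,1\}$ and $G(i,j)=m_iH(i,j)$, viewed as operators on $B_b$. *)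

(* Defs.v *)
From HB Require Import structures.
From mathcomp Require Import all_boot all_order all_algebra.
From mathcomp Require Import all_classical all_reals all_analysis.
Set Implicit Arguments. Unset Strict Implicit. Unset Printing Implicit Defensive.
Import Order.TTheory GRing.Theory Num.Theory.
Import numFieldNormedType.Exports.
Local Open Scope classical_set_scope.
Local Open Scope ring_scope.

Section Defs.
Context (R : realType) (d : measure_display) (Omega : measurableType d)
  (P : probability Omega R) (D : countType).

Definition prob (A : set Omega) : R := fine (P A).

Definition indep_family (I : eqType) (F : I -> set (set Omega)) : Prop :=
  forall J : seq I, uniq J -> forall A : I -> set Omega,
    (forall i, i \in J -> F i (A i)) ->
    prob (\bigcap_(i in [set` J]) A i) = \prod_(i <- J) prob (A i).

Definition cyl (X : int -> Omega -> D) (n : int) (x : D) (s : seq D) : set Omega :=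
  [set w | X n w = x /\
     forall l : nat, (l < size s)%N -> X (n + (l.+1)%:Z) w = nth x s l].

Definition stationary_markov (X : int -> Omega -> D) (pi : D -> R)
    (p : D -> D -> R) : Prop :=
  (forall n j, measurable (X n @^-1` [set j])) /\
  (forall n x s, prob (cyl X n x s) =
     pi x * \prod_(l < size s) p (nth x (x :: s) l) (nth x s l)).

Definition irreducible (p : D -> D -> R) : Prop :=
  forall i j, exists s : seq D,
    path (fun a b => 0 < p a b) i s /\ last i s = j.

Definition model_sigma (X : int -> Omega -> D) (Q M : int -> D -> Omega -> R)
    (k : option (int * D)) : set (set Omega) :=
  match k with
  | None => <<s [set A | exists n j, A = X n @^-1` [set j]] >>
  | Some (n, i) => [set A | exists2 B : set (R * R)%type, measurable B &
                       A = (fun w => (Q n i w, M n i w)) @^-1` B]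
  end.

Definition slowly_varying (L : R -> R) : Prop :=
  (\forall t \near +oo, 0 < L t) /\
  forall lam : R, 0 < lam -> L (lam * t) / L t @[t --> +oo] --> (1 : R).

Definition unif_tail (alpha : R) (L : R -> R) (Qn : D -> Omega -> R)
    (eta : R) (q : D -> R) : Prop :=
  forall e : R, 0 < e -> \forall t \near +oo, forall i : D,
    `| prob [set w | t < eta * Qn i w] / (t `^ (- alpha) * L t) - q i | < e.

Definition mom (alpha eta : R) (Mi : Omega -> R) : R :=
  fine (\int[P]_w ((`|Mi w| `^ alpha) * (if 0 < eta * Mi w then 1 else 0))%:E).

Definition Hk (X : int -> Omega -> D) (i j : D) : R :=
  prob (X 0 @^-1` [set j] `&` X 1 @^-1` [set i]) / prob (X 1 @^-1` [set i]).

Definition dsum (f : D -> R) : R :=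
  fine (\esum_(j in [set: D]) (Num.max (f j) 0)%:E) -
  fine (\esum_(j in [set: D]) (Num.max (- f j) 0)%:E).

Definition Gop (X : int -> Omega -> D) (m : D -> R) (v : D -> R) : D -> R :=
  fun i => m i * dsum (fun j => Hk X i j * v j).

Definition bounded_seq (v : D -> R) : Prop := exists C : R, forall i, `|v i| <= C.

Definition Rsol (X : int -> Omega -> D) (Q M : int -> D -> Omega -> R)
    (w : Omega) : R :=
  limn (fun N : nat => \sum_(n < N.+1)
     (Q (- (n%:Z)) (X (- (n%:Z)) w) w *
      \prod_(k < n) M (- (k%:Z)) (X (- (k%:Z)) w) w)).

Definition condP (X : int -> Omega -> D) (A : set Omega) (i : D) : R :=
  prob (A `&` X 0 @^-1` [set i]) / prob (X 0 @^-1` [set i]).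

End Defs.

(* Main.v *)
Require Import Defs.
From HB Require Import structures.
From mathcomp Require Import all_boot all_order all_algebra.
From mathcomp Require Import all_classical all_reals all_analysis.
From mathcomp Require Import measurable_realfun ring lra.
Import Order.TTheory GRing.Theory Num.Theory.
Import numFieldNormedType.Exports.
Local Open Scope classical_set_scope.
Local Open Scope ring_scope.

(**
  The law of [R] given [X_0 = i] is that of [Q + M R'], where [(Q, M)] is
  distributed as [(Q_{0,i}, M_{0,i})] and is independent of [R'], whose law is
  the mixture over [j], with weights [H i j], of the laws of [R] given
  [X_0 = j].  By Breiman's lemma and the principle of a single big jump the
  tails of [R] and [-R] given [X_0 = i], divided by a monotone regularly
  varying function [f], therefore satisfy asymptotically the affine system
  solved by [K^(1)] and [K^(-1)].  In the sup norm over [i] and both signs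
  this system is a contraction with constant [sup_i m_i < 1], so the limiting
  deviation [dl] from the solution satisfies [dl <= c * dl], whence [dl = 0].

  The argument is run for the partial sums [R^(N)], uniformly in [N].  That
  [dl] is finite, and that the series for [R] converges absolutely almost
  surely, both follow from the bound [P(|R^(N)| > t | X_0 = i) <= C f t],
  uniform in [N], [i] and large [t]; for the second, it is applied to
  [(|Q|, |M|)].  For [f] one takes the tail of some [Q_{0,j}] with
  [q_j^(1) > 0], which spares measurability assumptions on [L].
*)

(** Breiman's lemma is not uniform in the multiplier. Every estimate for a fixed pair [(q, m)]
    therefore carries an error of the form [e * (1 + |m|^b) * f t] with [b > alpha]; the moment
    bound of order [b] makes this integrable, uniformly over the states.

    The limit in [t] has to be exchanged with the limit in [N]. This is why the law [V] and the
    variable [r] are quantified inside the eventual statements: one threshold in [t] then serves all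
    partial sums and all states. The first partial sums have other tail constants, the empty one
    being 0, so a deviation is measured from some [N0] on, and [N0] grows by one with each
    contraction.

    No independent copy of [R'] is constructed. [V i] is [P] conditioned on [X 0 = i], [R'] is the
    partial sum that starts at time -1, and independence enters through Fubini's theorem for image
    laws.

    A negative [M] exchanges the two tails. Hence the sum of the two constants satisfies an equation
    with the operator [G], and their difference one with [G_1 - G_{-1}]; both operators have norm at
    most [sup_i m_i]. *)

Section RealAnalysis.
Context {R : realType}.

(** An explicit threshold lets an eventual bound be used at shifted points such as [dt * t] or
    [(1 - dt) * t]. *)
Lemma near_pinfty_ex (P : R -> Prop) : (\forall u \near +oo, P u) ->
  exists2 T0 : R, 0 < T0 & forall u, T0 <= u -> P u.
Proof.
move=> [A [_ HA]]; exists (`|A| + 1); first by rewrite ltr_wpDl.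
by move=> u Tu; apply: HA; have := ler_norm A; lra.
Qed.

Lemma near_pinfty_ge (a : R) : \forall u \near +oo, a <= u.
Proof. by apply: nbhs_pinfty_ge; rewrite num_real. Qed.

Lemma powR1E (b : R) : 1 `^ b = 1.
Proof. by rewrite powR1. Qed.

Lemma powR_le1D (m b c : R) : 0 <= m -> 0 <= b <= c -> m `^ b <= 1 + m `^ c.
Proof.
move=> m0 /andP[b0 bc]; have [m1|m1] := lerP m 1.
  rewrite (@le_trans _ _ 1)// ?lerDl ?powR_ge0//.
  by rewrite -(powR1E b) ge0_ler_powR ?nnegrE// ler01.
by rewrite (@le_trans _ _ (m `^ c)) ?lerDr// ler_powR// ltW.
Qed.

End RealAnalysis.

(** * Real-valued probabilities and events of the form [t < q + m * r] *)

Section ProbReal.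
Context {d : measure_display} {T : measurableType d} {R : realType}.
Variable P : probability T R.
Implicit Types A B : set T.

Lemma probE A : measurable A -> P A = (prob P A)%:E.
Proof. by move=> mA; rewrite /prob fineK// fin_num_measure. Qed.

Lemma prob_ge0 A : 0 <= prob P A.
Proof. exact/fine_ge0/measure_ge0. Qed.

Lemma prob_le1 A : measurable A -> prob P A <= 1.
Proof. by move=> mA; rewrite -lee_fin -probE// probability_le1. Qed.

Lemma le_prob A B : measurable A -> measurable B -> A `<=` B ->
  prob P A <= prob P B.
Proof.
by move=> mA mB AB; rewrite -lee_fin -!probE//; apply: le_measure; rewrite ?inE.
Qed.

Lemma prob_setU_le A B : measurable A -> measurable B ->
  prob P (A `|` B) <= prob P A + prob P B.
Proof.
move=> mA mB; rewrite -lee_fin EFinD -!probE//; last exact: measurableU.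
exact: measureU2.
Qed.

Lemma prob_setC A : measurable A -> prob P (~` A) = 1 - prob P A.
Proof.
move=> mA; apply: EFin_inj; rewrite EFinB -!probE//; last exact: measurableC.
exact: probability_setC.
Qed.

Lemma prob_setT : prob P setT = 1.
Proof. by rewrite /prob probability_setT. Qed.

Lemma prob_set0 : prob P set0 = 0.
Proof. by rewrite /prob measure0. Qed.

End ProbReal.

Section RandomVariableEvents.
Context {d : measure_display} {T : measurableType d} {R : realType}.

Lemma measurable_gtr (g : T -> R) t : measurable_fun setT g ->
  measurable [set w | t < g w].
Proof.
move=> mg; rewrite [X in measurable X](_ : _ = g @^-1` `]t, +oo[); last first.
  by apply/seteqP; split => w /=; rewrite in_itv/= andbT.
by rewrite -[X in measurable X]setTI; apply: mg => //; exact: measurable_itv.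
Qed.

Lemma measurable_affine (g : T -> R) (a b : R) : measurable_fun setT g ->
  measurable_fun setT (fun w => a + b * g w).
Proof. by move=> mg; apply: measurable_funD => //; exact: measurable_funM. Qed.

Lemma measurable_scale (g : T -> R) (b : R) : measurable_fun setT g ->
  measurable_fun setT (fun w => b * g w).
Proof. by move=> mg; exact: measurable_funM. Qed.

Lemma measurable_abs (g : T -> R) : measurable_fun setT g ->
  measurable_fun setT (fun w => `|g w|).
Proof. by move=> mg; exact: measurableT_comp. Qed.

Lemma prob_abs_le (V : probability T R) (g : T -> R) u : measurable_fun setT g ->
  prob V [set w | u < `|g w|] <=
  prob V [set w | u < g w] + prob V [set w | u < - g w].
Proof.
move=> mg; have m1 := measurable_gtr _ u mg.
have m2 : measurable [set w | u < - g w].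
  by apply: measurable_gtr; exact: measurableT_comp.
apply: le_trans (prob_setU_le V _ _ m1 m2); apply: le_prob.
- by apply: measurable_gtr; exact: measurable_abs.
- exact: measurableU.
- by move=> w /=; rewrite lter_normr => /orP.
Qed.

(** If [q] and [m * r] are both at most [(1 - dt) * t], their sum passes [t] only when each exceeds
    [dt * t]; this is the joint event of the last term. *)
Lemma prob_affine_le (V : probability T R) (r : T -> R) (q m t dt : R) : measurable_fun setT r ->
  prob V [set w | t < q + m * r w] <=
    ((1 - dt) * t < q)%R%:R + prob V [set w | (1 - dt) * t < m * r w]
    + (dt * t < `|q|)%R%:R * prob V [set w | dt * t < `|m * r w|].
Proof.
move=> mr.
have mm := measurable_scale _ m mr.
have m1 := measurable_gtr _ t (measurable_affine _ q m mr).
have m2 := measurable_gtr _ ((1 - dt) * t) mm.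
have m3 := measurable_gtr _ (dt * t) (measurable_abs _ mm).
have [qt|qt] := boolP ((1 - dt) * t < q)%R.
  by rewrite -addrA (le_trans (prob_le1 V _ m1))// lerDl addr_ge0 ?mulr_ge0 ?prob_ge0.
rewrite add0r -leNgt in qt *.
have [qd|qd] := boolP (dt * t < `|q|)%R.
  rewrite mul1r; apply: le_trans (prob_setU_le V _ _ m2 m3).
  apply: le_prob => //; first exact: measurableU.
  move=> w /= h; rewrite lter_normr.
  have [?|?] := ltrP ((1 - dt) * t) (m * r w); [by left|right].
  by apply/orP; left; lra.
rewrite mul0r addr0; apply: le_prob => // w /=.
by move: qd; rewrite -leNgt ler_norml => /andP[_]; lra.
Qed.

(** The factor 2 is needed when [q] is large: a very negative [m * r] may cancel it, and the two
    jump terms may both be counted although a probability is at most one. *)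
Lemma prob_affine_ge (V : probability T R) (r : T -> R) (q m t dt : R) : measurable_fun setT r ->
  0 < dt -> 0 < t ->
  ((1 + dt) * t < q)%R%:R + prob V [set w | (1 + dt) * t < m * r w]
    - 2 * ((dt * t < `|q|)%R%:R * prob V [set w | dt * t < `|m * r w|])
  <= prob V [set w | t < q + m * r w].
Proof.
move=> mr dt0 t0.
have dtt : 0 < dt * t by rewrite mulr_gt0.
have mm := measurable_scale _ m mr.
have m1 := measurable_gtr _ t (measurable_affine _ q m mr).
have m2 := measurable_gtr _ ((1 + dt) * t) mm.
have m3 := measurable_gtr _ (dt * t) (measurable_abs _ mm).
have h23 : prob V [set w | (1 + dt) * t < m * r w] <=
    prob V [set w | dt * t < `|m * r w|].
  apply: le_prob => // w /= h; rewrite lter_normr; apply/orP; left.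
  by move: h; lra.
have h3 := prob_ge0 V [set w | dt * t < `|m * r w|].
have [qt|qt] := boolP ((1 + dt) * t < q)%R.
  have -> : (dt * t < `|q|)%R = true by rewrite lter_normr; apply/orP; left; lra.
  have : 1 - prob V [set w | dt * t < `|m * r w|] <= prob V [set w | t < q + m * r w].
    rewrite -prob_setC//; apply: le_prob => //; first exact: measurableC.
    move=> w /= /negP; rewrite -leNgt ler_norml => /andP[]; lra.
  by rewrite /= !mulr1n mul1r; lra.
rewrite add0r.
have [qd|qd] := boolP (dt * t < `|q|)%R.
  by have := prob_ge0 V [set w | t < q + m * r w]; rewrite /= mulr1n mul1r; lra.
rewrite mul0r mulr0 subr0; apply: le_prob => // w /=.
by move: qd; rewrite -leNgt ler_norml => /andP[]; lra.
Qed.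

(* [e2] is chosen after [dt] because [P(|Q| > dt t) / P(|Q| > t)] behaves like
   [dt `^ (- alpha)], which is unbounded as [dt] tends to 0 *)
End RandomVariableEvents.

(** * Regularly varying tails: uniform estimates, Breiman's lemma, a single big jump *)

Section RegularlyVaryingTails.
Context {R : realType} {d : measure_display} {T : measurableType d}.
Variables (alpha : R) (f : R -> R) (F0 : R).
Hypothesis alpha0 : 0 < alpha.
Hypothesis f_noninc : forall x y : R, x <= y -> f y <= f x.
Hypothesis f_gt0 : forall x : R, 0 < f x.
Hypothesis f_le : forall x : R, f x <= F0.
Hypothesis f_rv : forall m : R, 0 < m -> forall e : R, 0 < e ->
  \forall u \near +oo, `|f (u / m) - m `^ alpha * f u| <= e * f u.

Let f_div (u x y : R) : 0 < u -> 0 < x -> x <= y -> f (u / x) <= f (u / y).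
Proof.
move=> u0 x0 xy; apply: f_noninc; rewrite ler_pM2l//.
by rewrite lef_pV2 ?posrE// (lt_le_trans x0).
Qed.

(** As [2^alpha < 2^b], halving a large argument multiplies [f] by at most [2^b], and this is
    iterated. Once the argument falls below [u0], boundedness takes over: [C] is chosen so that
    [F0 <= C * f u] there. *)
Lemma potter_dyadic (b : R) : alpha < b -> exists2 u0 : R, 0 < u0 &
  exists2 C : R, 1 <= C &
  forall n (u : R), u0 <= u -> f (u / 2 ^+ n) <= C * (2 `^ b) ^+ n * f u.
Proof.
have al0 := alpha0; move=> ab.
have h2 : 2 `^ alpha < 2 `^ b :> R.
  by rewrite /powR (_ : (2 == 0 :> R) = false) ?ltr_expR ?ltr_pM2r ?ln_gt0 ?ltr1n//; apply/eqP; lra.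
have [u0 u00 Hu0] := near_pinfty_ex _ (f_rv 2 ltac:(lra) (2 `^ b - 2 `^ alpha) ltac:(lra)).
have step u : u0 <= u -> f (u / 2) <= 2 `^ b * f u.
  by move=> /Hu0; rewrite ler_norml => /andP[_]; lra.
have B1 : 1 <= 2 `^ b :> R.
  by rewrite -[leLHS](powRr0 2); apply: ler_powR; [rewrite ler1n|lra].
exists u0 => //; exists (1 + F0 / f u0).
  by rewrite lerDl divr_ge0// ltW// (lt_le_trans (f_gt0 0)).
set C := 1 + _.
have C1 : 1 <= C by rewrite lerDl divr_ge0// ltW// (lt_le_trans (f_gt0 0)).
have CF u : u <= u0 -> F0 <= C * f u.
  move=> uu0; have h : F0 = F0 / f u0 * f u0 by rewrite divfK// gt_eqF.
  apply: (@le_trans _ _ (C * f u0)).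
    by rewrite {1}h ler_pM2r// lerDr ler01.
  by rewrite ler_pM2l ?f_noninc//; lra.
elim=> [|n IH] u u0u.
  by rewrite expr0 divr1 expr0 mulr1 ler_peMl// ltW.
rewrite exprS invfM mulrA exprS.
have [h|h] := lerP u0 (u / 2).
  apply: (le_trans (IH _ h)).
  rewrite [X in _ <= X](_ : _ = C * 2 `^ b ^+ n * (2 `^ b * f u)); last by ring.
  by apply: ler_wpM2l (step _ u0u); rewrite mulr_ge0// ?exprn_ge0 ?powR_ge0//; lra.
apply: (le_trans (f_le _)); apply: (le_trans (CF _ (ltW h))).
rewrite -!mulrA; apply: ler_wpM2l; first by lra.
apply: (le_trans (step _ u0u)); rewrite ler_wpM2l ?powR_ge0//.
by rewrite ler_peMl ?exprn_ege1// ltW.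
Qed.

(** Rounding [m] up to a power of two not above [2 * m] costs the factor [2^b], by monotonicity of
    [f]. *)
Lemma potter (b : R) : alpha < b -> exists2 u0 : R, 0 < u0 &
  exists2 C : R, 1 <= C &
  forall u m : R, u0 <= u -> 1 <= m -> f (u / m) <= C * m `^ b * f u.
Proof.
have al0 := alpha0; move=> ab; have [u0 u00 [C C1 H]] := potter_dyadic b ab.
have b0 : 0 < b by lra.
have B1 : 1 <= 2 `^ b :> R.
  by rewrite -[leLHS](powRr0 2); apply: ler_powR; [rewrite ler1n|lra].
exists u0 => //; exists (C * 2 `^ b).
  by rewrite -[leLHS]mulr1 ler_pM//; lra.
move=> u m u0u m1.
have exn : exists n, m <= 2 ^+ n.
  exists (Num.truncn m).+1.
  apply: (@le_trans _ _ (Num.truncn m).+1%:R); first exact/ltW/truncnS_gt.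
  by rewrite -natrX ler_nat ltnW// ltn_expl.
have [n mn n2m] : exists2 n, m <= 2 ^+ n & 2 ^+ n <= 2 * m.
  case: (ex_minnP exn) => -[m1' _|n mn nmin].
    by exists 0%N => //; rewrite expr0; lra.
  exists n.+1 => //; rewrite exprS ler_pM2l//.
  by have [//|/ltW /nmin] := lerP (2 ^+ n) m; rewrite ltnn.
have f2 : f (u / m) <= f (u / 2 ^+ n).
  apply: f_noninc; rewrite ler_pM2l; last lra.
  by rewrite lef_pV2// posrE ?exprn_gt0//; lra.
apply: (le_trans f2); apply: (le_trans (H _ _ u0u)).
rewrite ler_pM2r// -mulrA -powRM; [|lra..].
rewrite ler_pM2l; last lra.
rewrite -powR_mulrn ?powR_ge0// -powRrM mulrC powRrM powR_mulrn//.
by apply: ge0_ler_powR => //; rewrite ?nnegrE ?exprn_ge0//; lra.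
Qed.

(** Potter's bound with [m = u / u0] and an exponent [b'] between [alpha] and [b] compares [f u0]
    with [f u] and gives [u^(-b') <= K * f u]; the remaining factor [u^(-(b - b'))] tends to 0. *)
Lemma powRN_negligible (b e : R) : alpha < b -> 0 < e ->
  \forall u \near +oo, u `^ (- b) <= e * f u.
Proof.
have al0 := alpha0; move=> ab e0; set b' := (alpha + b) / 2.
have [u0 u00 [C C1 H]] := potter b' ltac:(rewrite /b'; lra).
pose K := C * u0 `^ (- b') / f u0.
have K0 : 0 < K by rewrite /K divr_gt0 ?mulr_gt0 ?powR_gt0//; lra.
have bb' : 0 < b - b' by rewrite /b'; lra.
near=> u.
have u0u : u0 <= u by near: u; exact: near_pinfty_ge.
have u_gt0 : 0 < u by lra.
have h : u `^ (- b') <= K * f u.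
  have := H u (u / u0) u0u; rewrite ler_pdivlMr// mul1r => /(_ u0u).
  rewrite invf_div mulrCA mulfV ?gt_eqF// mulr1.
  rewrite powRM ?invr_ge0; [|lra..].
  rewrite -powR_inv1 ?(ltW u00)// -powRrM mulN1r.
  rewrite powRN /K => hh.
  rewrite -(ler_pM2r (f_gt0 u0)) -mulrA.
  have un0 : 0 < u `^ b' by rewrite powR_gt0.
  rewrite ler_pdivrMl//; apply: (le_trans hh).
  rewrite le_eqVlt; apply/orP; left; apply/eqP.
  by field; rewrite gt_eqF.
have -> : - b = - (b - b') + - b' by ring.
rewrite powRD; last by rewrite (gt_eqF u_gt0) implybT.
have h2 : u `^ (- (b - b')) <= e / K.
  have eK : 0 < e / K by rewrite divr_gt0.
  rewrite powRN -[leRHS]invrK lef_pV2 ?posrE ?invr_gt0 ?powR_gt0//.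
  have : ((e / K)^-1) `^ (b - b')^-1 <= u by near: u; exact: near_pinfty_ge.
  move=> /(ge0_ler_powR (ltW bb')); rewrite !nnegrE powR_ge0 (ltW u_gt0).
  move=> /(_ isT isT); rewrite -powRrM mulVf ?gt_eqF// powRr1// invr_ge0.
  exact: ltW.
apply: (le_trans (ler_pM (powR_ge0 _ _) (powR_ge0 _ _) h2 h)).
by rewrite mulrA divfK// gt_eqF.
Unshelve. all: by end_near. Qed.

Let powR_inv_alpha x : 0 <= x -> (x `^ alpha^-1) `^ alpha = x.
Proof. by move=> x0; rewrite -powRrM mulVf ?gt_eqF// powRr1. Qed.

Let ltr_powR_alpha x y : 0 <= x -> 0 <= y -> (x `^ alpha < y `^ alpha) = (x < y).
Proof.
have al0 := alpha0; move=> x0 y0; apply/idP/idP; last first.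
  by move=> xy; apply: gt0_ltr_powR.
apply: contraTT; rewrite -!leNgt => yx.
by apply: ge0_ler_powR => //; exact: ltW.
Qed.

(** Near a point [x], monotonicity squeezes [f (u / y)] between its values for two fixed multipliers
    around [x], where pointwise regular variation applies; compactness of the segment makes this
    uniform. *)
Lemma rv_uniform_segment (a b e : R) : 0 < a -> 0 < e ->
  \forall u \near +oo, forall m : R, a <= m <= b ->
    `|f (u / m) - m `^ alpha * f u| <= e * f u.
Proof.
have al0 := alpha0; move=> a0 e0.
have /compact_near_coveringP/(_ R (nbhs +oo)
    (fun u m => `|f (u / m) - m `^ alpha * f u| <= e * f u) _) :=
  @segment_compact R a b.
move=> cov; apply: filterS (cov _) => [u|x /=].
  by move=> h m mab; apply: h => /=; rewrite in_itv.
rewrite in_itv/= => /andP[ax xb].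
have x0 : 0 < x by lra.
have xa0 : 0 < x `^ alpha by rewrite powR_gt0.
have [m1 m10 [g [g0 gl m1a]]] : exists2 m1 : R, 0 < m1 &
    exists g, [/\ 0 < g, g <= e / 4 & m1 `^ alpha = x `^ alpha - g].
  (* The first entry brings [m1^alpha] within [e / 4] of [x^alpha]; the second keeps it positive. *)
  pose g := Num.min (e / 4) (x `^ alpha / 2).
  have gx : 0 < x `^ alpha - g.
    by rewrite subr_gt0 gt_min; apply/orP; right; rewrite ltr_pdivrMr// ltr_pMr// ltr1n.
  exists ((x `^ alpha - g) `^ alpha^-1); first exact: powR_gt0.
  exists g; split; last by rewrite powR_inv_alpha// ltW.
    by rewrite lt_min !divr_gt0.
  by rewrite ge_min lexx.
have [m2 m20 m2a] : exists2 m2 : R, 0 < m2 & m2 `^ alpha = x `^ alpha + e / 4.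
  have gx : 0 < x `^ alpha + e / 4 by rewrite addr_gt0// divr_gt0.
  exists ((x `^ alpha + e / 4) `^ alpha^-1); first exact: powR_gt0.
  by rewrite powR_inv_alpha// ltW.
have m1x : m1 < x.
  by rewrite -ltr_powR_alpha ?(ltW m10) ?(ltW x0)// m1a ltrBlDr ltrDl.
have xm2 : x < m2.
  by rewrite -ltr_powR_alpha ?(ltW m20) ?(ltW x0)// m2a ltrDl divr_gt0.
have e40 : 0 < e / 4 by rewrite divr_gt0.
near=> y u => /=.
have u_gt0 : 0 < u.
  near: u; apply: nbhs_pinfty_gt; rewrite num_real//.
have y1 : m1 < y by near: y; exact: lt_nbhsr.
have y2 : y < m2 by near: y; exact: lt_nbhsl.
have H1 : `|f (u / m1) - m1 `^ alpha * f u| <= e / 4 * f u.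
  by near: u; exact: f_rv.
have H2 : `|f (u / m2) - m2 `^ alpha * f u| <= e / 4 * f u.
  by near: u; exact: f_rv.
have F1 : f (u / m1) <= f (u / y).
  by apply: f_div => //; exact: ltW.
have F2 : f (u / y) <= f (u / m2).
  by apply: f_div; [|exact: lt_trans y1|exact: ltW].
have y0 : 0 < y by exact: lt_trans y1.
have Y1 : m1 `^ alpha < y `^ alpha by rewrite ltr_powR_alpha// ltW.
have Y2 : y `^ alpha < m2 `^ alpha by rewrite ltr_powR_alpha// ltW.
have fu := f_gt0 u.
have Z1 : m1 `^ alpha * f u < y `^ alpha * f u by rewrite ltr_pM2r.
have Z2 : y `^ alpha * f u < m2 `^ alpha * f u by rewrite ltr_pM2r.
have Z3 : m2 `^ alpha * f u - m1 `^ alpha * f u <= e / 2 * f u.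
  by rewrite -mulrBl ler_pM2r//; rewrite m1a m2a; lra.
rewrite !ler_norml in H1 H2 *.
move: H1 H2 => /andP[H1 H1'] /andP[H2 H2'].
have e4 : e / 4 * f u = e * f u / 4 by ring.
have e2 : e / 2 * f u = e * f u / 2 by ring.
rewrite e4 in H1 H1' H2 H2'; rewrite e2 in Z3.
have ef : 0 < e * f u by rewrite mulr_gt0.
by apply/andP; split; lra.
Unshelve. all: by end_near. Qed.

(** Three ranges of [m]. Up to [a], where [a^alpha = e / 3], both terms are small; on [[a, A]]
    compactness applies; beyond [A], Potter's bound with exponent [b' < b] is absorbed, [A] being
    chosen so that [(C + 1) * m^b' <= e * m^b]. *)
Lemma rv_uniform (b e : R) : alpha < b -> 0 < e ->
  \forall u \near +oo, forall m : R, 0 < m ->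
    `|f (u / m) - m `^ alpha * f u| <= e * (1 + m `^ b) * f u.
Proof.
have al0 := alpha0; move=> ab e0; set b' := (alpha + b) / 2.
have [u0 u00 [C C1 H]] := potter b' ltac:(rewrite /b'; lra).
have bb' : 0 < b - b' by rewrite /b'; lra.
pose a := (e / 3) `^ alpha^-1.
have e30 : 0 < e / 3 by lra.
have aa : a `^ alpha = e / 3 by rewrite powR_inv_alpha//; lra.
have a0 : 0 < a by apply: powR_gt0; lra.
pose A := 1 + ((C + 1) / e) `^ (b - b')^-1.
have Ce0 : 0 < (C + 1) / e by rewrite divr_gt0//; lra.
have A1 : 1 <= A by rewrite lerDl powR_ge0.
have AE : ((C + 1) / e) `^ (b - b')^-1 <= A by rewrite /A; lra.
have b'a : alpha <= b' by rewrite /b'; lra.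
clearbody a A b'.
near=> u => m m0.
have fu := f_gt0 u.
have mb0 : 0 <= m `^ b by rewrite powR_ge0.
have u_gt0 : 0 < u by near: u; apply: nbhs_pinfty_gt; rewrite num_real.
have ef : 0 < e * f u by rewrite mulr_gt0.
have emf : 0 <= e * m `^ b * f u by rewrite mulr_ge0 ?mulr_ge0//; lra.
have E : e * (1 + m `^ b) * f u = e * f u + e * m `^ b * f u by ring.
have [ma|am] := lerP m a.
  have H1 : `|f (u / a) - a `^ alpha * f u| <= e / 3 * f u.
    by near: u; exact: f_rv.
  have F1 : f (u / m) <= f (u / a).
    by apply: f_div => //; lra.
  have F2 : m `^ alpha * f u <= a `^ alpha * f u.
    by rewrite ler_pM2r//; apply: ge0_ler_powR => //; rewrite ?nnegrE ltW.
  have F3 : 0 <= m `^ alpha * f u by rewrite mulr_ge0 ?powR_ge0// ltW.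
  rewrite aa in H1 F2.
  have e3 : e / 3 * f u = e * f u / 3 by ring.
  rewrite e3 in H1 F2.
  have := f_gt0 (u / m).
  move: H1; rewrite E !ler_norml => /andP[h1 h2] h3.
  by apply/andP; split; lra.
have [mA|Am] := lerP m A.
  have H1 : `|f (u / m) - m `^ alpha * f u| <= e * f u.
    suff : forall m : R, a <= m <= A -> `|f (u / m) - m `^ alpha * f u| <= e * f u.
      by apply; rewrite mA ltW.
    by near: u; exact: rv_uniform_segment.
  by rewrite E; lra.
have m1 : 1 <= m by lra.
have u0u : u0 <= u by near: u; exact: near_pinfty_ge.
have F1 := H _ _ u0u m1.
have F2 : m `^ alpha * f u <= m `^ b' * f u.
  by rewrite ler_pM2r//; apply: ler_powR.
have F3 : (C + 1) * m `^ b' <= e * m `^ b.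
  have mbb' : C + 1 <= m `^ (b - b') * e.
    rewrite -ler_pdivrMr//.
    have /(ge0_ler_powR (ltW bb')) : ((C + 1) / e) `^ (b - b')^-1 <= m by lra.
    rewrite !nnegrE powR_ge0 (ltW m0) => /(_ isT isT).
    by rewrite -powRrM mulVf ?gt_eqF// powRr1// ltW.
  have -> : m `^ b = m `^ b' * m `^ (b - b').
    by rewrite -powRD ?(gt_eqF m0) ?implybT// addrC subrK.
  rewrite [leRHS](_ : _ = m `^ (b - b') * e * m `^ b'); last by ring.
  by rewrite ler_wpM2r// powR_ge0.
have F4 : (C + 1) * m `^ b' * f u <= e * m `^ b * f u by rewrite ler_pM2r.
have F5 : 0 <= m `^ alpha * f u by rewrite mulr_ge0 ?powR_ge0// ltW.
have := f_gt0 (u / m).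
have F6 : 0 <= m `^ b' * f u by rewrite mulr_ge0 ?powR_ge0// ltW.
have F7 : (C + 1) * m `^ b' * f u = C * m `^ b' * f u + m `^ b' * f u by ring.
have F8 : 0 <= C * m `^ b' * f u by rewrite !mulr_ge0 ?powR_ge0 ?(ltW fu)// (le_trans ler01).
move=> F9; rewrite ler_norml E; apply/andP; split; lra.
Unshelve. all: by end_near. Qed.

(** For a multiplier with small [m^alpha], regular variation at a single [S] makes [f (S / m)] at
    most [3 / 4 * e]; monotonicity does the rest. *)
Lemma rv_cvg0 (e : R) : 0 < e -> \forall u \near +oo, f u < e.
Proof.
have al0 := alpha0; move=> e0.
have F00 : 0 < F0 by apply: lt_le_trans (f_le 0).
pose m := (e / (2 * F0)) `^ alpha^-1.
have E0 : 0 < e / (2 * F0) by rewrite divr_gt0// mulr_gt0.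
have m0 : 0 < m by rewrite powR_gt0.
have ma : m `^ alpha = e / (2 * F0) by rewrite powR_inv_alpha//; lra.
have [S S0 HS] := near_pinfty_ex _ (f_rv m m0 (e / (4 * F0)) ltac:(rewrite divr_gt0 ?mulr_gt0//)).
near=> u.
have /f_noninc : S / m <= u by near: u; exact: near_pinfty_ge.
move=> /le_lt_trans; apply.
have := HS S (lexx _); rewrite ma ler_norml => /andP[_ h].
have h2 : f S * (e / (4 * F0) + e / (2 * F0)) <= F0 * (e / (4 * F0) + e / (2 * F0)).
  by rewrite ler_pM2r// addr_gt0// divr_gt0// mulr_gt0.
have h3 : F0 * (e / (4 * F0) + e / (2 * F0)) = 3 / 4 * e by field; rewrite gt_eqF.
rewrite h3 in h2; lra.
Unshelve. all: by end_near. Qed.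

(* [mom alpha eta m] is the expectation of [spow eta m] *)
Definition spow (eta m : R) := `|m| `^ alpha * (if 0 < eta * m then 1 else 0).

Lemma spow_ge0 eta m : 0 <= spow eta m.
Proof. by rewrite /spow; case: ifP => _; rewrite ?mulr1 ?mulr0// powR_ge0. Qed.

Lemma spowD m : spow 1 m + spow (-1) m = `|m| `^ alpha.
Proof.
rewrite /spow mul1r mulN1r oppr_gt0.
have [m0|m0|->] := ltgtP m 0; rewrite ?mulr1 ?mulr0 ?addr0 ?add0r//.
by rewrite normr0 powR0// gt_eqF.
Qed.

Lemma spowN eta m : spow eta (- m) = spow (- eta) m.
Proof. by rewrite /spow normrN mulrN mulNr. Qed.

(** Both tails of [r] under [V] are described, with constants [k] and [k'], since a multiplier of
    either sign may follow. The threshold [S] is part of the data so that later bounds are uniform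
    over all [V] and [r] sharing it. *)
Definition tails (V : probability T R) (r : T -> R) (S k k' e : R) :=
  [/\ measurable_fun setT r,
    forall s, S <= s -> `|prob V [set w | s < r w] - k * f s| <= e * f s &
    forall s, S <= s -> `|prob V [set w | s < - r w] - k' * f s| <= e * f s].

Lemma tailsN V r S k k' e : tails V r S k k' e ->
  tails V (fun w => - r w) S k' k e.
Proof.
case=> mr h1 h2; split => [|//|s Ss]; first exact: measurableT_comp.
by under eq_set do rewrite opprK; exact: h1.
Qed.

(** Breiman's lemma for a deterministic multiplier. The given error [dl] is carried along with the
    exact factor [|m|^alpha], whose expectation will be the contraction constant; everything else
    goes into an arbitrarily small multiple of [1 + |m|^b]. *)
Lemma tail_mul (b e dl S K : R) : alpha < b -> 0 < e -> 0 <= dl -> 0 < S ->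
  \forall u \near +oo, forall V r k k' m, `|k| <= K -> `|k'| <= K ->
    tails V r S k k' dl ->
    `|prob V [set w | u < m * r w]
      - (k * spow 1 m + k' * spow (-1) m) * f u|
    <= (dl * `|m| `^ alpha + e * (1 + `|m| `^ b)) * f u.
Proof.
have al0 := alpha0; move=> ab e0 dl0 S0.
have b0 : 0 < b by lra.
have K1 : 0 < `|K| + dl + 1 by rewrite ltr_wpDl// addr_ge0.
have KF : 0 < 1 + (`|K| + dl + 1) * F0.
  by rewrite ltr_wpDr// mulr_ge0// ltW// (lt_le_trans (f_gt0 0)).
pose e1 := e / 2 / (`|K| + dl + 1).
have e20' : 0 < e / 2 by rewrite divr_gt0.
have e10 : 0 < e1 by rewrite divr_gt0.
have e1E : (`|K| + dl + 1) * e1 = e / 2 by rewrite mulrC divfK// gt_eqF.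
clearbody e1.
pose e2 := e / 2 / ((1 + (`|K| + dl + 1) * F0) * S `^ b).
have e20 : 0 < e2 by rewrite divr_gt0// mulr_gt0// powR_gt0.
near=> u => V r k k' m kK k'K tl.
have u0 : 0 < u.
  by near: u; apply: nbhs_pinfty_gt; rewrite num_real.
have U1 : forall m : R, 0 < m ->
    `|f (u / m) - m `^ alpha * f u| <= e1 * (1 + m `^ b) * f u.
  by near: u; exact: rv_uniform.
have U2 : u `^ (- b) <= e2 * f u by near: u; exact: powRN_negligible.
(* Negating both [r] and [m] keeps their product and exchanges the two tail constants. *)
wlog m0 : r k k' m kK k'K tl / 0 <= m.
  move=> H; have [/H|m0] := lerP 0 m; first exact.
  have := H _ _ _ (- m) k'K kK (tailsN _ _ _ _ _ _ tl).
  rewrite oppr_ge0 => /(_ (ltW m0)).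
  under eq_set do rewrite mulrNN.
  by rewrite !spowN opprK normrN (addrC (k' * _)).
have fu := f_gt0 u.
have mb0 : 0 <= m `^ b by rewrite powR_ge0.
have [->|mn0] := eqVneq m 0.
  rewrite [X in prob _ X](_ : _ = set0); last first.
    by apply/seteqP; split => w //=; rewrite mul0r ltNge (ltW u0).
  rewrite prob_set0 /spow normr0 !powR0 ?gt_eqF//.
  rewrite !(mul0r, mulr0, addr0, add0r, subr0, oppr0, normr0, mulr1).
  by apply: mulr_ge0; exact: ltW.
have {m0 mn0}m0 : 0 < m by rewrite lt_def mn0.
have ma0 : 0 <= m `^ alpha by rewrite powR_ge0.
rewrite /spow mul1r mulN1r oppr_gt0 m0 (gtr0_norm m0) ltNge (ltW m0) /=.
rewrite mulr1 !mulr0 addr0.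
case: tl => mr tl _.
rewrite [X in prob _ X](_ : _ = [set w | u / m < r w]); last first.
  by apply/seteqP; split => w /=; rewrite ltr_pdivrMr// mulrC.
have Ka : `|k| <= `|K| by apply: (le_trans kK); exact: ler_norm.
have [Su|uS] := lerP S (u / m).
  have {}tl := tl _ Su.
  have Um := U1 _ m0.
  rewrite (_ : _ - _ = (prob V [set w | u / m < r w] - k * f (u / m))
     + k * (f (u / m) - m `^ alpha * f u)); last by ring.
  apply: (le_trans (ler_normD _ _)); rewrite normrM.
  have h1 : `|k| * `|f (u / m) - m `^ alpha * f u| <=
      `|K| * (e1 * (1 + m `^ b) * f u) by exact: ler_pM.
  have h2 : dl * f (u / m) <= dl * (m `^ alpha * f u + e1 * (1 + m `^ b) * f u).
    by apply: ler_wpM2l => //; move: Um; rewrite ler_norml => /andP[_]; lra.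
  apply: (le_trans (lerD (le_trans tl h2) h1)).
  rewrite [leRHS](_ : _ = dl * (m `^ alpha * f u) + e * ((1 + m `^ b) * f u)); last by ring.
  rewrite [leLHS](_ : _ = dl * (m `^ alpha * f u)
     + (`|K| + dl) * e1 * ((1 + m `^ b) * f u)); last by ring.
  rewrite lerD2l ler_wpM2r//; first by rewrite mulr_ge0// ?(ltW fu)// addr_ge0.
  apply: (@le_trans _ _ (e / 2)); last by rewrite ler_pdivrMr// ler_peMr ?ler1n// ltW.
  by rewrite -e1E ler_wpM2r ?(ltW e10)// lerDl.
(* Here [u / m < S], so nothing is known about the tail of [r]. The trivial bound 1 is at most
   [(m * S / u)^b], and [u^(-b)] is negligible against [f u]. *)
have um : 1 <= (m * S / u) `^ b.
  rewrite -[leLHS](powR1E b); apply: ge0_ler_powR; rewrite ?nnegrE ?ler01 ?(ltW b0)//.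
    by rewrite divr_ge0 ?mulr_ge0// ltW.
  by rewrite ler_pdivlMr// mul1r mulrC -ler_pdivrMr// ltW.
have up : (m * S / u) `^ b = m `^ b * S `^ b * u `^ (- b).
  rewrite powRM ?invr_ge0 ?mulr_ge0 ?(ltW m0) ?(ltW S0) ?(ltW u0)//.
  rewrite powRM ?(ltW m0) ?(ltW S0)//.
  by rewrite -[u^-1]powR_inv1 ?(ltW u0)// -powRrM mulN1r.
have P1 : `|prob V [set w | u / m < r w] - k * m `^ alpha * f u| <=
   1 + `|k| * (m `^ alpha * f u).
  apply: (le_trans (ler_normB _ _)); rewrite -mulrA normrM (ger0_norm (mulr_ge0 ma0 (ltW fu))).
  by rewrite lerD2r ger0_norm ?prob_ge0// prob_le1//; exact: measurable_gtr.
have P2 : `|k| * (m `^ alpha * f u) <= `|K| * F0 + `|K| * (e1 * (1 + m `^ b) * f u).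
  rewrite -mulrDr; apply: ler_pM => //; first by rewrite mulr_ge0// ltW.
  by have := U1 _ m0; have := f_le (u / m); rewrite ler_norml => ? /andP[]; lra.
have P3 : 1 + `|K| * F0 <= e / 2 * m `^ b * f u.
  apply: (@le_trans _ _ ((1 + (`|K| + dl + 1) * F0) * (m * S / u) `^ b)).
    rewrite -[leLHS]mulr1; apply: ler_pM => //.
      by rewrite addr_ge0// mulr_ge0// ltW// (lt_le_trans (f_gt0 0)).
    rewrite lerD2l ler_wpM2r//; first by rewrite ltW// (lt_le_trans (f_gt0 0)).
    by rewrite -addrA lerDl addr_ge0.
  rewrite up; apply: (@le_trans _ _ ((1 + (`|K| + dl + 1) * F0) * (m `^ b * S `^ b * (e2 * f u)))).
    by rewrite ler_pM2l// ler_wpM2l// mulr_ge0// powR_ge0.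
  rewrite le_eqVlt; apply/orP; left; apply/eqP; rewrite /e2; field.
  by rewrite !gt_eqF// powR_gt0.
have P4 : `|K| * (e1 * (1 + m `^ b) * f u) <= e / 2 * (1 + m `^ b) * f u.
  rewrite !mulrA; apply: ler_wpM2r; first exact: ltW.
  apply: ler_wpM2r; first by rewrite addr_ge0.
  by rewrite -e1E ler_wpM2r ?(ltW e10)// -addrA lerDl addr_ge0.
apply: (le_trans P1).
have P5 : 0 <= dl * m `^ alpha * f u by rewrite !mulr_ge0// ltW.
have P6 : 0 <= e * f u by rewrite mulr_ge0// ltW.
rewrite [leRHS](_ : _ = dl * m `^ alpha * f u + e / 2 * m `^ b * f u
  + e / 2 * (1 + m `^ b) * f u + e * f u / 2); last by field.
clear -P2 P3 P4 P5 P6; lra.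
Unshelve. all: by end_near. Qed.

(** The multipliers [m1 > 1 > m2] have [alpha]-powers [1 + e / 2] and its inverse; [dt] is so small
    that [1 - dt] and [1 + dt] lie between [m1^-1] and [m2^-1], and monotonicity concludes. *)
Lemma rv_shift (e : R) : 0 < e -> exists2 dt : R, 0 < dt < 2^-1 &
  \forall t \near +oo,
    f ((1 - dt) * t) <= (1 + e) * f t /\ (1 - e) * f t <= f ((1 + dt) * t).
Proof.
move=> e0; have al0 := alpha0.
have a1 : alpha^-1 * alpha = 1 by rewrite mulVf// gt_eqF.
have e1 : 1 < (1 + e / 2) `^ alpha^-1.
  by rewrite -[ltLHS](powR1E alpha^-1) gt0_ltr_powR ?invr_gt0 ?nnegrE//; lra.
have e2 : (1 + e / 2)^-1 `^ alpha^-1 < 1.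
  rewrite -[ltRHS](powR1E alpha^-1) gt0_ltr_powR ?invr_gt0 ?nnegrE ?invr_ge0//; try lra.
  by rewrite invf_lt1; lra.
have e20 : 0 < 1 + e / 2 by rewrite addr_gt0 ?divr_gt0.
have m10 := powR_gt0 alpha^-1 e20.
have m20 : 0 < (1 + e / 2)^-1 `^ alpha^-1 by rewrite powR_gt0 ?invr_gt0.
pose m1 := (1 + e / 2) `^ alpha^-1; pose m2 := (1 + e / 2)^-1 `^ alpha^-1.
have m1a : m1 `^ alpha = 1 + e / 2 by rewrite -powRrM a1 powRr1//; lra.
have m2a : m2 `^ alpha = (1 + e / 2)^-1.
  by rewrite -powRrM a1 powRr1// invr_ge0; lra.
rewrite -/m1 in e1 m10; rewrite -/m2 in e2 m20.
clearbody m1 m2.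
have [dt [dt0 dt1 dt2]] : exists dt : R, [/\ 0 < dt < 2^-1,
    m1^-1 <= 1 - dt & 1 + dt <= m2^-1].
  have h1 : m1^-1 < 1 by rewrite invf_lt1.
  have h2 : 1 < m2^-1 by rewrite invf_gt1.
  pose g := Num.min 3^-1 (Num.min (1 - m1^-1) (m2^-1 - 1)).
  have q1 : g <= 3^-1 by rewrite ge_min lexx.
  have q2 : g <= 1 - m1^-1 by rewrite !ge_min lexx !orbT.
  have q3 : g <= m2^-1 - 1 by rewrite !ge_min lexx !orbT.
  exists g; split.
  - rewrite !lt_min invr_gt0 ltr0n !subr_gt0 h1 h2/=.
    by apply: (le_lt_trans q1); rewrite ltf_pV2 ?posrE// ltr_nat.
  - by rewrite lerBrDr addrC -lerBrDr.
  - by rewrite addrC -lerBrDr.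
(* With this error the lower bound is [(1 - e / 2) / (1 + e / 2)], which is at least [1 - e]. *)
pose e' := (1 + e / 2)^-1 * (e / 2).
have e'0 : 0 < e' by rewrite mulr_gt0 ?invr_gt0 ?addr_gt0 ?divr_gt0.
exists dt => //; near=> t.
have t0 : 0 < t by near: t; apply: nbhs_pinfty_gt; rewrite num_real.
have H1 : `|f (t / m1) - m1 `^ alpha * f t| <= e / 2 * f t.
  by near: t; apply: f_rv => //; rewrite divr_gt0.
have H2 : `|f (t / m2) - m2 `^ alpha * f t| <= e' * f t.
  by near: t; exact: f_rv.
have ft := f_gt0 t.
split.
  apply: (@le_trans _ _ (f (t / m1))).
    by apply: f_noninc; rewrite mulrC ler_pM2r.
  by move: H1; rewrite m1a ler_norml => /andP[_]; lra.
apply: (@le_trans _ _ (f (t / m2))); last first.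
  by apply: f_noninc; rewrite [leRHS]mulrC ler_pM2r.
have E : (1 - e) * f t <= ((1 + e / 2)^-1 - e') * f t.
  rewrite ler_pM2r// /e' -[X in _ <= X - _]mulr1 -mulrBr.
  rewrite ler_pdivlMl ?addr_gt0 ?divr_gt0//.
  have : 0 <= e ^+ 2 by rewrite sqr_ge0.
  by rewrite expr2; nra.
by move: H2; rewrite m2a ler_norml => /andP[+ _]; lra.
Unshelve. all: by end_near. Qed.

(** A crude form of Breiman's bound, with error 1 and both signs of [m]; only the order of magnitude
    matters for the joint event. *)
Lemma tail_mul_abs (b dl S K : R) : alpha < b -> 0 <= dl -> 0 < S -> 
  exists2 C : R, 0 < C & \forall u \near +oo, forall V r k k' m,
    `|k| <= K -> `|k'| <= K -> tails V r S k k' dl ->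
    prob V [set w | u < `|m * r w|] <= C * (1 + `|m| `^ b) * f u.
Proof.
move=> ab dl0 S0; have al0 := alpha0.
have K0 : 0 <= `|K| by [].
exists (2 * (2 * `|K| + dl + 1)); first by lra.
near=> u => V r k k' m kK k'K tl.
have TM : forall V r k k' m, `|k| <= K -> `|k'| <= K ->
    tails V r S k k' dl ->
    `|prob V [set w | u < m * r w]
      - (k * spow 1 m + k' * spow (-1) m) * f u|
    <= (dl * `|m| `^ alpha + 1 * (1 + `|m| `^ b)) * f u.
  by near: u; exact: tail_mul.
have h1 := TM _ _ _ _ m kK k'K tl.
have h2 := TM _ _ _ _ (- m) kK k'K tl.
case: (tl) => mr _ _.
apply: (le_trans (prob_abs_le _ _ _ (measurable_scale _ m mr))).
under [X in _ + prob _ X]eq_set do rewrite -mulNr.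
have fu := f_gt0 u.
have ma : `|m| `^ alpha <= 1 + `|m| `^ b by apply: powR_le1D => //; lra.
have s m' : `|m'| = `|m| -> (k * spow 1 m' + k' * spow (-1) m') * f u <=
    2 * `|K| * (1 + `|m| `^ b) * f u.
  move=> mm'; rewrite ler_pM2r//.
  have KK : K <= `|K| by exact: ler_norm.
  have s1 : 0 <= spow 1 m' by exact: spow_ge0.
  have s2 : 0 <= spow (-1) m' by exact: spow_ge0.
  have s3 : spow 1 m' + spow (-1) m' = `|m| `^ alpha by rewrite spowD mm'.
  have k1 : k * spow 1 m' <= `|K| * `|m| `^ alpha.
    apply: (@le_trans _ _ (`|K| * spow 1 m')).
      by apply: ler_wpM2r => //; have := ler_norm k; lra.
    by apply: ler_wpM2l => //; rewrite -s3 lerDl.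
  have k2 : k' * spow (-1) m' <= `|K| * `|m| `^ alpha.
    apply: (@le_trans _ _ (`|K| * spow (-1) m')).
      by apply: ler_wpM2r => //; have := ler_norm k'; lra.
    by apply: ler_wpM2l => //; rewrite -s3 lerDr.
  have : `|K| * `|m| `^ alpha <= `|K| * (1 + `|m| `^ b) by exact: ler_wpM2l.
  by lra.
have s1 := s m erefl; have s2 := s (- m) (normrN _).
have dm : dl * `|m| `^ alpha * f u <= dl * (1 + `|m| `^ b) * f u.
  by rewrite ler_pM2r//; exact: ler_wpM2l.
rewrite normrN in h2.
move: h1 h2; rewrite !ler_norml => /andP[_ h1] /andP[_ h2].
lra.
Unshelve. all: by end_near. Qed.

(** For [|m| <= A] the probability tends to 0 and is at most [e]; for larger [|m|] an exponent
    [b' < b] is absorbed into [e * |m|^b]. The constant [e] is affordable because it will multiply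
    the indicator of a large [q], whose probability is itself of order [f t]. *)
Lemma joint_tail (b dl S K e dt : R) :
  alpha < b -> 0 <= dl -> 0 < S -> 0 < e -> 0 < dt ->
  \forall t \near +oo, forall V r k k' m,
    `|k| <= K -> `|k'| <= K -> tails V r S k k' dl ->
    prob V [set w | dt * t < `|m * r w|] <= e + e * `|m| `^ b * f t.
Proof.
move=> ab dl0 S0 e0 dt0; have al0 := alpha0.
set b' := (alpha + b) / 2.
have ab' : alpha < b' by rewrite /b'; lra.
have bb' : b - b' > 0 by rewrite /b'; lra.
have b'0 : 0 <= b' by rewrite (le_trans (ltW al0))// ltW.
clearbody b'.
have [C C0 HC] := tail_mul_abs b' dl S K ab' dl0 S0.
have [T1 T10 HT1] := near_pinfty_ex _ HC.
have [T2 T20 HT2] := near_pinfty_ex _ (f_rv dt^-1 ltac:(rewrite invr_gt0//) 1 ltac:(lra)).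
pose C1 := 2 * C * (dt^-1 `^ alpha + 1).
have C10 : 0 < C1 by rewrite !mulr_gt0// ltr_wpDl// powR_ge0.
pose A := 1 + (C1 / e) `^ (b - b')^-1.
have A1 : 1 <= A by rewrite lerDl powR_ge0.
have AC : C1 <= e * A `^ (b - b').
  rewrite -ler_pdivrMl// mulrC.
  rewrite -[leLHS](@powRr1 _ (C1 / e)); last by rewrite divr_ge0// ltW.
  rewrite -[X in _ `^ X <= _](@mulVf _ (b - b')) ?gt_eqF// powRrM.
  apply: ge0_ler_powR; rewrite ?nnegrE ?powR_ge0 ?(ltW bb')//.
    by rewrite (le_trans ler01).
  by rewrite lerDr.
clearbody A.
have A0 : 0 < A by lra.
have CA : 0 < C * (1 + A `^ b') by rewrite mulr_gt0// ltr_wpDr// powR_ge0.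
have [T3 T30 HT3] := near_pinfty_ex _ (rv_cvg0 _ (divr_gt0 e0 CA)).
near=> t => V r k k' m kK k'K tl.
have t0 : 0 < t by near: t; apply: nbhs_pinfty_gt; rewrite num_real.
have t1 : T1 <= dt * t.
  by rewrite mulrC -ler_pdivrMr//; near: t; exact: near_pinfty_ge.
have t2 : T2 <= t by near: t; exact: near_pinfty_ge.
have t3 : T3 <= dt * t.
  by rewrite mulrC -ler_pdivrMr//; near: t; exact: near_pinfty_ge.
have h := HT1 _ t1 V r k k' m kK k'K tl.
have [mA|Am] := lerP `|m| A.
  apply: (@le_trans _ _ e); last first.
    by rewrite lerDl !mulr_ge0 ?powR_ge0 ?(ltW e0) ?(ltW (f_gt0 _)).
  apply: (le_trans h); have /ltW := HT3 _ t3.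
  rewrite ler_pdivlMr// mulrC; apply: le_trans.
  rewrite ler_wpM2r ?(ltW (f_gt0 _))// ler_wpM2l ?(ltW C0)// lerD2l.
  by apply: ge0_ler_powR; rewrite ?nnegrE// ltW.
apply: (@le_trans _ _ (e * `|m| `^ b * f t)); last by rewrite lerDr ltW.
apply: (le_trans h).
have ft := f_gt0 t.
have m0 : 0 < `|m| by exact: lt_trans Am.
have f1 : f (dt * t) <= (dt^-1 `^ alpha + 1) * f t.
  have := HT2 _ t2; rewrite invrK mulrC ler_norml => /andP[_].
  by lra.
have b1 : 1 + `|m| `^ b' <= 2 * `|m| `^ b'.
  have : 1 <= `|m| `^ b'.
    by rewrite -[leLHS](powR1E b') ge0_ler_powR ?nnegrE// (le_trans A1)// ltW.
  by lra.
apply: (@le_trans _ _ (C1 * `|m| `^ b' * f t)).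
  rewrite [leRHS](_ : _ = C * (2 * `|m| `^ b') * ((dt^-1 `^ alpha + 1) * f t)); last by rewrite /C1; ring.
  apply: ler_pM => //.
  - by rewrite mulr_ge0 ?(ltW C0)// addr_ge0// powR_ge0.
  - exact: ltW.
  - by rewrite ler_pM2l.
rewrite ler_pM2r//.
have -> : `|m| `^ b = `|m| `^ (b - b') * `|m| `^ b'.
  by rewrite -powRD ?(gt_eqF m0) ?implybT// subrK.
rewrite mulrA ler_wpM2r ?powR_ge0//.
apply: (le_trans AC); rewrite ler_pM2l//.
by apply: ge0_ler_powR; rewrite ?nnegrE ?(ltW bb') ?(ltW A0) ?(ltW Am).
Unshelve. all: by end_near. Qed.

(* Single big jump: outside the joint event [dt * t < |q|], [dt * t < |m r|],
   [q + m r] exceeds [t] essentially iff [q] or [m r] does *)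
Lemma affine_tail (b dl S K e : R) : alpha < b -> 0 <= dl -> 0 < S -> 0 < e ->
  exists2 dt : R, 0 < dt < 2^-1 &
  (\forall t \near +oo,
    f ((1 - dt) * t) <= (1 + e) * f t /\ (1 - e) * f t <= f ((1 + dt) * t)) /\
  forall e2 : R, 0 < e2 -> \forall t \near +oo, forall V r k k' q m,
    `|k| <= K -> `|k'| <= K -> tails V r S k k' dl ->
    prob V [set w | t < q + m * r w] <=
      ((1 - dt) * t < q)%R%:R + e2 * (dt * t < `|q|)%R%:R
      + (k * spow 1 m + k' * spow (-1) m
         + (dl * `|m| `^ alpha + e * (1 + `|m| `^ b))) * f t /\
    ((1 + dt) * t < q)%R%:R - e2 * (dt * t < `|q|)%R%:R
      + (k * spow 1 m + k' * spow (-1) m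
         - (dl * `|m| `^ alpha + e * (1 + `|m| `^ b))) * f t
    <= prob V [set w | t < q + m * r w].
Proof.
move=> ab dl0 S0 e0; have al0 := alpha0.
have [K' KK' K'0] : exists2 K' : R, K <= K' & 0 <= K'.
  by exists `|K| => //; exact: ler_norm.
(* Up to the factor [1 + |m|^b], [D] bounds the coefficients of [f] in the tail of [m * r];
   [e1 * D <= e / 2] then pays for replacing [f ((1 - dt) * t)] and [f ((1 + dt) * t)] by [f t]. *)
pose D := 2 * K' + dl + 3.
have D0 : 0 < D by rewrite /D; lra.
have [e1 e10 [e1D e1e e11]] : exists2 e1 : R, 0 < e1 & [/\ e1 * D <= e / 2, e1 <= e / 8 & e1 <= 1].
  pose g := Num.min (e / 2 / D) (Num.min (e / 8) 1).
  exists g; first by rewrite !lt_min !divr_gt0//=.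
  by split; rewrite ?ge_min ?lexx ?orbT// -ler_pdivlMr// ge_min lexx.
have [dt dtb Hsh] := rv_shift e1 e10.
have [dt0 dt1] : 0 < dt /\ dt < 2^-1 by apply/andP.
exists dt => //; split.
  near=> t; have [h1 h2] : f ((1 - dt) * t) <= (1 + e1) * f t /\
    (1 - e1) * f t <= f ((1 + dt) * t) by near: t; exact: Hsh.
  have ft := f_gt0 t.
  have : e1 * f t <= e * f t by rewrite ler_pM2r//; lra.
  by split; lra.
have H1 := near_pinfty_ex _ (tail_mul b e1 dl S K ab e10 dl0 S0).
have [T1 T10 {}H1] := H1.
move=> e2 e20.
have [e3 e30 [e3e e32]] : exists2 e3 : R, 0 < e3 & e3 <= e / 8 /\ 2 * e3 <= e2.
  pose g := Num.min (e / 8) (e2 / 2).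
  exists g; first by rewrite lt_min !divr_gt0.
  by split; [rewrite ge_min lexx|rewrite mulrC -ler_pdivlMr// ge_min lexx orbT].
have H2 := joint_tail b dl S K e3 dt ab dl0 S0 e30 dt0.
near=> t => V r k k' q m kK k'K tl.
have t0 : 0 < t by near: t; apply: nbhs_pinfty_gt; rewrite num_real.
have [t1 t2] : T1 <= (1 - dt) * t /\ T1 <= (1 + dt) * t.
  have tT : 2 * T1 <= t by near: t; exact: near_pinfty_ge.
  have : 0 < dt * t by rewrite mulr_gt0.
  have : dt * t < 2^-1 * t by rewrite ltr_pM2r.
  by split; lra.
have [f1 f2] : f ((1 - dt) * t) <= (1 + e1) * f t /\
    (1 - e1) * f t <= f ((1 + dt) * t) by near: t; exact: Hsh.
have J : prob V [set w | dt * t < `|m * r w|] <= e3 + e3 * `|m| `^ b * f t.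
  by move: V r k k' m kK k'K tl; near: t; exact: H2.
have M1 := H1 _ t1 V r k k' m kK k'K tl.
have M2 := H1 _ t2 V r k k' m kK k'K tl.
have [mr _ _] := tl.
have U := prob_affine_le V r q m t dt mr.
have L := prob_affine_ge V r q m t dt mr dt0 t0.
have ft := f_gt0 t.
have f3 : f t <= f ((1 - dt) * t).
  by apply: f_noninc; rewrite ler_piMl ?(ltW t0)// lerBlDr lerDl ltW.
have f4 : f ((1 + dt) * t) <= f t.
  by apply: f_noninc; rewrite ler_peMl ?(ltW t0)// lerDl ltW.
have mb0 : 0 <= `|m| `^ b by exact: powR_ge0.
have ma0 : 0 <= `|m| `^ alpha by exact: powR_ge0.
have mab : `|m| `^ alpha <= 1 + `|m| `^ b by apply: powR_le1D => //; rewrite !ltW.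
set B := k * spow 1 m + k' * spow (-1) m in M1 M2 *.
have B1 : `|B| <= 2 * K' * (1 + `|m| `^ b).
  have s1 : 0 <= spow 1 m by exact: spow_ge0.
  have s2 : 0 <= spow (-1) m by exact: spow_ge0.
  have s3 : spow 1 m + spow (-1) m = `|m| `^ alpha by rewrite spowD.
  apply: (le_trans (ler_normD _ _)); rewrite (normrM k) (normrM k') (ger0_norm s1) (ger0_norm s2).
  have k1 : `|k| * spow 1 m <= K' * (1 + `|m| `^ b).
    by apply: ler_pM; rewrite ?(le_trans (kK))// (le_trans _ mab)// -s3 lerDl.
  have k2 : `|k'| * spow (-1) m <= K' * (1 + `|m| `^ b).
    by apply: ler_pM; rewrite ?(le_trans (k'K))// (le_trans _ mab)// -s3 lerDr.
  apply: (le_trans (lerD k1 k2)).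
  by rewrite -mulrA [leRHS]mulr_natl mulr2n.
set G := dl * `|m| `^ alpha + e1 * (1 + `|m| `^ b) in M1 M2.
have G0 : 0 <= G by rewrite addr_ge0 ?mulr_ge0 ?(ltW e10)// addr_ge0.
have G1 : G <= (dl + 1) * (1 + `|m| `^ b).
  rewrite mulrDl lerD//; first exact: ler_wpM2l.
  by apply: ler_wpM2r => //; lra.
have Q1 (x : R) : `|x| <= e1 * f t -> 
    `|B * x| + G * `|x| <= e / 2 * (1 + `|m| `^ b) * f t.
  move=> xf; rewrite normrM -mulrDl.
  have hb : `|B| + G <= D * (1 + `|m| `^ b).
    apply: (le_trans (lerD B1 G1)); rewrite -mulrDl ler_wpM2r ?addr_ge0//.
    by rewrite /D -[leRHS]addrA !lerD2l ler1n.
  apply: (@le_trans _ _ (D * (1 + `|m| `^ b) * (e1 * f t))).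
    by apply: ler_pM => //; rewrite addr_ge0.
  rewrite [leLHS](_ : _ = e1 * D * ((1 + `|m| `^ b) * f t)); last by ring.
  rewrite -[leRHS]mulrA ler_wpM2r// mulr_ge0 ?(ltW ft)// addr_ge0//.
have Q1a : `|B * (f ((1 - dt) * t) - f t)| + G * `|f ((1 - dt) * t) - f t|
    <= e / 2 * (1 + `|m| `^ b) * f t.
  by apply: Q1; rewrite ger0_norm ?subr_ge0// lerBlDl -[X in _ <= X + _]mul1r -mulrDl.
have Q1b : `|B * (f ((1 + dt) * t) - f t)| + G * `|f ((1 + dt) * t) - f t|
    <= e / 2 * (1 + `|m| `^ b) * f t.
  by apply: Q1; rewrite ler0_norm ?subr_le0// opprB lerBlDr -lerBlDl -[X in X - _ <= _]mul1r -mulrBl.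
have GE : G * f t <= (dl * `|m| `^ alpha + e / 8 * (1 + `|m| `^ b)) * f t.
  by rewrite ler_pM2r// lerD2l ler_wpM2r// addr_ge0.
have IJ : 2 * ((dt * t < `|q|)%R%:R * prob V [set w | dt * t < `|m * r w|]) <=
    e2 * (dt * t < `|q|)%R%:R + e / 4 * `|m| `^ b * f t.
  have e8 : 0 <= e / 4 * `|m| `^ b * f t by rewrite !mulr_ge0 ?(ltW ft) ?divr_ge0 ?(ltW e0).
  case: (dt * t < `|q|)%R; last by rewrite mul0r !mulr0 add0r.
  rewrite mul1r mulr1.
  apply: (@le_trans _ _ (2 * (e3 + e3 * `|m| `^ b * f t))); first by rewrite ler_pM2l.
  rewrite mulrDr lerD//.
  rewrite [leRHS](_ : _ = 2 * (e / 8 * `|m| `^ b * f t)); last by field.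
  by rewrite ler_pM2l// ler_pM2r// ler_wpM2r.
have I0 : 0 <= e2 * (dt * t < `|q|)%R%:R by rewrite mulr_ge0// ltW.
have pI0 : 0 <= (dt * t < `|q|)%R%:R * prob V [set w | dt * t < `|m * r w|].
  by rewrite mulr_ge0// prob_ge0.
have emf : 0 <= e * `|m| `^ b * f t by rewrite !mulr_ge0// ltW.
have ef : 0 <= e * f t by rewrite mulr_ge0// ltW.
have Gf3 : G * (f ((1 - dt) * t) - f t) <= G * `|f ((1 - dt) * t) - f t|.
  by apply: ler_wpM2l => //; exact: ler_norm.
have Gf4 : G * (f t - f ((1 + dt) * t)) >= 0 by rewrite mulr_ge0// subr_ge0.
have Gf5 : 0 <= G * `|f ((1 + dt) * t) - f t| by rewrite mulr_ge0.
have Bf3 := ler_norm (B * (f ((1 - dt) * t) - f t)).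
have Bf4 := ler_norm (- (B * (f ((1 + dt) * t) - f t))).
rewrite normrN in Bf4.
move: (f ((1 - dt) * t)) (f ((1 + dt) * t)) (f t) (`|m| `^ b) (`|m| `^ alpha)
  (prob V [set w | t < q + m * r w]) (prob V [set w | (1 - dt) * t < m * r w])
  (prob V [set w | (1 + dt) * t < m * r w])
  ((dt * t < `|q|)%R%:R * prob V [set w | dt * t < `|m * r w|])
  M1 M2 U L Q1a Q1b GE IJ I0 pI0 emf ef Gf3 Gf4 Gf5 Bf3 Bf4
  => {Q1 G1 G0 B1 mab ma0 mb0 f3 f4 ft tl J f1 f2 t1 t2}
     x y z mb ma pp pu pl ij + + U L Q1a Q1b GE IJ I0 pI0 emf ef Gf3 Gf4 Gf5 Bf3 Bf4.
rewrite !ler_norml => /andP[M1 M1'] /andP[M2 M2'].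
by split; lra.
Unshelve. all: by end_near. Qed.

(** The order of quantifiers is the point: [A] is fixed before [C], so a bound with constant [C] can
    reproduce itself for [C] large. The term with [A] comes from [|m|] so large that
    [t < 2 * S * |m|], where 1 is at most [(2 * S * |m|)^b * t^(-b)]. *)
Lemma affine_apriori (b e : R) : alpha < b -> 0 < e <= 1 ->
  exists2 dt : R, 0 < dt < 2^-1 &
  exists2 S0 : R, 0 < S0 & forall S : R, S0 <= S -> exists2 A : R, 0 <= A &
  forall (C : R) (V : probability T R) (r : T -> R) (q m t : R), 0 <= C -> measurable_fun setT r ->
    (forall s, S <= s -> prob V [set w | s < `|r w|] <= C * f s) -> S <= t ->
    prob V [set w | t < `|q + m * r w|] <= (dt * t < `|q|)%R%:R
      + (C * (`|m| `^ alpha + e * (1 + `|m| `^ b)) + A * `|m| `^ b) * f t.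
Proof.
move=> ab /andP[e0 e1]; have al0 := alpha0.
have e30 : 0 < e / 3 by rewrite divr_gt0.
have [dt dtb Hsh] := rv_shift (e / 3) e30.
have [dt0 dt1] : 0 < dt /\ dt < 2^-1 by apply/andP.
have [T1 T10 H1] := near_pinfty_ex _ Hsh.
have [T2 T20 H2] := near_pinfty_ex _ (rv_uniform _ _ ab e30).
have [T3 T30 H3] := near_pinfty_ex _ (powRN_negligible _ _ ab ltr01).
exists dt => //; exists (T1 + 2 * T2 + T3); first by rewrite !addr_gt0 ?mulr_gt0.
move=> S SS; have S0 : 0 < S by rewrite (lt_le_trans _ SS) ?addr_gt0 ?mulr_gt0.
exists ((2 * S) `^ b); first exact: powR_ge0.
move=> C V r q m t C0 mr Hr St.
have t0 : 0 < t by rewrite (lt_le_trans S0).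
have mm := measurable_scale _ m mr.
have m1 := measurable_gtr _ t (measurable_abs _ (measurable_affine _ q m mr)).
have m2 := measurable_gtr _ ((1 - dt) * t) (measurable_abs _ mm).
have ft := f_gt0 t.
have mb0 : 0 <= `|m| `^ b by exact: powR_ge0.
have ma0 : 0 <= `|m| `^ alpha by exact: powR_ge0.
have Z0 : 0 <= `|m| `^ alpha + e * (1 + `|m| `^ b).
  by rewrite !(addr_ge0, mulr_ge0)// ltW.
have Y0 : 0 <= (C * (`|m| `^ alpha + e * (1 + `|m| `^ b)) + (2 * S) `^ b * `|m| `^ b) * f t.
  by rewrite mulr_ge0 ?(ltW ft)// addr_ge0 ?mulr_ge0 ?powR_ge0.
have [qd|qd] := boolP (dt * t < `|q|)%R.
  by rewrite (le_trans (prob_le1 V _ m1))// lerDl.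
rewrite add0r -leNgt in qd *.
apply: (@le_trans _ _ (prob V [set w | (1 - dt) * t < `|m * r w|])).
  apply: le_prob => // w /= h; have := ler_normD q (m * r w); lra.
have dt2 : 2^-1 * t < (1 - dt) * t by rewrite ltr_pM2r//; lra.
have u0 : 0 < (1 - dt) * t by lra.
have [m0|m0] := eqVneq m 0.
  rewrite [X in prob _ X](_ : _ = set0) ?prob_set0//.
  by apply/seteqP; split => w //=; rewrite m0 mul0r normr0 ltNge (ltW u0).
have {}m0 : 0 < `|m| by rewrite normr_gt0.
have [u1 u2 u3] : [/\ T1 <= t, T2 <= (1 - dt) * t & T3 <= t] by split; lra.
rewrite [X in prob _ X](_ : _ = [set w | (1 - dt) * t / `|m| < `|r w|]); last first.
  by apply/seteqP; split => w /=; rewrite ltr_pdivrMr// normrM (mulrC `|m|).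
have [Su|uS] := lerP S ((1 - dt) * t / `|m|).
  apply: (le_trans (Hr _ Su)).
  apply: (@le_trans _ _ (C * (`|m| `^ alpha + e * (1 + `|m| `^ b)) * f t)); last first.
    by rewrite ler_pM2r// lerDl mulr_ge0 ?powR_ge0.
  rewrite -[leRHS]mulrA; apply: ler_wpM2l => //.
  have [h1 _] := H1 _ u1.
  have := H2 _ u2 _ m0; rewrite ler_norml => /andP[_ h2].
  have h3 : f ((1 - dt) * t / `|m|) <=
      (`|m| `^ alpha + e / 3 * (1 + `|m| `^ b)) * f ((1 - dt) * t) by lra.
  apply: (le_trans h3).
  apply: (@le_trans _ _ ((`|m| `^ alpha + e / 3 * (1 + `|m| `^ b)) * ((1 + e / 3) * f t))).
    by apply: ler_wpM2l => //; rewrite !(addr_ge0, mulr_ge0)// ltW.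
  rewrite mulrA ler_pM2r//.
  have mab : `|m| `^ alpha <= 1 + `|m| `^ b by apply: powR_le1D => //; rewrite !ltW.
  have k1 : e * `|m| `^ alpha <= e * (1 + `|m| `^ b) by exact: ler_wpM2l (ltW e0) _ _ _.
  have k2 : e * e * (1 + `|m| `^ b) <= e * (1 + `|m| `^ b).
    apply: ler_wpM2r; first by rewrite addr_ge0.
    by rewrite ler_piMl// ltW.
  have k3 : 0 <= e * (1 + `|m| `^ b) by rewrite mulr_ge0 ?addr_ge0// ltW.
  by lra.
apply: (le_trans (prob_le1 _ _ (measurable_gtr _ _ (measurable_abs _ mr)))).
apply: (@le_trans _ _ ((2 * S) `^ b * `|m| `^ b * f t)); last first.
  by rewrite ler_pM2r// lerDr mulr_ge0.
have h3 := H3 _ u3; rewrite mul1r in h3.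
apply: (@le_trans _ _ ((2 * S) `^ b * `|m| `^ b * t `^ (- b))); last first.
  by apply: ler_wpM2l => //; rewrite mulr_ge0// powR_ge0.
rewrite -powRM ?mulr_ge0 ?(ltW S0)//.
rewrite powRN ler_pdivlMr ?powR_gt0// mul1r; apply: ge0_ler_powR.
- by rewrite (le_trans (ltW al0))// ltW.
- by rewrite nnegrE ltW.
- by rewrite nnegrE !mulr_ge0// ltW.
- by move: uS; rewrite ltr_pdivrMr//; lra.
Qed.

End RegularlyVaryingTails.

(** * Conditioning, independence, countable partitions and countable sums *)

Lemma measurable_preim {d d' : measure_display} {T : measurableType d}
    {T' : measurableType d'} (g : T -> T') (B : set T') :
  measurable_fun setT g -> measurable B -> measurable (g @^-1` B).
Proof. by move=> mg mB; rewrite -[X in measurable X]setTI; exact: mg. Qed.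

Section Conditioning.
Context {d : measure_display} {T : measurableType d} {R : realType}.
Variables (P : probability T R).

Lemma mnormalizeE (mu : {measure set T -> \bar R}) A (e : R) :
  mu setT = e%:E -> 0 < e -> mnormalize mu P A = (mu A * e^-1%:E)%E.
Proof. by move=> muT e0; rewrite /mnormalize muT eqe gt_eqF. Qed.

(** The second argument [P] of [mnormalize] is the value taken when [E] is null, so this is always a
    probability; formulas for it require positive mass. *)
Definition condprob (E : set T) (mE : measurable E) : probability T R :=
  mnormalize (mrestr P mE) P.

Lemma condprobE (E : set T) (mE : measurable E) A : 0 < prob P E ->
  measurable A -> prob (condprob E mE) A = prob P (A `&` E) / prob P E.
Proof.
move=> E0 mA.
have CE : condprob E mE A = (mrestr P mE A * (prob P E)^-1%:E)%E.
  by apply: mnormalizeE => //; rewrite /= /mrestr setTI probE.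
rewrite [LHS]/prob CE fineM//= /mrestr probE//; exact: measurableI.
Qed.
End Conditioning.

Section IndependentAffine.
Context {d : measure_display} {T : measurableType d} {R : realType}.
Variables (P : probability T R).

Definition mfun_of {d' : measure_display} {T' : measurableType d'} (g : T -> T')
  (mg : measurable_fun setT g) : {mfun T >-> T'} :=
  HB.pack g (isMeasurableFun.Build _ _ _ _ _ mg).

(** By the product formula on rectangles, the law of [((q, m), r)] given [G] is the product of the
    law of [(q0, m0)] under [P] and that of [r'] under [V]; Fubini's theorem evaluates it on the
    preimage of [C] under the affine map. *)
Lemma prob_affine_indep (V : probability T R) (G : set T) (q m q0 m0 r r' : T -> R) :
  measurable G -> measurable_fun setT q -> measurable_fun setT m ->
  measurable_fun setT q0 -> measurable_fun setT m0 ->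
  measurable_fun setT r -> measurable_fun setT r' ->
  (forall (B : set (R * R)%type) (C : set R), measurable B -> measurable C ->
    prob P (G `&` ((fun w => (q w, m w)) @^-1` B `&` r @^-1` C)) =
    prob P G * (prob P ((fun w => (q0 w, m0 w)) @^-1` B) * prob V (r' @^-1` C))) ->
  forall C : set R, measurable C ->
    measurable_fun setT (fun w => prob V [set v | C (q0 w + m0 w * r' v)]) /\
    prob P (G `&` (fun w => q w + m w * r w) @^-1` C) =
    prob P G * \int[P]_w prob V [set v | C (q0 w + m0 w * r' v)].
Proof.
move=> mG mq mm mq0 mm0 mr mr' H C mC.
have mZ : measurable_fun setT (fun w => (q w, m w)) by exact: measurable_fun_pair.
have mZ0 : measurable_fun setT (fun w => (q0 w, m0 w)) by exact: measurable_fun_pair.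
have mZr : measurable_fun setT (fun w => ((q w, m w), r w)) by exact: measurable_fun_pair.
pose g (x : (R * R) * R) : R := x.1.1 + x.1.2 * x.2.
have mg : measurable_fun setT g.
  apply: measurable_funD; first exact: measurableT_comp measurable_fst measurable_fst.
  by apply: measurable_funM => //; exact: measurableT_comp measurable_snd measurable_fst.
have mgC : measurable (g @^-1` C) by rewrite -[X in measurable X]setTI; exact: mg.
pose m1 := distribution P (mfun_of _ mZ0).
pose m2 := distribution V (mfun_of _ mr').
have xE w : xsection (g @^-1` C) (q0 w, m0 w) = [set x | C (q0 w + m0 w * x)].
  by apply/seteqP; split => x; rewrite /xsection /= inE.
have mx : measurable_fun setT (fun x => m2 (xsection (g @^-1` C) x)).
  exact: measurable_fun_xsection.
have E w : (m2 \o xsection (g @^-1` C)) (q0 w, m0 w) =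
    (prob V [set v | C (q0 w + m0 w * r' v)])%:E.
  rewrite /= xE /m2 /distribution /pushforward /= probE//.
  rewrite -[X in measurable X]setTI.
  have mh : measurable_fun setT (fun v => q0 w + m0 w * r' v) by exact: measurable_affine.
  exact: mh.
have mI : measurable_fun setT (fun w => (prob V [set v | C (q0 w + m0 w * r' v)])%:E).
  under eq_fun do rewrite -E.
  exact: (measurableT_comp mx mZ0).
have prodE : (m1 \x m2)%E (g @^-1` C) =
    (\int[P]_w (prob V [set v | C (q0 w + m0 w * r' v)])%:E)%E.
  rewrite /product_measure1 ge0_integral_pushforward//=.
  by apply: eq_integral => w _; rewrite -E.
split; first exact/measurable_EFinP.
have [G0|G0] := eqVneq (prob P G) 0.
  rewrite G0 mul0r; apply/eqP; rewrite eq_le prob_ge0 andbT -G0.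
  apply: le_prob => //; apply: measurableI => //.
  rewrite -[X in measurable X]setTI.
  have mh : measurable_fun setT (fun w => q w + m w * r w).
    by apply: measurable_funD => //; exact: measurable_funM.
  exact: mh.
have {}G0 : 0 < prob P G by rewrite lt_def G0 prob_ge0.
have pre (A : set (R * R)%type) (B : set R) :
  (fun w => ((q w, m w), r w)) @^-1` (A `*` B) =
  (fun w => (q w, m w)) @^-1` A `&` r @^-1` B by [].
have mp A : measurable A -> measurable ((fun w => ((q w, m w), r w)) @^-1` A).
  by move=> mA; rewrite -[X in measurable X]setTI; exact: mZr.
pose m' := distribution (condprob P G mG) (mfun_of _ mZr).
have PU : (m1 \x m2)%E (g @^-1` C) = m' (g @^-1` C).
  apply: product_measure_unique mgC => A B mA mB.
  have mB' : measurable (r' @^-1` B) by exact: measurable_preim mr' mB.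
  have mA' : measurable ((fun w => (q0 w, m0 w)) @^-1` A). by exact: measurable_preim mZ0 mA.
  have mAB : measurable ((fun w => (q w, m w)) @^-1` A `&` r @^-1` B).
    by rewrite -pre; apply: mp; exact: measurableX.
  transitivity (prob (condprob P G mG)
     ((fun w => (q w, m w)) @^-1` A `&` r @^-1` B))%:E; first exact: (probE _ _ mAB).
  rewrite condprobE// setIC (H _ _ mA mB) mulrC mulKf ?gt_eqF// EFinM.
  by congr (_ * _)%E; apply/esym; [exact: (probE _ _ mA')|exact: (probE _ _ mB')].
have m'C : m' (g @^-1` C) = (prob (condprob P G mG)
    ((fun w => q w + m w * r w) @^-1` C))%:E.
  exact: (probE _ _ (mp _ mgC)).
rewrite /Rintegral -prodE PU m'C /= condprobE//; last exact: (mp _ mgC).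
by rewrite mulrC divfK ?gt_eqF// setIC.
Qed.

End IndependentAffine.

Section CountablePartition.
Context {d : measure_display} {T : measurableType d} {R : realType}.
Variables (P : probability T R) (D : countType) (X : T -> D).
Hypothesis mX : forall j, measurable (X @^-1` [set j]).

Lemma measurable_preimage_count (A : set D) : measurable (X @^-1` A).
Proof.
rewrite [X in measurable X](_ : _ = \bigcup_n
  (if unpickle n is Some j then if j \in A then X @^-1` [set j] else set0 else set0)).
  apply: bigcupT_measurable => n; case: unpickle => [j|]; last exact: measurable0.
  by case: ifP => _; [exact: mX|exact: measurable0].
apply/seteqP; split => [w Aw|w [n _]].
  exists (pickle (X w)) => //; rewrite pickleK.
  by rewrite ifT// inE.
by case: unpickle => [j|]//; case: ifPn => //; rewrite inE => Aj /= ->.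
Qed.

(** This makes [Q_{n, X_n}] a random variable: a preimage splits into countably many pieces on which
    the state is fixed. *)
Lemma measurable_select {d' : measure_display} {T' : measurableType d'}
    (F : D -> T -> T') : (forall j, measurable_fun setT (F j)) ->
  measurable_fun setT (fun w => F (X w) w).
Proof.
move=> mF _ B mB; rewrite setTI.
rewrite [X in measurable X](_ : _ = \bigcup_n
  (if unpickle n is Some j then X @^-1` [set j] `&` F j @^-1` B else set0)).
  apply: bigcupT_measurable => n; case: unpickle => [j|]; last exact: measurable0.
  apply: measurableI; first exact: mX.
  by rewrite -[X in measurable X]setTI; exact: mF.
apply/seteqP; split => [w Bw|w [n _]].
  by exists (pickle (X w)) => //; rewrite pickleK.
by case: unpickle => [j|]//= [<-].
Qed.

(** The encoding [pickle] turns the states into a sequence of disjoint events, to which countable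
    additivity applies; codes that are not attained give empty events. *)
Lemma prob_partition A : measurable A ->
  (prob P A)%:E = (\esum_(j in [set: D]) (prob P (A `&` X @^-1` [set j]))%:E)%E.
Proof.
move=> mA; pose F n := A `&` (pickle \o X) @^-1` [set n].
have mF n : measurable (F n).
  by apply: measurableI => //; exact: (measurable_preimage_count (pickle @^-1` [set n])).
have AF : A = \bigcup_n F n.
  by apply/seteqP; split => [w Aw|w [n _ []]//]; exists (pickle (X w)).
have tF : trivIset setT F.
  apply/trivIsetP => i j _ _ /eqP ij; apply/seteqP; split => // w [[_ /= wi] [_ /= wj]].
  by apply: ij; rewrite -wi -wj.
rewrite -probE// {1}AF measure_semi_bigcup//; last by rewrite -AF.
rewrite (@eq_eseriesr _ _ (fun n => (prob P (F n))%:E)); last by move=> n _; exact: probE.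
rewrite nneseries_esumT; last by move=> n; rewrite lee_fin prob_ge0.
transitivity (\esum_(n in range (@pickle D)) (prob P (F n))%:E)%E.
  rewrite [RHS]esum_mkcond; apply: eq_esum => n _.
  case: ifPn => //; rewrite notin_setE => nr; congr EFin.
  rewrite [F n](_ : _ = set0) ?prob_set0//.
  by apply/seteqP; split => // w [_ /= wn]; apply: nr; exists (X w).
rewrite (esum_image setT (@pickle D)); last by move=> x y _ _; exact: (pcan_inj pickleK).
apply: eq_esum => j _; congr (prob P (A `&` _))%:E.
by apply/seteqP; split => w /=; [move/(pcan_inj pickleK)|move=> ->].
Qed.

End CountablePartition.

Section ExtendedSums.
Context {R : realType} {I : choiceType}.
Implicit Types (a : I -> R).

(** Finite partial sums give one inequality for every positive factor; the converse is the same
    inequality for [c^-1]. *)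
Lemma esumZl (c : R) a : 0 <= c -> (forall i, 0 <= a i) ->
  (\esum_(i in [set: I]) (c * a i)%:E = c%:E * \esum_(i in [set: I]) (a i)%:E)%E.
Proof.
have le (k : R) b : 0 < k -> (forall i, 0 <= b i) ->
    (\esum_(i in [set: I]) (k * b i)%:E <= k%:E * \esum_(i in [set: I]) (b i)%:E)%E.
  move=> k0 b0; apply: ub_ereal_sup => _ [A [finA _] <-].
  under eq_fsbigr do rewrite EFinM.
  rewrite -ge0_mule_fsumr; last by move=> i; rewrite lee_fin.
  by rewrite lee_pmul2l// esum_ge//; exists A.
move=> c0 a0; have [->|cn0] := eqVneq c 0.
  by rewrite mul0e; apply: esum1 => i _; rewrite mul0r.
have {}c0 : 0 < c by rewrite lt_def cn0.
apply/eqP; rewrite eq_le le//=.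
rewrite -(@lee_pmul2l _ c^-1%:E)// ?lte_fin ?invr_gt0//.
rewrite muleA -EFinM mulVf// mul1e.
rewrite [in leLHS](_ : a = fun i => c^-1 * (c * a i)); last first.
  by apply/funext => i; rewrite mulKf.
by apply: le; rewrite ?invr_gt0// => i; rewrite mulr_ge0// ltW.
Qed.

End ExtendedSums.

(** * The reversed chain and the law of the partial sums *)

Section MarkovPerpetuity.
Context (R : realType) (d : measure_display) (Omega : measurableType d)
  (P : probability Omega R) (D : countType)
  (X : int -> Omega -> D) (pi : D -> R) (p : D -> D -> R)
  (Q M : int -> D -> Omega -> R).
Hypothesis markov : stationary_markov P X pi p.
Hypothesis irr : irreducible p.
Hypothesis mQ : forall n i, measurable_fun setT (Q n i).
Hypothesis mM : forall n i, measurable_fun setT (M n i).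
Hypothesis ind : indep_family P (model_sigma X Q M).
Hypothesis iid : forall (i : D) (n : int) (B : set (R * R)%type), measurable B ->
  prob P ((fun w => (Q n i w, M n i w)) @^-1` B) =
  prob P ((fun w => (Q 0 i w, M 0 i w)) @^-1` B).

Let mX n j : measurable (X n @^-1` [set j]) := markov.1 n j.

Lemma cyl_nil n x : cyl X n x [::] = X n @^-1` [set x].
Proof. by apply/seteqP; split => w /=; [case|]. Qed.

(** Cylinders are extended at their earliest time because the series runs into the past. *)
Lemma cyl_cons n j i s :
  cyl X (n - 1) j (i :: s) = cyl X n i s `&` X (n - 1) @^-1` [set j].
Proof.
apply/seteqP; split => w /=.
  move=> [Xj H]; split => //; split.
    by have := H 0%N isT; rewrite subrK.
  move=> l ls; have := H l.+1 ls => /=.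
  rewrite (set_nth_default i)// => <-; congr (X _ w).
  by rewrite -addrA; congr (n + _); rewrite addrC -natrB//= ?subn1.
move=> [[Xi H] Xj]; split => // -[_|l ls /=]; first by rewrite subrK.
rewrite (set_nth_default i)// -H//; congr (X _ w).
by rewrite -addrA; congr (n + _); rewrite addrC -natrB//= ?subn1.
Qed.

Lemma measurable_cyl n x s : measurable (cyl X n x s).
Proof.
elim: s n x => [|i s IH] n x; first by rewrite cyl_nil.
rewrite -[n](addrK 1) cyl_cons; exact: measurableI.
Qed.

Lemma cyl_sigma n x s : model_sigma X Q M None (cyl X n x s).
Proof.
have base m j : model_sigma X Q M None (X m @^-1` [set j]).
  by apply: sub_sigma_algebra; exists m, j.
elim: s n x => [|i s IH] n x; first by rewrite cyl_nil.
rewrite -[n](addrK 1) cyl_cons.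
set G := [set A | exists n j, A = X n @^-1` [set j]].
exact: (@measurableI _ (g_sigma_algebraType G) _ _ (IH _ _) (base _ _)).
Qed.

Lemma prob_state n j : prob P (X n @^-1` [set j]) = pi j.
Proof. by rewrite -cyl_nil markov.2 big_ord0 mulr1. Qed.

Let pi_ge0 j : 0 <= pi j.
Proof. by rewrite -(prob_state 0); exact: prob_ge0. Qed.

(** Some state has positive mass because the total is one, and [pi i * p i k <= pi k] carries
    positivity along the paths given by irreducibility. Conditioning on any state is thereby
    legitimate. *)
Lemma state_prob_gt0 j : 0 < pi j.
Proof.
have [i i0] : exists i, 0 < pi i.
  apply: contrapT => /forallNP pi0.
  have := prob_partition P D (X 0) (mX 0) setT measurableT.
  rewrite prob_setT esum1 => [[]|k _]; first by move/eqP; rewrite oner_eq0.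
  rewrite setTI prob_state; congr EFin; apply/eqP; rewrite eq_le pi_ge0 andbT.
  by rewrite leNgt; apply/negP/pi0.
have [s [+ <-]] := irr i j.
elim: s i i0 => [//|k s IH] i i0 /= /andP[pik ps]; apply: IH => //.
apply: (@lt_le_trans _ _ (pi i * p i k)); first exact: mulr_gt0.
have := markov.2 (0 - 1) i [:: k]; rewrite big_ord1/= => <-.
rewrite -(prob_state 0) cyl_cons cyl_nil.
by apply: le_prob => //; exact: measurableI.
Qed.

Lemma Hk_pi i j : Hk P X i j = pi j * p j i / pi i.
Proof.
rewrite /Hk prob_state; congr (_ / _).
have := markov.2 (1 - 1) j [:: i]; rewrite big_ord1/= => <-.
by rewrite cyl_cons cyl_nil setIC.
Qed.

(** The Markov property in reversed time: given the states from time [n] on, the state at [n - 1]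
    depends only on the one at [n], through the kernel [H]. *)
Lemma prob_cyl_cons n j i s :
  prob P (cyl X (n - 1) j (i :: s)) = prob P (cyl X n i s) * Hk P X i j.
Proof.
rewrite !markov.2 /= big_ord_recl /= Hk_pi.
rewrite [X in _ * (_ * X) = _](_ : _ = \prod_(l < size s) p (nth i (i :: s) l) (nth i s l)).
  by field; rewrite gt_eqF ?state_prob_gt0.
apply: eq_bigr => l _; rewrite !add0n.
rewrite (set_nth_default i) ?(@ltnW l (size s)) ?ltnS ?(ltnW (ltn_ord l))//=.
by rewrite (set_nth_default i) ?ltn_ord.
Qed.

(** The value at time [n] of the recursion started from 0, after [N] steps ending at [n]. This form
    exposes the affine step; [perp_sum] recovers the truncated series. *)
Fixpoint perp (n : int) (N : nat) (w : Omega) : R :=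
  if N is N'.+1 then Q n (X n w) w + M n (X n w) w * perp (n - 1) N' w else 0.

Lemma measurable_perp n N : measurable_fun setT (perp n N).
Proof.
elim: N n => [|N IH] n /=; first exact: measurable_cst.
apply: measurable_funD; first exact: measurable_select.
by apply: measurable_funM; [exact: measurable_select|exact: IH].
Qed.

(** The whole chain enters the independent family through the single index [None], whose
    sigma-algebra contains every cylinder. *)
Lemma indep_cyl n i s (J : seq (int * D)) A : uniq J ->
  (forall k, k \in J -> model_sigma X Q M (Some k) (A k)) ->
  prob P (cyl X n i s `&` \bigcap_(k in [set` J]) A k) =
  prob P (cyl X n i s) * \prod_(k <- J) prob P (A k).
Proof.
move=> uJ AJ.
pose A' (k : option (int * D)) := if k is Some k then A k else cyl X n i s.
have := ind (None :: map Some J) _ A' _.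
rewrite big_cons big_map /= => <-.
- congr prob; apply/seteqP; split => w.
    move=> [cw Jw] [k|] //=; rewrite inE /= => /mapP[k' k'J [->]].
    exact: Jw.
  move=> H; split; first by apply: (H None); rewrite /= inE.
  by move=> k kJ; apply: (H (Some k)); rewrite /= inE map_f.
- rewrite map_inj_uniq ?uJ ?andbT; last by move=> ? ? [].
  by apply/mapP => -[].
- move=> [k|] //=; last by move=> _; exact: cyl_sigma.
  by rewrite inE /= => /mapP[k' k'J [->]]; exact: AJ.
Qed.

Lemma model_sigma_measurable k A : model_sigma X Q M (Some k) A -> measurable A.
Proof.
case: k => n i [B mB ->]; apply: measurable_preim mB.
exact: measurable_fun_pair.
Qed.

Lemma measurable_indep_event (J : seq (int * D)) A :
  (forall k, k \in J -> model_sigma X Q M (Some k) (A k)) ->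
  measurable (\bigcap_(k in [set` J]) A k).
Proof.
move=> AJ; apply: fin_bigcap_measurable; first exact: finite_seq.
by move=> k /= kJ; exact: model_sigma_measurable (AJ _ kJ).
Qed.

(* Given [X n = i], the partial sum [perp n N] is independent of the later states
   and of the pairs with index greater than [n], and its law does not depend
   on [n]. *)
Let claim N := forall n i s (J : seq (int * D)) A C, measurable C -> uniq J ->
  (forall k, k \in J -> n < k.1) ->
  (forall k, k \in J -> model_sigma X Q M (Some k) (A k)) ->
  prob P (cyl X n i s `&` \bigcap_(k in [set` J]) A k `&` perp n N @^-1` C) =
  prob P (cyl X n i s) * \prod_(k <- J) prob P (A k)
    * condP P X (perp 0 N @^-1` C) i.

Lemma condP_ge0 A i : 0 <= condP P X A i.
Proof. by rewrite /condP divr_ge0// prob_ge0. Qed.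

Lemma Hk_ge0 i j : 0 <= Hk P X i j.
Proof. by rewrite /Hk divr_ge0// prob_ge0. Qed.

(** Splitting over the state [j] at time [n - 1] lengthens the cylinder by one step into the past,
    and the pair at [(n, i)] becomes one more event at a time later than [n - 1], so the claim
    applies at [n - 1]. *)
Let claim_pair N : claim N -> forall n i s (J : seq (int * D)) A,
  uniq J -> (forall k, k \in J -> n < k.1) ->
  (forall k, k \in J -> model_sigma X Q M (Some k) (A k)) ->
  forall (B : set (R * R)%type) (C : set R), measurable B -> measurable C ->
  (prob P (cyl X n i s `&` \bigcap_(k in [set` J]) A k `&`
    ((fun w => (Q n i w, M n i w)) @^-1` B `&` perp (n - 1) N @^-1` C)))%:E =
  ((prob P (cyl X n i s) * \prod_(k <- J) prob P (A k)
    * prob P ((fun w => (Q 0 i w, M 0 i w)) @^-1` B))%:E *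
    \esum_(j in [set: D]) (Hk P X i j * condP P X (perp 0 N @^-1` C) j)%:E)%E.
Proof.
move=> HN n i s J A uJ nJ AJ B C mB mC.
pose J' := (n, i) :: J.
(* All times in [J] exceed [n], so [(n, i)] is a new index and its event can be prescribed
   independently of [A]. *)
pose Z := (fun w => (Q n i w, M n i w)) @^-1` B.
pose A' k := if k == (n, i) then Z else A k.
have niJ : (n, i) \notin J by apply/negP => /nJ /=; rewrite ltxx.
have uJ' : uniq J' by rewrite /= niJ.
have nJ' k : k \in J' -> n - 1 < k.1.
  have n1 : n - 1 < n by rewrite ltrBlDr ltrDl.
  by rewrite inE => /orP[/eqP-> //|/nJ]; exact: lt_trans.
have A'J k : k \in J -> A' k = A k.
  by move=> kJ; rewrite /A'; case: eqP kJ => // ->; rewrite (negPf niJ).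
have AJ' k : k \in J' -> model_sigma X Q M (Some k) (A' k).
  rewrite inE => /orP[/eqP->|kJ]; last by rewrite A'J//; exact: AJ.
  by rewrite /A' eqxx; exists B.
have mZ : measurable Z by apply: measurable_preim mB; exact: measurable_fun_pair.
have mG : measurable (cyl X n i s `&` \bigcap_(k in [set` J]) A k).
  by apply: measurableI; [exact: measurable_cyl|exact: measurable_indep_event].
have mp : measurable (perp (n - 1) N @^-1` C).
  by apply: measurable_preim mC; exact: measurable_perp.
rewrite (prob_partition P D (X (n - 1)) (mX (n - 1))); last first.
  by apply: measurableI => //; exact: measurableI.
rewrite -esumZl; last 2 first.
- by rewrite !mulr_ge0 ?prob_ge0// prodr_ge0// => k _; exact: prob_ge0.
- by move=> j; rewrite mulr_ge0 ?Hk_ge0 ?condP_ge0.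
apply: eq_esum => j _; congr EFin.
transitivity (prob P (cyl X (n - 1) j (i :: s) `&`
    \bigcap_(k in [set` J']) A' k `&` perp (n - 1) N @^-1` C)).
  congr prob; rewrite cyl_cons; apply/seteqP; split => w.
    move=> [[[cw Aw] [Zw pw]] Xw]; split => //; split => // k /=.
    rewrite inE => /orP[/eqP->|kJ]; first by rewrite /A' eqxx.
    by rewrite A'J//; exact: Aw.
  move=> [[[cw Xw] Aw] pw]; split => //; split; split => //.
    by move=> k kJ; rewrite -A'J//; apply: Aw; rewrite /= inE kJ orbT.
  by have := Aw (n, i); rewrite /A' eqxx; apply; rewrite /= inE eqxx.
rewrite HN// prob_cyl_cons big_cons {1}/A' eqxx iid//.
rewrite (eq_big_seq (fun k => prob P (A k))); last by move=> k kJ; rewrite A'J.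
by ring.
Qed.

Let measurable_state0 (i : D) : measurable (X 0 @^-1` [set i]) := mX 0 i.

Let state_law i := condprob P _ (measurable_state0 i).

Let state_lawE i A : measurable A ->
  prob (state_law i) A = condP P X A i.
Proof. by move=> mA; rewrite condprobE// prob_state state_prob_gt0. Qed.

(** The case of a trivial event for the pair and no later events, at time 0. *)
Let state_law_perp N : claim N -> forall i (C : set R), measurable C ->
  (prob (state_law i) (perp (-1) N @^-1` C))%:E =
  (\esum_(j in [set: D]) (Hk P X i j * condP P X (perp 0 N @^-1` C) j)%:E)%E.
Proof.
move=> HN i C mC; have mp : measurable (perp (-1) N @^-1` C).
  by apply: measurable_preim mC; exact: measurable_perp.
have := claim_pair N HN 0 i [::] [::] (fun _ => setT) isT _ _ setT C measurableT mC.
rewrite sub0r preimage_setT prob_setT mulr1 big_nil mulr1 setTI cyl_nil.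
rewrite (_ : \bigcap_(k in [set` [::]]) _ = setT); last first.
  by apply/seteqP; split => // w _ k.
rewrite setIT prob_state state_lawE// /condP prob_state setIC => H.
rewrite EFinM [(prob _ _)%:E]H// muleC muleA -EFinM mulVf ?mul1e//.
by rewrite gt_eqF ?state_prob_gt0.
Qed.

(** The factorisation in [claim_pair] involves laws that depend neither on [n] nor on the later
    events. [prob_affine_indep] hence yields the same integral in all cases. *)
Let claim_step N : claim N ->
  (forall i (C : set R), measurable C ->
    measurable_fun setT (fun w =>
      prob (state_law i) [set v | C (Q 0 i w + M 0 i w * perp (-1) N v)]) /\
    condP P X (perp 0 N.+1 @^-1` C) i =
    \int[P]_w prob (state_law i) [set v | C (Q 0 i w + M 0 i w * perp (-1) N v)])
  /\ claim N.+1.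
Proof.
move=> HN.
have step n i s (J : seq (int * D)) A C : measurable C -> uniq J ->
    (forall k, k \in J -> n < k.1) ->
    (forall k, k \in J -> model_sigma X Q M (Some k) (A k)) ->
    measurable_fun setT (fun w =>
      prob (state_law i) [set v | C (Q 0 i w + M 0 i w * perp (-1) N v)]) /\
    prob P (cyl X n i s `&` \bigcap_(k in [set` J]) A k `&` perp n N.+1 @^-1` C) =
    prob P (cyl X n i s) * \prod_(k <- J) prob P (A k) *
    \int[P]_w prob (state_law i) [set v | C (Q 0 i w + M 0 i w * perp (-1) N v)].
  move=> mC uJ nJ AJ.
  have mG : measurable (cyl X n i s `&` \bigcap_(k in [set` J]) A k).
    by apply: measurableI; [exact: measurable_cyl|exact: measurable_indep_event].
  have [] := prob_affine_indep P (state_law i) _ (Q n i) (M n i) (Q 0 i) (M 0 i)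
    (perp (n - 1) N) (perp (-1) N) mG (mQ n i) (mM n i) (mQ 0 i) (mM 0 i)
    (measurable_perp _ _) (measurable_perp _ _) _ C mC.
    move=> B C' mB mC'; apply: EFin_inj.
    rewrite claim_pair// indep_cyl// -state_law_perp// -EFinM; congr EFin.
    by ring.
  rewrite indep_cyl// => mI <-; split => //.
  congr prob; apply/seteqP; split => w [[[Xw cw] Aw] pw]; split => //=;
    by move: pw; rewrite /= Xw.
split=> [i C mC|n i s J A C mC uJ nJ AJ].
  have [mI H] := step 0 i [::] [::] (fun _ => setT) C mC isT ltac:(by []) ltac:(by []).
  split => //.
  move: H; rewrite (_ : \bigcap_(k in [set` [::]]) _ = setT); last first.
    by apply/seteqP; split => // w _ k.
  rewrite setIT cyl_nil big_nil mulr1 prob_state /condP prob_state setIC => ->.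
  by rewrite mulrC mulKf// gt_eqF ?state_prob_gt0.
have [_ ->] := step n i s J A C mC uJ nJ AJ; congr (_ * _).
(* The instance at time 0 without further events turns the integral back into a conditional
   probability. *)
have [_] := step 0 i [::] [::] (fun _ => setT) C mC isT ltac:(by []) ltac:(by []).
rewrite (_ : \bigcap_(k in [set` [::]]) _ = setT); last first.
  by apply/seteqP; split => // w _ k.
rewrite setIT cyl_nil big_nil mulr1 prob_state /condP prob_state setIC => ->.
by rewrite mulrC mulKf// gt_eqF ?state_prob_gt0.
Qed.

(** The empty partial sum is 0, so in the base case the event is everything or nothing according to
    whether [C] contains 0. *)
Let claim_all N : claim N.
Proof.
elim: N => [|N IH]; last by have [] := claim_step N IH.
move=> n i s J A C mC uJ nJ AJ.
have [C0|C0] := pselect (C 0).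
  have E m (B : set Omega) : B `&` perp m 0 @^-1` C = B.
    by apply/seteqP; split => w // [].
  have -> : condP P X (perp 0 0 @^-1` C) i = 1.
    by rewrite /condP setIC E divff// prob_state gt_eqF ?state_prob_gt0.
  by rewrite E mulr1 indep_cyl.
have E m (B : set Omega) : B `&` perp m 0 @^-1` C = set0.
  by apply/seteqP; split => w // [].
have -> : condP P X (perp 0 0 @^-1` C) i = 0.
  by rewrite /condP setIC E prob_set0 mul0r.
by rewrite E prob_set0 mulr0.
Qed.

(** The interface between the model and the tail analysis: an affine step driven by an independent
    pair, followed by a mixture over the previous state. The witness [V i] is [P] given
    [X 0 = i]. *)
Theorem perp_kernel : exists V : D -> probability Omega R, forall N i (C : set R),
  measurable C ->
  [/\ measurable_fun setT (fun w =>
        prob (V i) [set v | C (Q 0 i w + M 0 i w * perp (-1) N v)]),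
     condP P X (perp 0 N.+1 @^-1` C) i =
       \int[P]_w prob (V i) [set v | C (Q 0 i w + M 0 i w * perp (-1) N v)] &
     (prob (V i) (perp (-1) N @^-1` C))%:E =
       (\esum_(j in [set: D]) (Hk P X i j * condP P X (perp 0 N @^-1` C) j)%:E)%E].
Proof.
exists state_law => N i C mC.
have [/(_ i C mC)[mI H] _] := claim_step N (claim_all N).
by split => //; exact: (state_law_perp N (claim_all N)).
Qed.

End MarkovPerpetuity.

(** * Averages against a stochastic kernel and the equations for the constants *)

Section StochasticRow.
Context {R : realType} {I : countType}.
Variable h : I -> R.
Hypothesis h_ge0 : forall j, 0 <= h j.
Hypothesis h_sum : (\esum_(j in [set: I]) (h j)%:E = 1)%E.

Let S (v : I -> R) : \bar R := (\esum_(j in [set: I]) (h j * v j)%:E)%E.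

Let S_cst (c : R) : 0 <= c -> S (fun=> c) = c%:E.
Proof.
move=> c0; rewrite /S; under eq_esum do rewrite mulrC.
by rewrite esumZl// h_sum mule1.
Qed.

Let S_ge0 (v : I -> R) : (forall j, 0 <= v j) -> (0 <= S v)%E.
Proof. by move=> v0; apply: esum_ge0 => j _; rewrite lee_fin mulr_ge0. Qed.

Let S_le (u v : I -> R) : (forall j, 0 <= u j <= v j) -> (S u <= S v)%E.
Proof.
move=> uv; apply: le_esum => j _; rewrite lee_fin ler_wpM2l//.
by have /andP[] := uv j.
Qed.

Let S_fin (v : I -> R) (c : R) : (forall j, 0 <= v j <= c) -> S v = (fine (S v))%:E /\ fine (S v) <= c.
Proof.
move=> vc; have v0 (j : I) : 0 <= v j by have /andP[] := vc j.
have [[j _]|nI] := pselect (exists j : I, True); last first.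
  exfalso; move: h_sum; rewrite esum1 => [[]|j]; first by move/eqP; rewrite eq_sym oner_eq0.
  by case: nI; exists j.
have c0 : 0 <= c by rewrite (le_trans (v0 j))//; have /andP[] := vc j.
have Sc : (S v <= c%:E)%E by rewrite -S_cst//; exact: S_le.
have Sf : S v \is a fin_num.
  by rewrite ge0_fin_numE ?S_ge0// (le_lt_trans Sc)// ltry.
by rewrite fineK// -lee_fin fineK.
Qed.

Let SD (u v : I -> R) : (forall j, 0 <= u j) -> (forall j, 0 <= v j) ->
  (S u + S v = S (fun j => u j + v j)%R)%E.
Proof.
move=> u0 v0; rewrite /S -esumD; last 2 first.
- by move=> j _; rewrite lee_fin mulr_ge0.
- by move=> j _; rewrite lee_fin mulr_ge0.
by apply: eq_esum => j _; rewrite -EFinD mulrDr.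
Qed.

Let max0M (a x : R) : 0 <= a -> Num.max (a * x) 0 = a * Num.max x 0.
Proof. by move=> a0; rewrite -[X in Num.max _ X](mulr0 a) maxr_pMr. Qed.

Let dsumE (v : I -> R) : dsum (fun j => h j * v j) =
  fine (S (fun j => Num.max (v j) 0)) - fine (S (fun j => Num.max (- v j) 0)).
Proof.
rewrite /dsum /S; congr (fine _ - fine _); apply: eq_esum => j _.
  by rewrite max0M.
by rewrite -mulrN max0M.
Qed.

Lemma dsum_ge0E (v : I -> R) : (forall j, 0 <= v j) ->
  dsum (fun j => h j * v j) = fine (\esum_(j in [set: I]) (h j * v j)%:E)%E.
Proof.
move=> v0; rewrite dsumE (_ : S (fun j => Num.max (- v j) 0) = 0%E).
  rewrite subr0; congr fine; apply: eq_esum => j _.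
  by rewrite (max_idPl _).
by apply: esum1 => j _; rewrite (max_idPr _) ?mulr0// oppr_le0.
Qed.

(** [dsum] is a difference of two nonnegative sums. Since the row has mass one, adding a bound [c]
    to [v] reduces it to a single finite nonnegative sum, from which order bounds and additivity are
    inherited. *)
Let dsum_shift (v : I -> R) (c : R) : (forall j, `|v j| <= c) ->
  dsum (fun j => h j * v j) = fine (S (fun j => v j + c)) - c.
Proof.
move=> vc; have vb (j : I) : - c <= v j <= c by rewrite -ler_norml.
have [[j _]|nI] := pselect (exists j : I, True); last first.
  exfalso; move: h_sum; rewrite esum1 => [[]|j]; first by move/eqP; rewrite eq_sym oner_eq0.
  by case: nI; exists j.
have c0 : 0 <= c by rewrite (le_trans _ (vc j)).
rewrite dsumE.
have [E1 _] := @S_fin (fun j => Num.max (v j) 0) c ltac:(move=> k; rewrite le_max lexx orbT ge_max c0 andbT; by have /andP[] := vb k).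
have [E2 _] := @S_fin (fun j => Num.max (- v j) 0) c ltac:(move=> k; rewrite le_max lexx orbT ge_max c0 andbT lerNl; by have /andP[] := vb k).
have vc0 (k : I) : 0 <= v k + c by rewrite -lerBlDr sub0r; have /andP[] := vb k.
have [E3 _] := @S_fin (fun j => v j + c) (c + c) ltac:(move=> k; rewrite vc0 lerD2r; by have /andP[] := vb k).
have : (S (fun j => v j + c)%R + S (fun j => Num.max (- v j) 0)%R =
        S (fun j => Num.max (v j) 0)%R + S (fun=> c)%R)%E.
  rewrite !SD//; last 2 first.
  - by move=> k; rewrite le_max lexx orbT.
  - by move=> k; rewrite le_max lexx orbT.
  congr S; apply/funext => k.
  case: (leP (v k) 0) => vk; first by rewrite max_l ?oppr_ge0//; ring.
  by rewrite max_r ?oppr_le0 ?(ltW vk)//; ring.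
rewrite E1 E2 E3 S_cst// -!EFinD /= => -[].
by move: {E1 E2 E3} (fine _) (fine _) (fine _) => x y z; lra.
Qed.

Lemma dsum_le (v : I -> R) (c : R) : (forall j, `|v j| <= c) -> `|dsum (fun j => h j * v j)| <= c.
Proof.
move=> vc; rewrite (dsum_shift _ _ vc).
have vb (j : I) : - c <= v j <= c by rewrite -ler_norml.
have vc0 (k : I) : 0 <= v k + c by rewrite -lerBlDr sub0r; have /andP[] := vb k.
have [E3 E4] := @S_fin (fun j => v j + c) (c + c) ltac:(move=> k; rewrite vc0 lerD2r; by have /andP[] := vb k).
have : 0 <= fine (S (fun j => v j + c)) by rewrite fine_ge0// S_ge0.
rewrite ler_norml; move: {E3} (fine _) E4 => x; lra.
Qed.

Lemma dsumD (u v : I -> R) : bounded_seq u -> bounded_seq v ->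
  dsum (fun j => h j * (u j + v j)) =
  dsum (fun j => h j * u j) + dsum (fun j => h j * v j).
Proof.
move=> [a ua] [b vb]; rewrite (dsum_shift _ _ ua) (dsum_shift _ _ vb).
rewrite (@dsum_shift (fun j => u j + v j) (a + b)); last first.
  by move=> j; rewrite (le_trans (ler_normD _ _))// lerD.
have ua' (j : I) : - a <= u j <= a by rewrite -ler_norml.
have vb' (j : I) : - b <= v j <= b by rewrite -ler_norml.
have ua0 (k : I) : 0 <= u k + a by rewrite -lerBlDr sub0r; have /andP[] := ua' k.
have vb0 (k : I) : 0 <= v k + b by rewrite -lerBlDr sub0r; have /andP[] := vb' k.
have [E1 _] := @S_fin (fun j => u j + a) (a + a) ltac:(move=> k; rewrite ua0 lerD2r; by have /andP[] := ua' k).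
have [E2 _] := @S_fin (fun j => v j + b) (b + b) ltac:(move=> k; rewrite vb0 lerD2r; by have /andP[] := vb' k).
rewrite (_ : S _ = S (fun j => u j + a)%R + S (fun j => v j + b)%R)%E.
  by rewrite E1 E2 /=; ring.
by rewrite SD//; congr S; apply/funext => k; ring.
Qed.

(** A positive factor commutes with [fine] even on an infinite sum, both sides being 0 then; a
    negative factor exchanges the positive and negative parts. *)
Lemma dsumZ (a : R) (v : I -> R) : dsum (fun j => h j * (a * v j)) = a * dsum (fun j => h j * v j).
Proof.
have pos (b : R) (u : I -> R) : 0 <= b -> dsum (fun j => h j * (b * u j)) = b * dsum (fun j => h j * u j).
  move=> b0; rewrite !dsumE mulrBr.
  have E (w : I -> R) : fine (S (fun j => Num.max (b * w j) 0)) = b * fine (S (fun j => Num.max (w j) 0)).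
    rewrite (_ : (S (fun j => Num.max (b * w j) 0)%R = b%:E * S (fun j => Num.max (w j) 0)%R)%E).
      have [->|bn] := eqVneq b 0; first by rewrite mul0e mul0r.
      have {}bn : (0 < b%:E)%E by rewrite lte_fin lt_def bn.
      by case: (S _) => [r||]//; rewrite ?gt0_muley ?gt0_muleNy//= mulr0.
    rewrite /S -esumZl//; last by move=> j; rewrite mulr_ge0// le_max lexx orbT.
    by apply: eq_esum => j _; rewrite max0M// mulrCA.
  rewrite E; congr (_ - _); rewrite -E; congr (fine _); congr S.
  by apply/funext => j; rewrite mulrN.
have [a0|a0] := lerP 0 a; first exact: pos.
have neg (u : I -> R) : dsum (fun j => h j * - u j) = - dsum (fun j => h j * u j).
  rewrite !dsumE opprB; congr (_ - fine _); congr S.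
  by apply/funext => j; rewrite opprK.
rewrite -[RHS]opprK -mulNr -pos ?oppr_ge0 ?ltW// -neg.
by congr dsum; apply/funext => j; rewrite mulNr opprK.
Qed.

End StochasticRow.

Section FixedPoint.
Context {R : realType} {I : countType}.
Variable h : I -> I -> R.
Hypothesis h_ge0 : forall i j, 0 <= h i j.
Hypothesis h_sum : forall i, (\esum_(j in [set: I]) (h i j)%:E = 1)%E.

(** Banach's fixed point argument in the sup norm, carried out by hand: averaging against a
    stochastic row does not increase the norm, and multiplication by [g] contracts it by [c]. *)
Lemma fixed_point_exists (a g : I -> R) (A c : R) : 0 <= c < 1 ->
  (forall i, `|a i| <= A) -> (forall i, `|g i| <= c) ->
  exists K : I -> R, bounded_seq K /\
    K = fun i => a i + g i * dsum (fun j => h i j * K j).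
Proof.
move=> /andP[c0 c1] aA gc.
have [[i0 _]|nI] := pselect (exists i : I, True); last first.
  exists (fun=> 0); split; first by exists 0 => i; rewrite normr0.
  by apply/funext => i; case: nI; exists i.
have A0 : 0 <= A by rewrite (le_trans _ (aA i0)).
pose F (v : I -> R) i := a i + g i * dsum (fun j => h i j * v j).
pose v n := iter n F (fun=> 0).
(* The radius with [A + c * B = B]: the ball is invariant, and [B * c^n] is the tail of the
   geometric series of increments. *)
pose B := A / (1 - c).
have B0 : 0 <= B by rewrite divr_ge0// subr_ge0 ltW.
have c10 : 1 - c != 0 by rewrite gt_eqF// subr_gt0.
have BE : A + c * B = B by rewrite /B; field.
have bnd (u : I -> R) : (forall i, `|u i| <= B) -> forall i, `|F u i| <= B.
  move=> uB i; rewrite /F (le_trans (ler_normD _ _))// -[leRHS]BE lerD//.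
  rewrite normrM ler_pM//; exact: dsum_le.
have vB n i : `|v n i| <= B.
  by elim: n i => [|n IH] i /=; [rewrite normr0|exact: bnd].
have dif (u w : I -> R) (e : R) : (forall i, `|u i| <= B) -> (forall i, `|w i| <= B) ->
    (forall i, `|u i - w i| <= e) -> forall i, `|F u i - F w i| <= c * e.
  move=> uB wB uw i.
  have -> : F u i - F w i = g i * dsum (fun j => h i j * (u j - w j)).
    rewrite (_ : (fun j => h i j * (u j - w j)) =
      fun j => h i j * (u j + (-1) * w j)); last by apply/funext => j; ring.
    rewrite dsumD//; last 2 first.
    - by exists B.
    - by exists B => j; rewrite mulN1r normrN.
    by rewrite dsumZ// /F; ring.
  by rewrite normrM ler_pM//; exact: dsum_le.
have step n i : `|v n.+1 i - v n i| <= A * c ^+ n.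
  elim: n i => [|n IH] i.
    rewrite /v /= subr0 expr0 mulr1 /F.
    rewrite (_ : (fun j => h i j * 0) = fun j => h i j * (0 * 0)); last by apply/funext => j; rewrite mul0r.
    by rewrite dsumZ// mul0r mulr0 addr0.
  rewrite exprS mulrCA; exact: (dif _ _ _ (vB n.+1) (vB n) IH i).
(* [y ^~ i] increases, [z ^~ i] decreases and [v n i] lies between them, so
   the limit of the iterates is a supremum *)
pose y n i := v n i - B * c ^+ n.
pose z n i := v n i + B * c ^+ n.
have BA n : B * c ^+ n - B * c ^+ n.+1 = A * c ^+ n.
  by rewrite exprS /B; field.
have ynd i n m : (n <= m)%N -> y n i <= y m i.
  elim: m => [|m IH]; first by rewrite leqn0 => /eqP->.
  rewrite leq_eqVlt => /orP[/eqP->//|]; rewrite ltnS => /IH /le_trans; apply.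
  have := step m i; have := BA m; rewrite /y ler_norml => ? /andP[]; lra.
have zni i n m : (n <= m)%N -> z m i <= z n i.
  elim: m => [|m IH]; first by rewrite leqn0 => /eqP->.
  rewrite leq_eqVlt => /orP[/eqP->//|]; rewrite ltnS => /IH; apply: le_trans.
  have := step m i; have := BA m; rewrite /z ler_norml => ? /andP[]; lra.
have yz n i : y n i <= z n i.
  have : 0 <= B * c ^+ n by rewrite mulr_ge0// exprn_ge0.
  by rewrite /y /z; lra.
have yz2 i n m : y n i <= z m i.
  rewrite (le_trans (ynd i n (maxn n m) (leq_maxl _ _)))//.
  by rewrite (le_trans (yz _ _))// zni// leq_maxr.
pose K i := sup (range (y ^~ i)).
have hs i : has_sup (range (y ^~ i)).
  split; first by exists (y 0%N i), 0%N.
  by exists (z 0%N i) => _ [n _ <-].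
have Kv n i : `|K i - v n i| <= B * c ^+ n.
  have h1 : y n i <= K i by apply: sup_upper_bound => //; exists n.
  have h2 : K i <= z n i by apply: ge_sup => [|_ [m _ <-]//]; have [] := hs i.
  by rewrite ler_norml; move: h1 h2; rewrite /y /z; lra.
have KB i : `|K i| <= B by have := Kv 0%N i; rewrite /v /= subr0 expr0 mulr1.
exists K; split; first by exists B.
apply/funext => i; rewrite -/(F K i).
apply/eqP; rewrite -subr_eq0 -normr_le0.
have lim : (2 * B) * c ^+ n @[n --> \oo] --> (0 : R).
  by apply: cvg_geometric; rewrite ger0_norm.
rewrite -(cvg_lim _ lim)//; apply: limr_ge; first by apply/cvg_ex; exists 0.
near=> n.
have h1 := Kv n.+1 i; have h2 := dif K (v n) _ KB (vB n) (Kv n) i.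
rewrite -[F (v n) i]/(v n.+1 i) in h2.
have := ler_normB (K i - v n.+1 i) (F K i - v n.+1 i).
rewrite (_ : K i - v n.+1 i - (F K i - v n.+1 i) = K i - F K i); last by ring.
have h3 : c * (B * c ^+ n) <= B * c ^+ n by apply: ler_piMl; [rewrite mulr_ge0 ?exprn_ge0|exact: ltW].
by rewrite exprS mulrCA in h1; lra.
Unshelve. all: by end_near. Qed.

End FixedPoint.

(** * Integration of the one-step bounds *)

Section Moments.
Context {d : measure_display} {T : measurableType d} {R : realType}.
Variables (P : probability T R) (alpha b : R) (m : T -> R).
Hypothesis alpha0 : 0 < alpha.
Hypothesis ab : alpha < b.
Hypothesis mm : measurable_fun setT m.
Variable Cb : R.
Hypothesis m_mom : (\int[P]_w (`|m w| `^ b)%:E <= Cb%:E)%E.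
Local Notation integrable g := (P.-integrable setT (EFin \o (g : T -> R))).

Lemma measurable_powR_norm (p : R) : measurable_fun setT (fun w => `|m w| `^ p).
Proof.
apply: (measurableT_comp (f := fun x : R => x `^ p)); last exact: measurable_abs.
exact: measurable_powR.
Qed.

Lemma measurable_spow eta : measurable_fun setT (fun w => spow alpha eta (m w)).
Proof.
rewrite /spow; apply: measurable_funM; first exact: measurable_powR_norm.
apply: measurable_fun_ifT; [|exact: measurable_cst..].
by apply: measurable_fun_ltr; [exact: measurable_cst|exact: measurable_scale].
Qed.

Lemma integrable_powR_norm : integrable (fun w => `|m w| `^ b).
Proof.
apply/integrableP; split; first exact/measurable_EFinP/measurable_powR_norm.
apply: (le_lt_trans _ (ltry Cb)); apply: le_trans m_mom.
under eq_integral do rewrite /= ger0_norm ?powR_ge0//.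
exact: lexx.
Qed.

Lemma integrable_spow eta : integrable (fun w => spow alpha eta (m w)).
Proof.
have intc : integrable (fun=> 1).
  exact: finite_measure_integrable_cst.
apply: (le_integrable _ _ _ (integrableD _ intc integrable_powR_norm)) => //.
  exact/measurable_EFinP/measurable_spow.
move=> w _ /=; rewrite lee_fin ger0_norm ?spow_ge0//.
rewrite ger0_norm ?addr_ge0 ?powR_ge0//.
apply: (le_trans _ (powR_le1D _ alpha _ _ _)); [|by []|by rewrite !ltW].
by rewrite /spow; case: ifP => _; rewrite ?mulr1// mulr0 powR_ge0.
Qed.

Lemma integrable_event (a : T -> bool) : measurable [set w | a w] ->
  integrable (fun w => (a w)%:R) /\ \int[P]_w (a w)%:R = prob P [set w | a w].
Proof.
move=> mA.
have E : (fun w => (a w)%:R) = \1_[set w | a w] :> (T -> R).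
  by apply/funext => w; rewrite indicE mem_setE.
rewrite E; split; first exact: integrable_indic.
by rewrite /Rintegral integral_indic// setIT.
Qed.

(** The common shape of the one-step bounds as functions of [(Q, M)]: two indicators for [Q], the
    signed [alpha]-powers and the [b]-power of [M], and a constant. Being linear in these, it
    integrates term by term. *)
Definition combo (x1 x2 k1 k2 k3 k4 : R) (a1 a2 : T -> bool) w :=
  x1 * (a1 w)%:R + x2 * (a2 w)%:R +
  (k1 * spow alpha 1 (m w) + k2 * spow alpha (-1) (m w)
   + k3 * `|m w| `^ b + k4).

Let iD (g1 g2 : T -> R) : integrable g1 -> integrable g2 -> integrable (fun w => g1 w + g2 w).
Proof. by move=> h1 h2; exact: (integrableD measurableT h1 h2). Qed.

Let iZ (k : R) (g : T -> R) : integrable g -> integrable (fun w => k * g w).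
Proof. by move=> h; exact: (integrableZl measurableT k h). Qed.

Lemma integral_combo (x1 x2 k1 k2 k3 k4 : R) (a1 a2 : T -> bool) :
  measurable [set w | a1 w] -> measurable [set w | a2 w] ->
  integrable (combo x1 x2 k1 k2 k3 k4 a1 a2) /\
  \int[P]_w combo x1 x2 k1 k2 k3 k4 a1 a2 w =
    x1 * prob P [set w | a1 w] + x2 * prob P [set w | a2 w] +
    (k1 * mom P alpha 1 m + k2 * mom P alpha (-1) m
     + k3 * \int[P]_w (`|m w| `^ b) + k4).
Proof.
move=> ma1 ma2.
have [i1 e1] := integrable_event _ ma1.
have [i2 e2] := integrable_event _ ma2.
have s1 := integrable_spow 1; have s2 := integrable_spow (-1).
have pb := integrable_powR_norm.
have intc : integrable (fun=> k4) by exact: finite_measure_integrable_cst.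
have j1 := iZ x1 _ i1; have j2 := iZ x2 _ i2.
have t1 := iZ k1 _ s1; have t2 := iZ k2 _ s2; have t3 := iZ k3 _ pb.
have l1 := iD _ _ j1 j2; have l2 := iD _ _ t1 t2; have l3 := iD _ _ l2 t3.
have l4 := iD _ _ l3 intc.
split; first exact: iD.
rewrite /combo (RintegralD _ l1 l4)// (RintegralD _ j1 j2)//.
rewrite (RintegralD _ l3 intc)// (RintegralD _ l2 t3)// (RintegralD _ t1 t2)//.
rewrite !RintegralZl// e1 e2 Rintegral_cst//.
congr (_ + (_ + _)); rewrite -[RHS]mulr1; congr (_ * _); exact: (prob_setT P).
Qed.

Lemma int_le_combo (g : T -> R) (x1 x2 k1 k2 k3 k4 : R) (a1 a2 : T -> bool) :
  measurable [set w | a1 w] -> measurable [set w | a2 w] ->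
  measurable_fun setT g -> (forall w, 0 <= g w <= 1) ->
  (forall w, g w <= combo x1 x2 k1 k2 k3 k4 a1 a2 w) ->
  \int[P]_w g w <= x1 * prob P [set w | a1 w] + x2 * prob P [set w | a2 w] +
    (k1 * mom P alpha 1 m + k2 * mom P alpha (-1) m
     + k3 * \int[P]_w (`|m w| `^ b) + k4).
Proof.
move=> ma1 ma2 mg g01 gc; have [ic <-] := integral_combo x1 x2 k1 k2 k3 k4 _ _ ma1 ma2.
apply: le_Rintegral => //.
have intc : integrable (fun=> 1) by exact: finite_measure_integrable_cst.
apply: (le_integrable _ _ _ intc) => //; first exact/measurable_EFinP.
by move=> w _ /=; have /andP[g0 g1] := g01 w; rewrite lee_fin normr1 ger0_norm.
Qed.

Lemma int_ge_combo (g : T -> R) (x1 x2 k1 k2 k3 k4 : R) (a1 a2 : T -> bool) :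
  measurable [set w | a1 w] -> measurable [set w | a2 w] ->
  measurable_fun setT g -> (forall w, 0 <= g w <= 1) ->
  (forall w, combo x1 x2 k1 k2 k3 k4 a1 a2 w <= g w) ->
  x1 * prob P [set w | a1 w] + x2 * prob P [set w | a2 w] +
    (k1 * mom P alpha 1 m + k2 * mom P alpha (-1) m
     + k3 * \int[P]_w (`|m w| `^ b) + k4) <= \int[P]_w g w.
Proof.
move=> ma1 ma2 mg g01 gc; have [ic <-] := integral_combo x1 x2 k1 k2 k3 k4 _ _ ma1 ma2.
apply: le_Rintegral => //.
have intc : integrable (fun=> 1) by exact: finite_measure_integrable_cst.
apply: (le_integrable _ _ _ intc) => //; first exact/measurable_EFinP.
by move=> w _ /=; have /andP[g0 g1] := g01 w; rewrite lee_fin normr1 ger0_norm.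
Qed.

Lemma mom_b_bounds : 0 <= \int[P]_w (`|m w| `^ b) <= Cb.
Proof.
rewrite Rintegral_ge0/=; last by move=> w _; rewrite powR_ge0.
rewrite -lee_fin /Rintegral fineK//.
exact: integrable_fin_num integrable_powR_norm.
Qed.

Lemma mom_ge0 eta : 0 <= mom P alpha eta m.
Proof. by apply: Rintegral_ge0 => w _; exact: spow_ge0. Qed.

End Moments.

(** * Tails of the partial sums: a priori bound and contraction *)

Section PerpetuityTail.
Context {R : realType} {d : measure_display} {T : measurableType d}.
Variables (alpha : R) (f : R -> R) (F0 : R).
Hypothesis alpha0 : 0 < alpha.
Hypothesis f_noninc : forall x y : R, x <= y -> f y <= f x.
Hypothesis f_gt0 : forall x : R, 0 < f x.
Hypothesis f_le : forall x : R, f x <= F0.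
Hypothesis f_rv : forall m : R, 0 < m -> forall e : R, 0 < e ->
  \forall u \near +oo, `|f (u / m) - m `^ alpha * f u| <= e * f u.

(** An abstract model: [U N C i] stands for the conditional probability, given the state [i] at time
    0, that the partial sum with [N] terms lies in [C]; [r N] is the partial sum ending one step
    earlier, studied under [V i]. *)
Context {D : countType} (P : probability T R) (Q M : D -> T -> R)
  (V : D -> probability T R) (r : nat -> T -> R) (U : nat -> set R -> D -> R)
  (H : D -> D -> R).
Hypothesis mQ : forall i, measurable_fun setT (Q i).
Hypothesis mM : forall i, measurable_fun setT (M i).
Hypothesis mr : forall N, measurable_fun setT (r N).
Hypothesis U_ge0 : forall N C i, 0 <= U N C i.
Hypothesis U_le1 : forall N (C : set R) i, measurable C -> U N C i <= 1.
Hypothesis U_le : forall N (C C' : set R) i, measurable C -> measurable C' ->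
  C `<=` C' -> U N C i <= U N C' i.
Hypothesis U_init : forall (t : R) i, 0 <= t -> U 0 [set x | t < `|x|] i = 0.
Hypothesis U_step : forall N i (C : set R), measurable C ->
  measurable_fun setT (fun w => prob (V i) [set v | C (Q i w + M i w * r N v)]) /\
  U N.+1 C i = \int[P]_w prob (V i) [set v | C (Q i w + M i w * r N v)].
Hypothesis V_mix : forall N i (C : set R), measurable C ->
  (prob (V i) (r N @^-1` C))%:E = (\esum_(j in [set: D]) (H i j * U N C j)%:E)%E.
Hypothesis H_ge0 : forall i j, 0 <= H i j.
Hypothesis H_sum : forall i, (\esum_(j in [set: D]) (H i j)%:E = 1)%E.
Variables (b Cb c : R).
Hypothesis ab : alpha < b.
Hypothesis Cb0 : 0 <= Cb.
Hypothesis M_mom : forall i, (\int[P]_w (`|M i w| `^ b)%:E <= Cb%:E)%E.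
Hypothesis c01 : 0 <= c < 1.
Hypothesis M_contract : forall i,
  mom P alpha 1 (M i) + mom P alpha (-1) (M i) <= c.
Variables (Cq : R).
Hypothesis Cq0 : 0 <= Cq.
Hypothesis Q_tail : \forall t \near +oo, forall i,
  prob P [set w | t < `|Q i w|] <= Cq * f t.

Let rv_shift := @rv_shift R alpha f alpha0 f_noninc f_gt0 f_rv.
Let affine_tail := @affine_tail R d T alpha f F0 alpha0 f_noninc f_gt0 f_le f_rv.
Let affine_apriori := @affine_apriori R d T alpha f F0 alpha0 f_noninc f_gt0 f_le f_rv.

Let measurable_gt_abs (t : R) : measurable [set x : R | t < `|x|].
Proof. by apply: measurable_gtr; exact: measurable_abs. Qed.

Let V_dsum N i (C : set R) : measurable C ->
  prob (V i) (r N @^-1` C) = dsum (fun j => H i j * U N C j).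
Proof. by move=> mC; rewrite dsum_ge0E// -V_mix. Qed.

Let U_bounded N C : measurable C -> bounded_seq (U N C).
Proof. by move=> mC; exists 1 => i; rewrite ger0_norm ?U_ge0// U_le1. Qed.

Let f_shrink (dt : R) : 0 < dt -> exists2 C : R, 0 <= C &
  \forall t \near +oo, f (dt * t) <= C * f t.
Proof.
move=> dt0; exists (dt^-1 `^ alpha + 1); first by rewrite addr_ge0 ?powR_ge0.
near=> t.
have : `|f (t / dt^-1) - dt^-1 `^ alpha * f t| <= 1 * f t.
  by near: t; apply: f_rv; rewrite ?invr_gt0.
by rewrite invrK mulrC ler_norml => /andP[_]; lra.
Unshelve. all: by end_near. Qed.

(** Induction on [N] with a constant that reproduces itself. With [e * (1 + Cb) = (1 - c) / 2], one
    step multiplies [C] by [(1 + c) / 2 < 1] and adds a quantity independent of [C]. *)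
Lemma perp_apriori : exists2 S : R, 0 < S & exists2 C : R, 0 <= C &
  forall N i t, S <= t -> U N [set x | t < `|x|] i <= C * f t.
Proof.
have [c0 c1] : 0 <= c /\ c < 1 by apply/andP.
have al0 := alpha0; have Cb0' := Cb0.
pose e : R := (1 - c) / (2 * (1 + Cb)).
have e0 : 0 < e by rewrite divr_gt0 ?mulr_gt0 ?subr_gt0// ltr_wpDr.
have eE : e * (1 + Cb) = (1 - c) / 2 by rewrite /e; field; rewrite gt_eqF// ltr_wpDr.
have e1 : e <= 1.
  have : e <= e * (1 + Cb) by rewrite ler_peMr ?(ltW e0)// lerDl.
  by rewrite eE; lra.
clearbody e.
have [dt dtb [S0 S00 HA]] := affine_apriori b e ab ltac:(by rewrite e0 e1).
have dt0 : 0 < dt by have /andP[] := dtb.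
have [Cd Cd0 Hd] := f_shrink dt dt0.
have [T1 T10 H1] := near_pinfty_ex _ Hd.
have [T2 T20 H2] := near_pinfty_ex _ Q_tail.
pose S := S0 + T1 + T2 / dt.
have T2d : 0 < T2 / dt by rewrite divr_gt0.
have SS : S0 <= S by rewrite /S; lra.
have [A A0 {}HA] := HA S SS.
have S0' : 0 < S by rewrite /S; lra.
(* The fixed point of the affine map that one step induces on the constants. *)
pose C := 2 * (Cq * Cd + A * Cb) / (1 - c).
have C0 : 0 <= C.
  by rewrite /C divr_ge0 ?subr_ge0 ?(ltW c1)// mulr_ge0// addr_ge0// mulr_ge0.
have CE : Cq * Cd + (C * (c + e * (1 + Cb)) + A * Cb) = C.
  by rewrite eE /C; field; rewrite gt_eqF// subr_gt0.
have [T1S T2S] : T1 <= S /\ T2 / dt <= S by rewrite /S; split; lra.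
clearbody C S.
exists S => //; exists C => //.
elim=> [|N IH] i t St; first by rewrite U_init ?mulr_ge0 ?(ltW (f_gt0 t))//; lra.
have [mI ->] := U_step N i _ (measurable_gt_abs t).
have t0 : 0 < t by lra.
have ft := f_gt0 t.
have mqd : measurable [set w | (dt * t < `|Q i w|)%R].
  by apply: measurable_gtr; exact: measurable_abs.
apply: (le_trans (int_le_combo P alpha b (M i) alpha0 ab (mM i) Cb (M_mom i)
   _ 1 0 (C * f t) (C * f t) ((C * e + A) * f t) (C * e * f t) _
   (fun=> false) mqd _ mI _ _)).
- rewrite (_ : [set _ | _] = set0)//; last by apply/seteqP; split.
- move=> w; rewrite prob_ge0/= prob_le1//.
  have mh := measurable_affine _ (Q i w) (M i w) (mr N).
  exact: (measurable_preim _ _ mh (measurable_gt_abs t)).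
- move=> w; have := HA C (V i) (r N) (Q i w) (M i w) t C0 (mr N) _ St.
  have VS s : S <= s -> prob (V i) [set v | s < `|r N v|] <= C * f s.
    move=> Ss; have := V_dsum N i _ (measurable_gt_abs s); rewrite /preimage/= => ->.
    apply: (le_trans (ler_norm _)); apply: dsum_le => // j.
    by rewrite ger0_norm ?IH.
  move=> /(_ VS) /le_trans; apply.
  rewrite /combo -(spowD _ alpha0) mul0r mul1r addr0.
  by rewrite le_eqVlt; apply/orP; left; apply/eqP; ring.
have h1 : prob P [set w | dt * t < `|Q i w|] <= Cq * Cd * f t.
  apply: (@le_trans _ _ (Cq * f (dt * t))).
    by apply: H2; rewrite mulrC -ler_pdivrMr//; lra.
  by rewrite -mulrA ler_wpM2l// H1//; lra.
have /andP[mb0 mbC] := mom_b_bounds P b (M i) (mM i) Cb (M_mom i).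
have h2 : (C * e + A) * f t * \int[P]_w (`|M i w| `^ b) <= (C * e + A) * f t * Cb.
  by apply: ler_wpM2l => //; rewrite mulr_ge0 ?(ltW ft)// addr_ge0// mulr_ge0// ltW.
have h3 : C * f t * (mom P alpha 1 (M i) + mom P alpha (-1) (M i)) <= C * f t * c.
  by apply: ler_wpM2l => //; rewrite mulr_ge0// ltW.
rewrite mul1r mul0r addr0.
have h4 : Cq * Cd * f t + (C * f t * c + (C * e + A) * f t * Cb + C * e * f t) = C * f t.
  by rewrite -[in RHS]CE; ring.
by rewrite -[leRHS]h4; move: h1 h2 h3; lra.
Unshelve. all: by end_near. Qed.

Variables (q1 qm1 k1 km1 : D -> R) (K : R).
Hypothesis k1_le : forall i, `|k1 i| <= K.
Hypothesis km1_le : forall i, `|km1 i| <= K.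
Hypothesis q1_tail : forall e : R, 0 < e -> \forall t \near +oo, forall i,
  `|prob P [set w | t < Q i w] - q1 i * f t| <= e * f t.
Hypothesis qm1_tail : forall e : R, 0 < e -> \forall t \near +oo, forall i,
  `|prob P [set w | t < - Q i w] - qm1 i * f t| <= e * f t.
Hypothesis q1_le : forall i, `|q1 i| <= Cq.
Hypothesis qm1_le : forall i, `|qm1 i| <= Cq.
Hypothesis k1_eq : forall i, k1 i = q1 i
  + mom P alpha 1 (M i) * dsum (fun j => H i j * k1 j)
  + mom P alpha (-1) (M i) * dsum (fun j => H i j * km1 j).
Hypothesis km1_eq : forall i, km1 i = qm1 i
  + mom P alpha 1 (M i) * dsum (fun j => H i j * km1 j)
  + mom P alpha (-1) (M i) * dsum (fun j => H i j * k1 j).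

(** The bound [dl] is relative to [f t] and covers both signs. The threshold in [t] is common to all
    states and all [N >= N0]; [N0] excludes early partial sums, whose tail constants differ. *)
Let deviation (dl : R) := exists N0 : nat, \forall t \near +oo,
  forall N i, (N0 <= N)%N ->
    `|U N [set x | t < x] i - k1 i * f t| <= dl * f t /\
    `|U N [set x | t < - x] i - km1 i * f t| <= dl * f t.

Let measurable_gt (t : R) : measurable [set x : R | t < x].
Proof. by apply: measurable_gtr. Qed.

Let measurable_gtN (t : R) : measurable [set x : R | t < - x].
Proof. by apply: measurable_gtr; exact: measurable_funN. Qed.

(** Averaging over the previous state replaces [k] by its average and, the row being stochastic,
    does not enlarge the error. *)
Let V_close N i (C : set R) (k : D -> R) (dl t : R) : measurable C ->
  (forall j, `|k j| <= K) -> 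
  (forall j, `|U N C j - k j * f t| <= dl * f t) ->
  `|prob (V i) (r N @^-1` C) - dsum (fun j => H i j * k j) * f t| <= dl * f t.
Proof.
move=> mC kK UC; rewrite V_dsum//.
have -> : dsum (fun j => H i j * U N C j) - dsum (fun j => H i j * k j) * f t =
    dsum (fun j => H i j * (U N C j - k j * f t)).
  rewrite (_ : (fun j => H i j * (U N C j - k j * f t)) =
    fun j => H i j * (U N C j + (- f t) * k j)); last by apply/funext => j; ring.
  rewrite dsumD//; last 2 first.
  - exact: U_bounded.
  - exists (f t * K) => j; rewrite normrM normrN (gtr0_norm (f_gt0 t)).
    by rewrite ler_wpM2l// ltW.
  by rewrite dsumZ//; ring.
exact: dsum_le.
Qed.

(* the bound for the lower tail follows by negating [Q] and [M] *)
Let contraction_side (Q' M' : D -> T -> R) (q k k' : D -> R) (dl S e : R) :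
  (forall i, measurable_fun setT (Q' i)) -> (forall i, measurable_fun setT (M' i)) ->
  (forall i w, `|M' i w| = `|M i w|) ->
  (forall i, mom P alpha 1 (M' i) + mom P alpha (-1) (M' i) <= c) -> (forall i w, `|Q' i w| = `|Q i w|) ->
  (forall e' : R, 0 < e' -> \forall t \near +oo, forall i,
    `|prob P [set w | t < Q' i w] - q i * f t| <= e' * f t) ->
  (forall i, `|q i| <= Cq) ->
  0 <= dl -> 0 < S -> 0 < e ->
  (forall i, `|k i| <= K) -> (forall i, `|k' i| <= K) ->
  \forall t \near +oo, forall N i,
    tails f (V i) (r N) S (k i) (k' i) dl ->
    measurable_fun setT (fun w => prob (V i) [set v | t < Q' i w + M' i w * r N v]) ->
    `|\int[P]_w prob (V i) [set v | t < Q' i w + M' i w * r N v] -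
      (q i + mom P alpha 1 (M' i) * k i + mom P alpha (-1) (M' i) * k' i) * f t|
    <= (c * dl + e) * f t.
Proof.
move=> mQ' mM' MM' cM' QQ' q_tail q_le dl0 S0 e0 kK k'K.
have al0 := alpha0; have Cb0' := Cb0; have Cq0' := Cq0.
(* The denominator leaves room for [Cq + 2] from the tail of [Q'], 1 from the joint event, and
   [Cb + 1] from integrating [1 + |M'|^b]. *)
pose e1 := Num.min 1 (e / (Cq + Cb + 5)).
have D0 : 0 < Cq + Cb + 5 by lra.
have e10 : 0 < e1 by rewrite lt_min ltr01 divr_gt0.
have e11 : e1 <= 1 by rewrite ge_min lexx.
have e1e : e1 * (Cq + Cb + 5) <= e by rewrite -ler_pdivlMr// ge_min lexx orbT.
clearbody e1.
have [dt dtb [Hsh HA]] := affine_tail b dl S K e1 ab dl0 S0 e10.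
have [dt0 dt1] : 0 < dt /\ dt < 2^-1 by apply/andP.
have [Cd Cd0 Hd] := f_shrink dt dt0.
have E2 : 0 < Cq * Cd + 1 by rewrite ltr_wpDl// mulr_ge0.
(* Since [|Q'| > dt * t] has probability at most [Cq * Cd * f t], this makes the joint event cost at
   most [e1 * f t]. *)
pose e2 := e1 / (Cq * Cd + 1).
have e20 : 0 < e2 by rewrite divr_gt0.
have e2E : e2 * (Cq * Cd) <= e1.
  by rewrite /e2 mulrAC ler_pdivrMr// ler_wpM2l ?(ltW e10)// lerDl.
clearbody e2.
have {}HA := HA e2 e20.
have [T1 T10 H1] := near_pinfty_ex _ (q_tail e1 e10).
have [T2 T20 H2] := near_pinfty_ex _ Q_tail.
near=> t => N i tl mI.
have t0 : 0 < t by near: t; apply: nbhs_pinfty_gt; rewrite num_real.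
have [sh1 sh2] : f ((1 - dt) * t) <= (1 + e1) * f t /\
    (1 - e1) * f t <= f ((1 + dt) * t) by near: t; exact: Hsh.
have td1 : T1 <= (1 - dt) * t.
  have : 2 * T1 <= t by near: t; exact: near_pinfty_ge.
  have : dt * t < 2^-1 * t by rewrite ltr_pM2r.
  by lra.
have td2 : T1 <= (1 + dt) * t.
  have : T1 <= t by near: t; exact: near_pinfty_ge.
  have : 0 < dt * t by rewrite mulr_gt0.
  by lra.
have td3 : T2 <= dt * t.
  by rewrite mulrC -ler_pdivrMr//; near: t; exact: near_pinfty_ge.
have fd : f (dt * t) <= Cd * f t by near: t; exact: Hd.
have hA : forall q0 m0 : R,
    prob (V i) [set w | t < q0 + m0 * r N w] <=
      ((1 - dt) * t < q0)%R%:R + e2 * (dt * t < `|q0|)%R%:R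
      + (k i * spow alpha 1 m0 + k' i * spow alpha (-1) m0
         + (dl * `|m0| `^ alpha + e1 * (1 + `|m0| `^ b))) * f t /\
    ((1 + dt) * t < q0)%R%:R - e2 * (dt * t < `|q0|)%R%:R
      + (k i * spow alpha 1 m0 + k' i * spow alpha (-1) m0
         - (dl * `|m0| `^ alpha + e1 * (1 + `|m0| `^ b))) * f t
    <= prob (V i) [set w | t < q0 + m0 * r N w].
  suff : forall (V0 : probability T R) (r0 : T -> R) (k0 k0' q0 m0 : R), `|k0| <= K -> `|k0'| <= K ->
    tails f V0 r0 S k0 k0' dl ->
    prob V0 [set w | t < q0 + m0 * r0 w] <=
      ((1 - dt) * t < q0)%R%:R + e2 * (dt * t < `|q0|)%R%:R
      + (k0 * spow alpha 1 m0 + k0' * spow alpha (-1) m0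
         + (dl * `|m0| `^ alpha + e1 * (1 + `|m0| `^ b))) * f t /\
    ((1 + dt) * t < q0)%R%:R - e2 * (dt * t < `|q0|)%R%:R
      + (k0 * spow alpha 1 m0 + k0' * spow alpha (-1) m0
         - (dl * `|m0| `^ alpha + e1 * (1 + `|m0| `^ b))) * f t
    <= prob V0 [set w | t < q0 + m0 * r0 w].
    by move=> HV q0 m0; exact (HV (V i) (r N) (k i) (k' i) q0 m0 (kK i) (k'K i) tl).
  by near: t; exact: HA.
have ft := f_gt0 t.
have mqd : measurable [set w | (dt * t < `|Q' i w|)%R].
  by apply: measurable_gtr; exact: measurable_abs.
have mq1 : measurable [set w | ((1 - dt) * t < Q' i w)%R] by exact: measurable_gtr.
have mq2 : measurable [set w | ((1 + dt) * t < Q' i w)%R] by exact: measurable_gtr.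
have p01 w : 0 <= prob (V i) [set v | t < Q' i w + M' i w * r N v] <= 1.
  rewrite prob_ge0/= prob_le1//.
  have mh := measurable_affine _ (Q' i w) (M' i w) (mr N).
  exact: (measurable_preim _ _ mh (measurable_gt t)).
have M'_mom : (\int[P]_w (`|M' i w| `^ b)%:E <= Cb%:E)%E.
  by under eq_integral do rewrite MM'; exact: M_mom.
(* By [spowD], [dl * |m|^alpha] adds [dl] to the coefficients of both signed powers; after
   integration [dl] is multiplied by the sum of the two moments, which is at most [c]. *)
have up := int_le_combo P alpha b (M' i) alpha0 ab (mM' i) Cb M'_mom
   (fun w => prob (V i) [set v | t < Q' i w + M' i w * r N v])
   1 e2 ((k i + dl) * f t) ((k' i + dl) * f t) (e1 * f t) (e1 * f t)
   _ _ mq1 mqd mI p01.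
have lo := int_ge_combo P alpha b (M' i) alpha0 ab (mM' i) Cb M'_mom
   (fun w => prob (V i) [set v | t < Q' i w + M' i w * r N v])
   1 (- e2) ((k i - dl) * f t) ((k' i - dl) * f t) (- e1 * f t) (- e1 * f t)
   _ _ mq2 mqd mI p01.
have {}up := up ltac:(move=> w; have [h _] := hA (Q' i w) (M' i w);
  apply: (le_trans h); rewrite /combo -(spowD _ alpha0);
  rewrite le_eqVlt; apply/orP; left; apply/eqP; ring).
have {}lo := lo ltac:(move=> w; have [_ h] := hA (Q' i w) (M' i w);
  apply: le_trans h; rewrite /combo -(spowD _ alpha0);
  rewrite le_eqVlt; apply/orP; left; apply/eqP; ring).
have /andP[mb0 mbC] := mom_b_bounds P b (M' i) (mM' i) Cb M'_mom.
have f3 : f t <= f ((1 - dt) * t).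
  by apply: f_noninc; rewrite ler_piMl ?(ltW t0)// lerBlDr lerDl ltW.
have f4 : f ((1 + dt) * t) <= f t.
  by apply: f_noninc; rewrite ler_peMl ?(ltW t0)// lerDl ltW.
have Pd : e2 * prob P [set w | dt * t < `|Q' i w|] <= e1 * f t.
  have h1 : prob P [set w | dt * t < `|Q' i w|] <= Cq * Cd * f t.
    under eq_set do rewrite QQ'.
    apply: (le_trans (H2 _ td3 i)).
    by rewrite -mulrA ler_wpM2l.
  apply: (@le_trans _ _ (e2 * (Cq * Cd * f t))); first by rewrite ler_wpM2l// ltW.
  by rewrite mulrA ler_pM2r.
have ef0 : 0 < e1 * f t by rewrite mulr_gt0.
have qf (x : R) : `|x - f t| <= e1 * f t -> `|q i * (x - f t)| <= Cq * (e1 * f t).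
  by move=> xf; rewrite normrM ler_pM.
have P1 : prob P [set w | (1 - dt) * t < Q' i w] <= q i * f t + (Cq + 2) * (e1 * f t).
  have := qf (f ((1 - dt) * t)) ltac:(rewrite ger0_norm ?subr_ge0//; lra).
  have := H1 _ td1 i.
  have : e1 * f ((1 - dt) * t) <= 2 * (e1 * f t).
    apply: (@le_trans _ _ (e1 * ((1 + e1) * f t))); first by rewrite ler_pM2l.
    by rewrite mulrCA ler_wpM2r ?(ltW ef0)//; lra.
  by rewrite !ler_norml => ? /andP[? ?] /andP[? ?]; lra.
have P2 : q i * f t - (Cq + 1) * (e1 * f t) <= prob P [set w | (1 + dt) * t < Q' i w].
  have := qf (f ((1 + dt) * t)) ltac:(rewrite ler0_norm ?subr_le0//; lra).
  have := H1 _ td2 i.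
  have : e1 * f ((1 + dt) * t) <= e1 * f t by rewrite ler_pM2l.
  by rewrite !ler_norml => ? /andP[? ?] /andP[? ?]; lra.
have dlm : dl * f t * (mom P alpha 1 (M' i) + mom P alpha (-1) (M' i)) <= dl * f t * c.
  by apply: ler_wpM2l => //; rewrite mulr_ge0// ltW.
have emb : e1 * f t * \int[P]_w (`|M' i w| `^ b) <= e1 * f t * Cb.
  by apply: ler_wpM2l => //; exact: ltW.
have ee : e1 * (Cq + Cb + 5) * f t <= e * f t by rewrite ler_pM2r.
move: {mb0 mbC qf p01 hA mqd mq1 mq2 mI} (\int[P]_w (`|M' i w| `^ b)) (mom P alpha 1 (M' i)) (mom P alpha (-1) (M' i))
  (prob P [set w | dt * t < `|Q' i w|]) (prob P [set w | (1 - dt) * t < Q' i w])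
  (prob P [set w | (1 + dt) * t < Q' i w])
  (\int[P]_w prob (V i) [set v | t < Q' i w + M' i w * r N v])
  up lo Pd P1 P2 dlm emb ee => mb mo1 mo2 pd p1 p2 I up lo Pd P1 P2 dlm emb ee.
by rewrite ler_norml; apply/andP; split; lra.
Unshelve. all: by end_near. Qed.

(** The equations for [k1] and [km1] say that one affine step reproduces the constants exactly, so
    only the error is transformed, and it is contracted by [c]. Each step costs one more term of the
    series. *)
Let deviation_step (dl e : R) : 0 <= dl -> 0 < e -> deviation dl -> deviation (c * dl + e).
Proof.
move=> dl0 e0 [N0 /near_pinfty_ex[S S0 HS]].
have k1K i : `|dsum (fun j => H i j * k1 j)| <= K by exact: dsum_le.
have km1K i : `|dsum (fun j => H i j * km1 j)| <= K by exact: dsum_le.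
have tl N i : (N0 <= N)%N -> tails f (V i) (r N) S
    (dsum (fun j => H i j * k1 j)) (dsum (fun j => H i j * km1 j)) dl.
  move=> N0N; split => // s Ss.
    have := V_close N i _ k1 dl s (measurable_gt s) k1_le.
    by apply => j; have [] := HS s Ss N j N0N.
  have := V_close N i _ km1 dl s (measurable_gtN s) km1_le.
  by apply => j; have [] := HS s Ss N j N0N.
have c1 := contraction_side Q M q1 _ _ dl S e mQ mM (fun _ _ => erefl) M_contract
  (fun _ _ => erefl) q1_tail q1_le dl0 S0 e0 k1K km1K.
have momN eta i : mom P alpha eta (fun w => - M i w) = mom P alpha (- eta) (M i).
  by apply: eq_Rintegral => w _; exact: spowN.
have c2 := contraction_side (fun i w => - Q i w) (fun i w => - M i w) qm1 _ _ dl S e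
  (fun i => measurable_funN (mQ i)) (fun i => measurable_funN (mM i)) (fun _ _ => normrN _)
  ltac:(move=> i; rewrite !momN opprK addrC; exact: M_contract)
  (fun _ _ => normrN _) qm1_tail qm1_le dl0 S0 e0 k1K km1K.
exists N0.+1; near=> t => -[//|N] i; rewrite ltnS => N0N.
have C1 : forall N i, tails f (V i) (r N) S
     (dsum (fun j => H i j * k1 j)) (dsum (fun j => H i j * km1 j)) dl ->
    measurable_fun setT (fun w => prob (V i) [set v | t < Q i w + M i w * r N v]) ->
    `|\int[P]_w prob (V i) [set v | t < Q i w + M i w * r N v] -
      (q1 i + mom P alpha 1 (M i) * dsum (fun j => H i j * k1 j)
       + mom P alpha (-1) (M i) * dsum (fun j => H i j * km1 j)) * f t|
    <= (c * dl + e) * f t by near: t; exact: c1.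
have C2 : forall N i, tails f (V i) (r N) S
     (dsum (fun j => H i j * k1 j)) (dsum (fun j => H i j * km1 j)) dl ->
    measurable_fun setT (fun w => prob (V i) [set v | t < - Q i w + - M i w * r N v]) ->
    `|\int[P]_w prob (V i) [set v | t < - Q i w + - M i w * r N v] -
      (qm1 i + mom P alpha 1 (fun w => - M i w) * dsum (fun j => H i j * k1 j)
       + mom P alpha (-1) (fun w => - M i w) * dsum (fun j => H i j * km1 j)) * f t|
    <= (c * dl + e) * f t by near: t; exact: c2.
have opE w : [set v | t < - (Q i w + M i w * r N v)] =
    [set v | t < - Q i w + - M i w * r N v].
  by apply/seteqP; split => v /=; rewrite opprD mulNr.
have [mI1 ->] := U_step N i _ (measurable_gt t).
have [mI2 ->] := U_step N i _ (measurable_gtN t).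
split; first by have := C1 N i (tl N i N0N) mI1; rewrite -k1_eq.
have mI2' : measurable_fun setT (fun w => prob (V i) [set v | t < - Q i w + - M i w * r N v]).
  by under eq_fun do rewrite -opE.
have := C2 N i (tl N i N0N) mI2'; rewrite !momN opprK.
have -> : qm1 i + mom P alpha (-1) (M i) * dsum (fun j => H i j * k1 j)
       + mom P alpha 1 (M i) * dsum (fun j => H i j * km1 j) = km1 i.
  by rewrite [RHS]km1_eq addrAC.
by under eq_Rintegral do rewrite -opE.
Unshelve. all: by end_near. Qed.

(** The a priori bound supplies a finite initial deviation [d0], and the contraction is iterated
    until [c^n * d0 <= e / 2]. *)
Lemma perp_tail (e : R) : 0 < e -> deviation e.
Proof.
move=> e0; have [c0 c1] : 0 <= c /\ c < 1 by apply/andP.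
have [S S0 [C C0 HC]] := perp_apriori.
pose d0 := C + `|K|.
have d00 : 0 <= d0 by rewrite addr_ge0.
have step n : deviation (c ^+ n * d0 + e / 2).
  elim: n => [|n IH]; last first.
    (* With this additive error, [e / 2] is the fixed point of the map on deviations, so the errors
       do not accumulate beyond it. *)
    have c1e : 0 < (1 - c) * (e / 2) by rewrite mulr_gt0 ?subr_gt0 ?divr_gt0.
    have := deviation_step _ _ _ c1e IH; rewrite addr_ge0 ?mulr_ge0 ?exprn_ge0 ?divr_ge0 ?(ltW e0)//.
    by move=> /(_ isT); congr deviation; rewrite exprS; ring.
  exists 0%N; near=> t => N i _; rewrite expr0 mul1r.
  have St : S <= t by near: t; exact: near_pinfty_ge.
  have ft := f_gt0 t.
  have bd (C' : set R) (k : D -> R) : (forall j, `|k j| <= K) -> measurable C' ->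
      U N C' i <= U N [set x | t < `|x|] i -> `|U N C' i - k i * f t| <= (d0 + e / 2) * f t.
    move=> kK mC' UC; apply: (le_trans (ler_normB _ _)).
    rewrite ger0_norm// normrM (gtr0_norm ft).
    have h1 : U N C' i <= C * f t by apply: (le_trans UC); exact: HC.
    have h2 : `|k i| * f t <= `|K| * f t.
      by rewrite ler_pM2r// (le_trans (kK i))// ler_norm.
    have h3 : 0 < e / 2 * f t by rewrite mulr_gt0// divr_gt0.
    by rewrite /d0; lra.
  split; apply: bd => //; apply: U_le => // x /= tx; rewrite lter_normr tx ?orbT//.
have [n cn] : exists n, c ^+ n * d0 <= e / 2.
  have lim : d0 * c ^+ n @[n --> \oo] --> (0 : R).
    by apply: cvg_geometric; rewrite ger0_norm.
  have e20 : 0 < e / 2 by rewrite divr_gt0.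
  have [n _ Hn] := cvgr_le _ lim _ e20.
  by exists n; rewrite mulrC; apply: (Hn n) => /=.
have [N0 HN] := step n; exists N0; near=> t => N i N0N.
have [h1 h2] : `|U N [set x | t < x] i - k1 i * f t| <= (c ^+ n * d0 + e / 2) * f t /\
    `|U N [set x | t < - x] i - km1 i * f t| <= (c ^+ n * d0 + e / 2) * f t.
  by move: N i N0N; near: t; exact: HN.
have le : (c ^+ n * d0 + e / 2) * f t <= e * f t by rewrite ler_pM2r//; lra.
by split; [exact: le_trans le|exact: le_trans le].
Unshelve. all: by end_near. Qed.

End PerpetuityTail.

(** * Slow variation of [L] and regular variation of the comparison function [f] *)

Section SlowVariation.
Context {R : realType}.
Variables (alpha : R) (L f : R -> R).
Hypothesis L_sv : slowly_varying L.
Hypothesis f_gt0 : forall x : R, 0 < f x.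
Hypothesis f_equiv : f t / (t `^ (- alpha) * L t) @[t --> +oo] --> (1 : R).

Let near_gt (a : R) : \forall u \near +oo, a < u.
Proof. by apply: nbhs_pinfty_gt; rewrite num_real. Qed.

(** The ratio [f (u / m) / f u] is eventually a product of three convergent ratios: the equivalence
    at [u / m], the slow variation of [L], and the inverse of the equivalence at [u]. *)
Lemma regular_variation (m : R) : 0 < m -> forall e : R, 0 < e ->
  \forall u \near +oo, `|f (u / m) - m `^ alpha * f u| <= e * f u.
Proof.
move=> m0 e e0; have [L0 Lm] := L_sv.
have um : u / m @[u --> +oo] --> +oo.
  apply/cvgryPge => A; near=> u.
  by rewrite ler_pdivlMr//; near: u; exact: near_pinfty_ge.
have c1 : f (u / m) / ((u / m) `^ (- alpha) * L (u / m)) @[u --> +oo] --> (1 : R).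
  exact: (cvg_comp _ _ um f_equiv).
have c2 : L (m^-1 * u) / L u @[u --> +oo] --> (1 : R).
  by apply: Lm; rewrite invr_gt0.
have c3 : (f u / (u `^ (- alpha) * L u))^-1 @[u --> +oo] --> (1 : R).
  by rewrite -invr1; apply: cvgV => //; rewrite oner_neq0.
have c4 : f (u / m) / f u @[u --> +oo] --> m `^ alpha.
  have c5 : f (u / m) / ((u / m) `^ (- alpha) * L (u / m)) *
      (m `^ alpha * (L (m^-1 * u) / L u)) * (f u / (u `^ (- alpha) * L u))^-1
      @[u --> +oo] --> m `^ alpha.
    rewrite -[X in _ --> X]mul1r -[X in _ --> X]mulr1.
    apply: cvgM => //; apply: cvgM => //.
    by rewrite -[X in _ --> X]mulr1; apply: cvgM => //; exact: cvg_cst.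
  apply: cvg_trans c5; apply: near_eq_cvg; near=> u.
  have u0 : 0 < u by near: u; exact: near_gt.
  have Lu : 0 < L u by near: u; exact: L0.
  have Lum : 0 < L (u / m) by near: u; exact: (um _ L0).
  rewrite /= [m^-1 * u]mulrC.
  move: (L (u / m)) Lum => l l0; rewrite powRM ?invr_ge0 ?(ltW u0) ?(ltW m0)//.
  rewrite -[m^-1]powR_inv1 ?(ltW m0)// -powRrM mulN1r opprK.
  by field; rewrite !gt_eqF ?powR_gt0.
have /cvgrPdist_le /(_ _ e0) := c4; apply: filterS => u.
rewrite distrC => h; have fu := f_gt0 u.
rewrite (_ : f (u / m) - _ = (f (u / m) / f u - m `^ alpha) * f u); last first.
  by field; rewrite gt_eqF.
by rewrite normrM (gtr0_norm fu) ler_pM2r.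
Unshelve. all: by end_near. Qed.

(** Because [q] is bounded, changing the normalisation from [t^(-alpha) * L t] to [f t] costs an
    error uniform in the state. *)
Lemma unif_tail_equiv {d : measure_display} {T : measurableType d}
  {P : probability T R} {D : countType} (Q : D -> T -> R) (eta C : R) (q : D -> R) :
  (forall i, `|q i| <= C) -> unif_tail P alpha L Q eta q -> forall e : R, 0 < e ->
  \forall t \near +oo, forall i,
    `|prob P [set w | t < eta * Q i w] - q i * f t| <= e * f t.
Proof.
move=> qC Hq e e0; have [L0 _] := L_sv.
have D0 : 0 < 2 + `|C| by rewrite ltr_wpDr.
pose e1 := Num.min (2^-1) (e / (2 * (2 + `|C|))).
have e10 : 0 < e1 by rewrite lt_min invr_gt0 ltr0n divr_gt0// mulr_gt0.
have e11 : e1 <= 2^-1 by rewrite ge_min lexx.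
have e1e : e1 * (2 * (2 + `|C|)) <= e.
  by rewrite -ler_pdivlMr ?mulr_gt0// ge_min lexx orbT.
clearbody e1.
near=> t => i.
have t0 : 0 < t by near: t; exact: near_gt.
have Lt : 0 < L t by near: t; exact: L0.
have h1 : `|prob P [set w | t < eta * Q i w] / (t `^ (- alpha) * L t) - q i| < e1.
  by move: i; near: t; exact: Hq.
have h2 : `|1 - f t / (t `^ (- alpha) * L t)| <= e1.
  by near: t; move/cvgrPdist_le : f_equiv => /(_ _ e10).
have ft := f_gt0 t.
set g := t `^ (- alpha) * L t in h1 h2.
have g0 : 0 < g by rewrite mulr_gt0// powR_gt0.
have gf : `|g - f t| <= e1 * g.
  rewrite (_ : g - f t = (1 - f t / g) * g); last by field; rewrite gt_eqF.
  by rewrite normrM (gtr0_norm g0) ler_pM2r.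
have pg : `|prob P [set w | t < eta * Q i w] - q i * g| <= e1 * g.
  rewrite (_ : _ - q i * g = (prob P [set w | t < eta * Q i w] / g - q i) * g); last first.
    by field; rewrite gt_eqF.
  by rewrite normrM (gtr0_norm g0) ler_pM2r// ltW.
have g2f : g <= 2 * f t.
  have : e1 * g <= 2^-1 * g by rewrite ler_pM2r.
  by move: gf; rewrite ler_norml => /andP[]; lra.
have qg : `|q i * (g - f t)| <= `|C| * (e1 * g).
  by rewrite normrM ler_pM// (le_trans (qC i))// ler_norm.
have e1g : e1 * (2 + `|C|) * g <= e * f t.
  apply: (@le_trans _ _ (e1 * (2 + `|C|) * (2 * f t))).
    by rewrite ler_pM2l// mulr_gt0.
  rewrite (_ : _ * (2 * f t) = e1 * (2 * (2 + `|C|)) * f t); last by ring.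
  by rewrite ler_pM2r.
have eg : 0 < e1 * g by rewrite mulr_gt0.
rewrite (_ : prob P _ - _ = (prob P [set w | t < eta * Q i w] - q i * g)
   + q i * (g - f t)); last by ring.
apply: (le_trans (ler_normD _ _)); apply: le_trans e1g.
by move: pg qg; lra.
Unshelve. all: by end_near. Qed.

End SlowVariation.

(** * Almost sure limits and exceptional sets *)

Section AlmostSureLimits.
Context {d : measure_display} {T : measurableType d} {R : realType}.

(** Fatou's lemma for events: outside [Bad], [G] is contained in the lower limit of the [F m], an
    increasing union of events of probability at most [c]. *)
Lemma prob_le_eventually (P : probability T R) (Bad G : set T) (F : nat -> set T)
    (N0 : nat) (c : R) :
  measurable Bad -> measurable G -> (forall n, measurable (F n)) -> prob P Bad = 0 ->
  (forall w, G w -> ~ Bad w -> exists n, forall m, (n <= m)%N -> F m w) ->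
  (forall m, (N0 <= m)%N -> prob P (F m) <= c) -> prob P G <= c.
Proof.
move=> mB mG mF PB GF Fc.
pose A n := \bigcap_(m in [set m | (n <= m)%N]) F m.
have mA n : measurable (A n) by apply: bigcap_measurable => //; exists n => /=.
have mUA : measurable (\bigcup_n A n) by exact: bigcup_measurable.
have GA : prob P G <= prob P (\bigcup_n A n).
  rewrite -[leRHS]add0r -PB; apply: le_trans (prob_setU_le P _ _ mB mUA).
  apply: le_prob => //; first exact: measurableU.
  move=> w Gw; have [Bw|Bw] := pselect (Bad w); [by left|right].
  by have [n Hn] := GF w Gw Bw; exists n.
apply: (le_trans GA); rewrite -lee_fin -probE//.
have ndA : {homo A : n m / (n <= m)%N >-> (n <= m)%O}.
  move=> n m nm; apply/subsetPset => w Aw k /= mk; apply: Aw => /=.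
  exact: leq_trans mk.
have lim : (P \o A) n @[n --> \oo] --> P (\bigcup_n A n).
  exact: nondecreasing_cvg_mu.
rewrite -(cvg_lim _ lim)//; apply: lime_le; first by apply/cvg_ex; eexists; exact: lim.
near=> n; rewrite /= probE// lee_fin.
have N0n : (N0 <= n)%N by near: n; exists N0.
apply: (le_trans _ (Fc n N0n)); apply: le_prob => //.
by move=> w Aw; apply: Aw => /=.
Unshelve. all: by end_near. Qed.

(** As [S] is nondecreasing in [n], the tail bound, uniform in [n], passes to the supremum, and [f]
    tends to 0. *)
Lemma prob_unbounded (P : probability T R) (S : nat -> T -> R) (f : R -> R) (C S0 : R) :
  (forall n, measurable_fun setT (S n)) ->
  (forall w, nondecreasing_seq (S ^~ w)) -> 0 <= C ->
  (forall e : R, 0 < e -> \forall t \near +oo, f t < e) ->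
  (forall n t, S0 <= t -> prob P [set w | t < S n w] <= C * f t) ->
  measurable (\bigcap_k \bigcup_n [set w | k%:R < S n w]) /\
  prob P (\bigcap_k \bigcup_n [set w | k%:R < S n w]) = 0.
Proof.
move=> mS ndS C0 f0 tail.
have mU (t : R) : measurable (\bigcup_n [set w | t < S n w]).
  by apply: bigcup_measurable => n _; exact: measurable_gtr.
have mB : measurable (\bigcap_k \bigcup_n [set w | k%:R < S n w]).
  by apply: bigcap_measurable => //; exists 0%N.
split => //; apply/eqP; rewrite eq_le prob_ge0 andbT.
apply/ler_addgt0Pr => e e0; rewrite add0r.
have eC : 0 < e / (C + 1) by rewrite divr_gt0// ltr_wpDl.
have [T1 T10 HT] := near_pinfty_ex _ (f0 _ eC).
pose k := (Num.truncn (Num.max T1 S0)).+1.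
have kT : Num.max T1 S0 <= k%:R by apply/ltW; exact: truncnS_gt.
have [kT1 kS0] : T1 <= k%:R /\ S0 <= k%:R by move: kT; rewrite ge_max => /andP.
apply: (@le_trans _ _ (prob P (\bigcup_n [set w | k%:R < S n w]))).
  by apply: le_prob => // w; apply.
apply: (@prob_le_eventually P set0 _ (fun n => [set w | k%:R < S n w]) 0) => //.
- by move=> n; exact: measurable_gtr.
- exact: prob_set0.
- by move=> w [n _ /= kS] _; exists n => m nm /=; apply: (lt_le_trans kS); exact: ndS.
move=> m _; apply: (le_trans (tail m _ kS0)).
apply: (@le_trans _ _ (C * (e / (C + 1)))); first by rewrite ler_wpM2l// ltW// HT.
by rewrite mulrCA ler_piMr ?(ltW e0)// ler_pdivrMr ?ltr_wpDl// mul1r lerDl.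
Qed.

(* [limn] takes the value [point] where [u ^~ w] diverges *)
Lemma measurable_limn (u : nat -> T -> R) : (forall n, measurable_fun setT (u n)) ->
  measurable_fun setT (fun w => limn (u ^~ w)).
Proof.
move=> mu.
pose A k n m := [set w | `|u m w - u n w| <= k.+1%:R^-1].
have mA k n m : measurable (A k n m).
  rewrite [X in measurable X](_ : _ = ~` [set w | k.+1%:R^-1 < `|u m w - u n w|]).
    apply: measurableC; apply: measurable_gtr; apply: measurable_abs.
    exact: measurable_funB.
  by apply/seteqP; split => w /=; [move=> ?; apply/negP; rewrite -leNgt|move/negP; rewrite -leNgt].
(* Cauchy's criterion with accuracies [1 / (k + 1)] describes the set of convergence by countable
   operations. *)
pose Conv := \bigcap_k \bigcup_n \bigcap_(m in [set m | (n <= m)%N]) A k n m.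
have mC : measurable Conv.
  apply: bigcap_measurable; first by exists 0%N.
  move=> k _; apply: bigcup_measurable => n _.
  by apply: bigcap_measurable; [exists n => /=|].
have ConvP w : Conv w <-> cvgn (u ^~ w).
  split.
    move=> Cw; apply: cauchy_cvg; apply/cauchy_exP => e e0.
    pose k := Num.truncn e^-1.
    have ke : k.+1%:R^-1 < e.
      by rewrite invf_plt ?posrE// truncnS_gt.
    have [n _ Hn] := Cw k I; exists (u n w).
    exists n => // m /= nm; have := Hn m nm; rewrite /A /ball/= distrC => h.
    exact: le_lt_trans ke.
  move=> /cvg_ex[l ul] k _.
  have k0 : 0 < k.+1%:R^-1 / 2 :> R by rewrite divr_gt0.
  have /cvgrPdist_le /(_ _ k0) [n _ Hn] := ul.
  exists n => // m nm; rewrite /A /=.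
  have h1 := Hn n (leqnn n); have h2 := Hn m nm.
  rewrite (_ : u m w - u n w = (l - u n w) - (l - u m w)); last by ring.
  by apply: (le_trans (ler_normB _ _)); rewrite [leRHS]splitr lerD.
(* Replacing [u] by the default value off [Conv] gives a sequence that converges everywhere to
   [limn (u ^~ w)]. *)
pose v n w := if w \in Conv then u n w else point.
apply: (@measurable_fun_cvg _ _ _ setT v).
  move=> n; rewrite /v; apply: measurable_fun_ifT => //.
  apply: (measurable_fun_bool true).
  rewrite [X in measurable X](_ : _ = Conv)//.
  by apply/seteqP; split => w /= => [[_ /set_mem]//|Cw]; split => //; exact: mem_set.
move=> w _; have [Cw|nCw] := pselect (Conv w).
  rewrite (_ : v ^~ w = u ^~ w); first exact/ConvP.
  by apply/funext => n; rewrite /v mem_set.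
rewrite (_ : v ^~ w = fun=> point); last first.
  by apply/funext => n; rewrite /v memNset.
by rewrite (dvgP (fun h => nCw ((ConvP w).2 h))); exact: cvg_cst.
Qed.

End AlmostSureLimits.

(** * The abstract tail estimates applied to the model *)

Section ModelTails.
Context (R : realType) (d : measure_display) (Omega : measurableType d)
  (P : probability Omega R) (D : countType)
  (X : int -> Omega -> D) (pi : D -> R) (p : D -> D -> R)
  (Q M : int -> D -> Omega -> R).
Hypothesis markov : stationary_markov P X pi p.
Hypothesis irr : irreducible p.
Hypothesis mQ : forall n i, measurable_fun setT (Q n i).
Hypothesis mM : forall n i, measurable_fun setT (M n i).
Hypothesis ind : indep_family P (model_sigma X Q M).
Hypothesis iid : forall (i : D) (n : int) (B : set (R * R)%type), measurable B ->
  prob P ((fun w => (Q n i w, M n i w)) @^-1` B) =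
  prob P ((fun w => (Q 0 i w, M 0 i w)) @^-1` B).
Variables (alpha : R) (f : R -> R) (F0 : R).
Hypothesis alpha0 : 0 < alpha.
Hypothesis f_noninc : forall x y : R, x <= y -> f y <= f x.
Hypothesis f_gt0 : forall x : R, 0 < f x.
Hypothesis f_le : forall x : R, f x <= F0.
Hypothesis f_rv : forall m : R, 0 < m -> forall e : R, 0 < e ->
  \forall u \near +oo, `|f (u / m) - m `^ alpha * f u| <= e * f u.
Variables (b Cb c Cq : R).
Hypothesis ab : alpha < b.
Hypothesis Cb0 : 0 <= Cb.
Hypothesis M_mom : forall i, (\int[P]_w (`|M 0 i w| `^ b)%:E <= Cb%:E)%E.
Hypothesis c01 : 0 <= c < 1.
Hypothesis M_contract : forall i,
  mom P alpha 1 (M 0 i) + mom P alpha (-1) (M 0 i) <= c.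
Hypothesis Cq0 : 0 <= Cq.
Hypothesis Q_tail : \forall t \near +oo, forall i,
  prob P [set w | t < `|Q 0 i w|] <= Cq * f t.

Let mX n j : measurable (X n @^-1` [set j]) := markov.1 n j.
Let pi0 i : 0 < prob P (X 0 @^-1` [set i]).
Proof. by rewrite (prob_state _ _ _ _ _ _ _ _ markov) (state_prob_gt0 _ _ _ _ _ _ _ _ markov). Qed.

Local Notation perp := (perp R d Omega D X Q M).
Let mperp n N : measurable_fun setT (perp n N).
Proof. exact: (measurable_perp R d Omega P D X pi p Q M markov mQ mM). Qed.

Let U N (C : set R) i := condP P X (perp 0 N @^-1` C) i.

Lemma condP_le A B i : measurable A -> measurable B -> A `<=` B ->
  condP P X A i <= condP P X B i.
Proof.
move=> mA mB AB; rewrite /condP ler_pM2r ?invr_gt0//.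
apply: le_prob; [exact: measurableI|exact: measurableI|].
by move=> w [Aw Xw]; split => //; exact: AB.
Qed.

Lemma condPT i : condP P X setT i = 1.
Proof. by rewrite /condP setTI divff// gt_eqF. Qed.

(** The mixture formula for the sure event. *)
Lemma Hk_sum i : (\esum_(j in [set: D]) (Hk P X i j)%:E = 1)%E.
Proof.
have [V /(_ 0%N i setT measurableT)[_ _]] :=
  perp_kernel R d Omega P D X pi p Q M markov irr mQ mM ind iid.
rewrite preimage_setT prob_setT => ->; apply: eq_esum => j _.
by congr EFin; rewrite [condP _ _ _ _](condPT j) mulr1.
Qed.

Let U_ge0 N C i : 0 <= U N C i.
Proof. exact: condP_ge0. Qed.

Let U_le N (C C' : set R) i : measurable C -> measurable C' ->
  C `<=` C' -> U N C i <= U N C' i.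
Proof.
move=> mC mC' CC'; apply: condP_le; [exact: measurable_preim..|].
by move=> w; exact: CC'.
Qed.

Let U_le1 N (C : set R) i : measurable C -> U N C i <= 1.
Proof. by move=> mC; rewrite -(condPT i); exact: (U_le N C setT). Qed.

Let U_init (t : R) i : 0 <= t -> U 0 [set x | t < `|x|] i = 0.
Proof.
move=> t0; rewrite /U /condP (_ : _ `&` _ = set0) ?prob_set0 ?mul0r//.
by apply/seteqP; split => w // [/=]; rewrite normr0 ltNge t0.
Qed.

(** Kept apart from the exact tails so that it also applies to [(|Q|, |M|)], for which only an upper
    bound on the tail of [|Q|] is supplied. *)
Lemma model_apriori : exists2 S : R, 0 < S & exists2 C : R, 0 <= C &
  forall N i t, S <= t -> condP P X [set w | t < `|perp 0 N w|] i <= C * f t.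
Proof.
have [V HV] := perp_kernel R d Omega P D X pi p Q M markov irr mQ mM ind iid.
exact: (perp_apriori alpha f F0 alpha0 f_noninc f_gt0 f_le f_rv P (Q 0) (M 0) V
  (perp (-1)) U (Hk P X) (mQ 0) (mM 0) (mperp (-1)) U_ge0 U_init
  (fun N i C mC => let: And3 h1 h2 _ := HV N i C mC in conj h1 h2)
  (fun N i C mC => let: And3 _ _ h := HV N i C mC in h)
  (Hk_ge0 _ _ _ P D X) Hk_sum b Cb c ab Cb0 M_mom c01 M_contract Cq Cq0 Q_tail).
Qed.

Variables (q1 qm1 k1 km1 : D -> R) (K : R).
Hypothesis k1_le : forall i, `|k1 i| <= K.
Hypothesis km1_le : forall i, `|km1 i| <= K.
Hypothesis q1_tail : forall e : R, 0 < e -> \forall t \near +oo, forall i,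
  `|prob P [set w | t < Q 0 i w] - q1 i * f t| <= e * f t.
Hypothesis qm1_tail : forall e : R, 0 < e -> \forall t \near +oo, forall i,
  `|prob P [set w | t < - Q 0 i w] - qm1 i * f t| <= e * f t.
Hypothesis q1_le : forall i, `|q1 i| <= Cq.
Hypothesis qm1_le : forall i, `|qm1 i| <= Cq.
Hypothesis k1_eq : forall i, k1 i = q1 i
  + mom P alpha 1 (M 0 i) * dsum (fun j => Hk P X i j * k1 j)
  + mom P alpha (-1) (M 0 i) * dsum (fun j => Hk P X i j * km1 j).
Hypothesis km1_eq : forall i, km1 i = qm1 i
  + mom P alpha 1 (M 0 i) * dsum (fun j => Hk P X i j * km1 j)
  + mom P alpha (-1) (M 0 i) * dsum (fun j => Hk P X i j * k1 j).

Lemma model_tail (e : R) : 0 < e -> exists N0 : nat, \forall t \near +oo,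
  forall N i, (N0 <= N)%N ->
    `|condP P X [set w | t < perp 0 N w] i - k1 i * f t| <= e * f t /\
    `|condP P X [set w | t < - perp 0 N w] i - km1 i * f t| <= e * f t.
Proof.
have [V HV] := perp_kernel R d Omega P D X pi p Q M markov irr mQ mM ind iid.
exact: (perp_tail alpha f F0 alpha0 f_noninc f_gt0 f_le f_rv P (Q 0) (M 0) V
  (perp (-1)) U (Hk P X) (mQ 0) (mM 0) (mperp (-1)) U_ge0 U_le1 U_le U_init
  (fun N i C mC => let: And3 h1 h2 _ := HV N i C mC in conj h1 h2)
  (fun N i C mC => let: And3 _ _ h := HV N i C mC in h)
  (Hk_ge0 _ _ _ P D X) Hk_sum b Cb c ab Cb0 M_mom c01 M_contract Cq Cq0 Q_tail
  q1 qm1 k1 km1 K k1_le km1_le q1_tail qm1_tail q1_le qm1_le k1_eq km1_eq).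
Qed.

End ModelTails.

(** * The series: truncations, absolute values, passage to the limit *)

Section PerpetuitySeries.
Context (R : realType) (d : measure_display) (Omega : measurableType d)
  (D : countType) (X : int -> Omega -> D)
  (Q M : int -> D -> Omega -> R).

Lemma perp_sum n N w : perp R d Omega D X Q M n N w =
  \sum_(l < N) (Q (n - l%:Z) (X (n - l%:Z) w) w *
    \prod_(k < l) M (n - k%:Z) (X (n - k%:Z) w) w).
Proof.
elim: N n => [|N IH] n; first by rewrite big_ord0.
rewrite big_ord_recl big_ord0 mulr1 subr0 /= IH; congr (_ + _).
rewrite big_distrr /=; apply: eq_bigr => l _.
rewrite big_ord_recl /= subr0 mulrCA.
have E k : n - 1 - k%:Z = n - (bump 0 k)%:Z.
  by rewrite /bump add1n -addrA -opprD -intS.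
by rewrite E; congr (_ * (_ * _)); apply: eq_bigr => k _; rewrite E.
Qed.

End PerpetuitySeries.

Section PerpetuityAbsolute.
Context (R : realType) (d : measure_display) (Omega : measurableType d)
  (P : probability Omega R) (D : countType) (X : int -> Omega -> D)
  (Q M : int -> D -> Omega -> R).

(** Taking absolute values in the recursion produces the partial sums of the series of absolute
    values, so the a priori bound controls absolute convergence. *)
Lemma perp_abs_sum n N w :
  perp R d Omega D X (fun n i w => `|Q n i w|) (fun n i w => `|M n i w|) n N w =
  \sum_(l < N) `|Q (n - l%:Z) (X (n - l%:Z) w) w *
    \prod_(k < l) M (n - k%:Z) (X (n - k%:Z) w) w|.
Proof.
by rewrite perp_sum; apply: eq_bigr => l _; rewrite normrM normr_prod.
Qed.

Lemma indep_family_abs : indep_family P (model_sigma X Q M) ->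
  indep_family P (model_sigma X (fun n i w => `|Q n i w|) (fun n i w => `|M n i w|)).
Proof.
move=> ind J uJ A AJ; apply: ind => // -[[n i]|] kJ; last exact: (AJ None).
have [B mB ->] := AJ (Some (n, i)) kJ.
exists ((fun x : R * R => (`|x.1|, `|x.2|)) @^-1` B) => //.
apply: measurable_preim mB; apply: measurable_fun_pair.
  by apply: measurable_abs; exact: measurable_fst.
by apply: measurable_abs; exact: measurable_snd.
Qed.

End PerpetuityAbsolute.

Section TailOfLimit.
Context {d : measure_display} {T : measurableType d} {R : realType}.
Variables (P : probability T R) (f : R -> R).
Hypothesis f_noninc : forall x y : R, x <= y -> f y <= f x.
Hypothesis f_gt0 : forall x : R, 0 < f x.
Hypothesis f_shift : forall e : R, 0 < e -> exists2 dt : R, 0 < dt &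
  \forall t \near +oo, (1 - e) * f t <= f ((1 + dt) * t).

(** For fixed [t], [Z > t] forces [u n > t] eventually, while [Z <= t] only forces
    [u n < (1 + dt) * t] eventually; [f_shift] pays for this gap. Letting [n] grow at fixed [t] is
    allowed because the threshold in [t] is common to all [N >= N0]. *)
Lemma tail_of_limit (Bad : set T) (u : nat -> T -> R) (Z : T -> R) (k : R) :
  measurable Bad -> prob P Bad = 0 -> (forall n, measurable_fun setT (u n)) ->
  measurable_fun setT Z -> (forall w, ~ Bad w -> u n w @[n --> \oo] --> Z w) ->
  (forall e : R, 0 < e -> exists N0 : nat, \forall t \near +oo,
    forall N, (N0 <= N)%N -> `|prob P [set w | t < u N w] - k * f t| <= e * f t) ->
  forall e : R, 0 < e -> \forall t \near +oo,
    `|prob P [set w | t < Z w] - k * f t| <= e * f t.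
Proof.
move=> mB PB mu mZ uZ utail e e0.
pose e1 := e / (`|k| + 2).
have k2 : 0 < `|k| + 2 by rewrite ltr_wpDl.
have e10 : 0 < e1 by rewrite divr_gt0.
have e1E : e1 * (`|k| + 2) = e by rewrite divfK// gt_eqF.
clearbody e1.
have [dt dt0 Hdt] := f_shift e1 e10.
have [N0 HN] := utail e1 e10.
have [T1 T10 {}HN] := near_pinfty_ex _ HN.
near=> t.
have t0 : 0 < t by near: t; apply: nbhs_pinfty_gt; rewrite num_real.
have T1t : T1 <= t by near: t; exact: near_pinfty_ge.
have sh : (1 - e1) * f t <= f ((1 + dt) * t) by near: t; exact: Hdt.
have tt' : t < (1 + dt) * t by rewrite ltr_pMl// ltrDl.
have ft := f_gt0 t.
have mu' x n : measurable [set w | x < u n w] by exact: measurable_gtr.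
have mZ' x : measurable [set w | x < Z w] by exact: measurable_gtr.
have up : prob P [set w | t < Z w] <= (k + e1) * f t.
  apply: (@prob_le_eventually _ _ _ P Bad _ (fun n => [set w | t < u n w]) N0) => //.
    move=> w /= tZ nB.
    have [n _ Hn] := cvgr_gt _ (uZ w nB) _ tZ.
    by exists n => m nm; exact: Hn.
  move=> m N0m; have := HN t T1t m N0m; rewrite ler_norml mulrDl => /andP[_]; lra.
have lo : prob P (~` [set w | t < Z w]) <= 1 - (k - e1) * f ((1 + dt) * t).
  apply: (@prob_le_eventually _ _ _ P Bad _ (fun n => ~` [set w | (1 + dt) * t < u n w]) N0) => //.
  - exact: measurableC.
  - by move=> n; exact: measurableC.
  - move=> w /= /negP; rewrite -leNgt => Zt nB.
    have [n _ Hn] := cvgr_lt _ (uZ w nB) _ (le_lt_trans Zt tt').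
    exists n => m nm /=; apply/negP; rewrite -leNgt; apply: ltW; exact: Hn.
  move=> m N0m; rewrite prob_setC// lerD2l lerN2.
  have := HN _ (le_trans T1t (ltW tt')) m N0m; rewrite ler_norml mulrBl => /andP[+ _]; lra.
rewrite prob_setC// lerD2l lerN2 in lo.
have f4 : f ((1 + dt) * t) <= f t by apply: f_noninc; exact: ltW.
have kf : `|k * (f ((1 + dt) * t) - f t)| <= `|k| * (e1 * f t).
  rewrite normrM ler_wpM2l// ler0_norm ?subr_le0//; lra.
have ef : e1 * f ((1 + dt) * t) <= e1 * f t by rewrite ler_pM2l.
have eft : e * f t = `|k| * (e1 * f t) + 2 * (e1 * f t) by rewrite -e1E; ring.
have e1f : 0 < e1 * f t by rewrite mulr_gt0.
have k0f : 0 <= `|k| * (e1 * f t) by rewrite mulr_ge0// ltW.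
move: kf; rewrite !ler_norml eft => /andP[kf1 kf2]; apply/andP.
by move: up lo; rewrite mulrDl mulrBl; split; lra.
Unshelve. all: by end_near. Qed.

End TailOfLimit.

(** Each inverse operator is expressed through the bounded solutions of its equation. Existence is
    asserted separately; uniqueness is implied, since [K1 i + K2 i] and [K1 i - K2 i] are both
    determined by limits. *)
Theorem theorem2 (R : realType) (d : measure_display) (Omega : measurableType d)
  (P : probability Omega R) (D : countType)
  (X : int -> Omega -> D) (pi : D -> R) (p : D -> D -> R)
  (Q M : int -> D -> Omega -> R)
  (alpha beta : R) (L : R -> R) (q1 qm1 : D -> R) :
  (* the model *)
  stationary_markov P X pi p ->
  irreducible p ->
  (forall n i, measurable_fun setT (Q n i)) ->
  (forall n i, measurable_fun setT (M n i)) ->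
  indep_family P (model_sigma X Q M) ->
  (forall (i : D) (n : int) (B : set (R * R)%type), measurable B ->
     prob P ((fun w => (Q n i w, M n i w)) @^-1` B) =
     prob P ((fun w => (Q 0 i w, M 0 i w)) @^-1` B)) ->
  (* Assumption (A) *)
  0 < alpha ->
  (* (A1) *)
  slowly_varying L ->
  (forall i, 0 <= q1 i) -> (forall i, 0 <= qm1 i) ->
  (forall n, unif_tail P alpha L (Q n) 1 q1) ->
  (forall n, unif_tail P alpha L (Q n) (-1) qm1) ->
  (0 < \esum_(j in [set: D]) (q1 j)%:E)%E ->
  (exists C : R, forall j, Num.max (q1 j) (qm1 j) <= C) ->
  (* (A2) *)
  alpha < beta ->
  (exists C : R, forall i,
     (\int[P]_w ((`|M 0 i w| `^ beta)%:E) <= C%:E)%E) ->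
  (* (A3) *)
  (exists c : R, c < 1 /\
     forall i, mom P alpha 1 (M 0 i) + mom P alpha (-1) (M 0 i) <= c) ->
  (* (A4) *)
  (forall e : R, 0 < e -> exists2 delta : R, 0 < delta &
     forall eps : R, 0 < eps < delta -> forall i : D,
       `| prob P [set w | M 1 i w <= eps] - prob P [set w | M 1 i w <= 0] | < e) ->
  let m1 := fun i => mom P alpha 1 (M 0 i) in
  let mm1 := fun i => mom P alpha (-1) (M 0 i) in
  (* K1 = (I - G)^{-1} (q1 + qm1),  K2 = (I - G_1 + G_{-1})^{-1} (q1 - qm1) *)
  let eqK1 := fun K1 : D -> R => bounded_seq K1 /\
      K1 = (fun i => q1 i + qm1 i + Gop P X (fun j => m1 j + mm1 j) K1 i) in
  let eqK2 := fun K2 : D -> R => bounded_seq K2 /\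
      K2 = (fun i => q1 i - qm1 i + Gop P X m1 K2 i - Gop P X mm1 K2 i) in
  (exists K1, eqK1 K1) /\ (exists K2, eqK2 K2) /\
  forall K1 K2, eqK1 K1 -> eqK2 K2 ->
  forall eta : R, (eta = 1 \/ eta = -1) -> forall i : D,
    condP P X [set w | t < eta * Rsol X Q M w] i / (t `^ (- alpha) * L t)
      @[t --> +oo] --> (K1 i + eta * K2 i) / 2.
Proof.
move=> markov irr mQ mM ind iid al0 Lsv q1_ge0 qm1_ge0 tq1 tqm1 sq1 [Cq' HCq] ab
  [Cb HCb] [c [c1 Hc]] _ m1 mm1 eqK1 eqK2.
have [j0 q1j0] : exists j, 0 < q1 j.
  apply: contrapT => /forallNP q0; move: sq1; rewrite esum1 ?ltxx// => j _.
  congr EFin; apply/eqP; rewrite eq_le q1_ge0 andbT leNgt; exact/negP/q0.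
have q1C j : `|q1 j| <= Cq'.
  by rewrite ger0_norm// (le_trans _ (HCq j))// le_max lexx.
have qm1C j : `|qm1 j| <= Cq'.
  by rewrite ger0_norm// (le_trans _ (HCq j))// le_max lexx orbT.
have Cq0 : 0 <= Cq' by rewrite (le_trans _ (q1C j0)).
have m1_ge0 j : 0 <= m1 j by exact: mom_ge0.
have mm1_ge0 j : 0 <= mm1 j by exact: mom_ge0.
have c0 : 0 <= c by rewrite (le_trans _ (Hc j0))// addr_ge0// ?m1_ge0 ?mm1_ge0.
have c01 : 0 <= c < 1 by rewrite c0.
have Cb0 : 0 <= Cb.
  by have /andP[] := mom_b_bounds P beta _ (mM 0 j0) _ (HCb j0); exact: le_trans.
have H_ge0 := Hk_ge0 R d Omega P D X.
have H_sum := Hk_sum R d Omega P D X pi p Q M markov irr mQ mM ind iid.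
have exK1 : exists K1, eqK1 K1.
  apply: (fixed_point_exists (Hk P X) H_ge0 H_sum (fun i => q1 i + qm1 i)
    (fun i => m1 i + mm1 i) (Cq' + Cq') c c01) => i.
    by rewrite (le_trans (ler_normD _ _))// lerD.
  by rewrite ger0_norm ?addr_ge0// ?m1_ge0 ?mm1_ge0//; exact: Hc.
have exK2 : exists K2, eqK2 K2.
  (* The two terms with [m1] and [mm1] merge into one operator with multiplier [m1 - mm1], whose
     absolute value is at most [m1 + mm1 <= c]. *)
  have [i|i|K2 [bK2 eK2]] := fixed_point_exists (Hk P X) H_ge0 H_sum (fun i => q1 i - qm1 i)
    (fun i => m1 i - mm1 i) (Cq' + Cq') c c01.
  - by rewrite (le_trans (ler_normB _ _))// lerD.
  - have := Hc i; have := m1_ge0 i; have := mm1_ge0 i; rewrite /m1 /mm1 ler_norml.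
    by move=> ? ? ?; apply/andP; split; lra.
  exists K2; split => //; rewrite {1}eK2; apply/funext => i.
  by rewrite /Gop; ring.
split => //; split => // K1 K2 [bK1 eK1] [bK2 eK2] eta Heta i.
(* Dividing by [q1 j0] makes [f] equivalent to [t^(-alpha) * L t]. *)
pose f t := prob P [set w | t < Q 0 j0 w] / q1 j0.
have f_noninc (x y : R) : x <= y -> f y <= f x.
  move=> xy; rewrite ler_pM2r ?invr_gt0//; apply: le_prob; [exact: measurable_gtr..|].
  by move=> w /=; exact: le_lt_trans.
have [L0 _] := Lsv.
have f_equiv : f t / (t `^ (- alpha) * L t) @[t --> +oo] --> (1 : R).
  apply/cvgrPdist_le => e e0.
  have := tq1 0 (e * q1 j0) (mulr_gt0 e0 q1j0); apply: filterS => t /(_ j0) /ltW.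
  under eq_set do rewrite mul1r.
  move=> h; rewrite distrC -(ler_pM2r q1j0) -{1}(gtr0_norm q1j0) -normrM.
  rewrite (_ : _ * q1 j0 = prob P [set w | t < Q 0 j0 w] / (t `^ (- alpha) * L t) - q1 j0)//.
  by rewrite /f mulrBl mul1r mulrAC divfK// gt_eqF.
(* Equivalence with an eventually positive function gives positivity at large arguments, and
   monotonicity extends it to all. *)
have f_gt0 x : 0 < f x.
  have [T1 T10 HT1] := near_pinfty_ex _ (cvgr_gt _ f_equiv _ (@ltr01 R)).
  have [T2 T20 HT2] := near_pinfty_ex _ L0.
  pose t := Num.max x (T1 + T2).
  have xt : x <= t by rewrite le_max lexx.
  have Tt : T1 + T2 <= t by rewrite le_max lexx orbT.
  have t0 : 0 < t by lra.
  have := HT1 t ltac:(lra); have := HT2 t ltac:(lra) => Lt.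
  rewrite pmulr_lgt0; last by rewrite invr_gt0 mulr_gt0// powR_gt0.
  by move/lt_le_trans; apply; exact: f_noninc.
have f_le x : f x <= (q1 j0)^-1.
  by rewrite ler_piMl ?invr_ge0 ?(ltW q1j0)// prob_le1//; exact: measurable_gtr.
have f_rv := regular_variation alpha L f Lsv f_gt0 f_equiv.
clearbody f.
have t1 : forall e : R, 0 < e -> \forall t \near +oo, forall i,
    `|prob P [set w | t < Q 0 i w] - q1 i * f t| <= e * f t.
  move=> e e0; have := unif_tail_equiv alpha L f Lsv f_gt0 f_equiv (Q 0) 1 Cq' q1 q1C (tq1 0) e e0.
  by apply: filterS => t h k; have := h k; under eq_set do rewrite mul1r.
have tm1 : forall e : R, 0 < e -> \forall t \near +oo, forall i,
    `|prob P [set w | t < - Q 0 i w] - qm1 i * f t| <= e * f t.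
  move=> e e0; have := unif_tail_equiv alpha L f Lsv f_gt0 f_equiv (Q 0) (-1) Cq' qm1 qm1C (tqm1 0) e e0.
  by apply: filterS => t h k; have := h k; under eq_set do rewrite mulN1r.
(* Two tails, each eventually at most [(Cq' + 1) * f t]. *)
pose Cq := 2 * Cq' + 2.
have CqC : Cq' <= Cq by rewrite /Cq; lra.
have Cq_ge0 : 0 <= Cq by lra.
have Q_tail : \forall t \near +oo, forall i,
    prob P [set w | t < `|Q 0 i w|] <= Cq * f t.
  near=> t => k.
  have h1 : `|prob P [set w | t < Q 0 k w] - q1 k * f t| <= 1 * f t.
    by move: k; near: t; exact: t1.
  have h2 : `|prob P [set w | t < - Q 0 k w] - qm1 k * f t| <= 1 * f t.
    by move: k h1; near: t; apply: filterS (tm1 1 ltr01) => ? h ? _; exact: h.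
  apply: (le_trans (prob_abs_le _ _ _ (mQ 0 k))).
  have h3 : q1 k * f t <= Cq' * f t.
    by rewrite ler_pM2r// (le_trans (ler_norm _)).
  have h4 : qm1 k * f t <= Cq' * f t.
    by rewrite ler_pM2r// (le_trans (ler_norm _)).
  by move: h1 h2; rewrite !ler_norml /Cq => /andP[_ h1] /andP[_ h2]; lra.
have [C1 K1C] := bK1; have [C2 K2C] := bK2.
have C10 : 0 <= C1 by rewrite (le_trans _ (K1C j0)).
have C20 : 0 <= C2 by rewrite (le_trans _ (K2C j0)).
(* For [s] equal to 1 and -1 these are the half-sum and half-difference of [K1] and [K2], which turn
   the two separate equations into the coupled system for the two tails. *)
pose kk (s : R) j := 2^-1 * K1 j + s / 2 * K2 j.
have kk_le s : s = 1 \/ s = -1 -> forall j, `|kk s j| <= C1 + C2.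
  move=> hs j; have s1 : `|s| = 1 by case: hs => ->; rewrite ?normrN normr1.
  apply: (le_trans (ler_normD _ _)); rewrite !normrM s1 !normrV ?unitfE ?normr_nat//.
  by have := K1C j; have := K2C j; have := normr_ge0 (K1 j); have := normr_ge0 (K2 j); lra.
have hkk s k : dsum (fun j => Hk P X k j * kk s j) =
    2^-1 * dsum (fun j => Hk P X k j * K1 j) + s / 2 * dsum (fun j => Hk P X k j * K2 j).
  have bZ a (v : D -> R) : bounded_seq v -> bounded_seq (fun j => a * v j).
    by move=> [B vB]; exists (`|a| * B) => j; rewrite normrM ler_wpM2l.
  rewrite /kk (dsumD _ (H_ge0 k) (H_sum k)); [|exact: bZ..].
  by rewrite !(dsumZ _ (H_ge0 k)).
have kk1_eq k : kk 1 k = q1 k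
    + mom P alpha 1 (M 0 k) * dsum (fun j => Hk P X k j * kk 1 j)
    + mom P alpha (-1) (M 0 k) * dsum (fun j => Hk P X k j * kk (-1) j).
  by rewrite !hkk {1}/kk {1}eK1 {1}eK2 /Gop /m1 /mm1; field.
have kkm1_eq k : kk (-1) k = qm1 k
    + mom P alpha 1 (M 0 k) * dsum (fun j => Hk P X k j * kk (-1) j)
    + mom P alpha (-1) (M 0 k) * dsum (fun j => Hk P X k j * kk 1 j).
  by rewrite !hkk {1}/kk {1}eK1 {1}eK2 /Gop /m1 /mm1; field.
have qle (q : D -> R) : (forall j, `|q j| <= Cq') -> forall j, `|q j| <= Cq.
  by move=> h j; exact: le_trans (h j) CqC.
have tail := model_tail R d Omega P D X pi p Q M markov irr mQ mM ind iid alpha f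
  (q1 j0)^-1 al0 f_noninc f_gt0 f_le f_rv beta Cb c Cq ab Cb0 HCb c01 Hc Cq_ge0 Q_tail
  q1 qm1 (kk 1) (kk (-1)) (C1 + C2) (kk_le 1 (or_introl erefl)) (kk_le (-1) (or_intror erefl))
  t1 tm1 (qle _ q1C) (qle _ qm1C) kk1_eq kkm1_eq.
pose Qa n j w := `|Q n j w|; pose Ma n j w := `|M n j w|.
have mQa n j : measurable_fun setT (Qa n j) by exact: measurable_abs.
have mMa n j : measurable_fun setT (Ma n j) by exact: measurable_abs.
have iida (j : D) (n : int) (B : set (R * R)%type) : measurable B ->
    prob P ((fun w => (Qa n j w, Ma n j w)) @^-1` B) =
    prob P ((fun w => (Qa 0 j w, Ma 0 j w)) @^-1` B).
  move=> mB; apply: (iid j n ((fun x : R * R => (`|x.1|, `|x.2|)) @^-1` B)).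
  apply: measurable_preim mB; apply: measurable_fun_pair.
    by apply: measurable_abs; exact: measurable_fst.
  by apply: measurable_abs; exact: measurable_snd.
have HCba j : (\int[P]_w (`|Ma 0 j w| `^ beta)%:E <= Cb%:E)%E.
  by under eq_integral do rewrite /Ma normr_id; exact: HCb.
(* A nonnegative multiplier has no negative part and its positive part carries the whole
   [alpha]-moment, so the contraction constant is unchanged. *)
have Hca j : mom P alpha 1 (Ma 0 j) + mom P alpha (-1) (Ma 0 j) <= c.
  apply: le_trans (Hc j).
  have -> : mom P alpha (-1) (Ma 0 j) = 0.
    rewrite /mom (_ : (fun w => _) = cst 0%E) ?integral0//.
    by apply/funext => w; rewrite mulN1r oppr_gt0 ltNge normr_ge0/= mulr0.
  rewrite addr0 -[leRHS](RintegralD (mu := P) measurableT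
    (integrable_spow P alpha beta _ al0 ab (mM 0 j) Cb (HCb j) 1)
    (integrable_spow P alpha beta _ al0 ab (mM 0 j) Cb (HCb j) (-1))).
  rewrite le_eqVlt; apply/orP; left; apply/eqP; apply: eq_Rintegral => w _.
  rewrite (spowD _ al0) /Ma normr_id mul1r normr_gt0.
  by case: eqVneq => [->|_]; rewrite ?mulr1// normr0 mulr0 powR0// gt_eqF.
have Qa_tail : \forall t \near +oo, forall j,
    prob P [set w | t < `|Qa 0 j w|] <= Cq * f t.
  by apply: filterS Q_tail => t h j; under eq_set do rewrite normr_id; exact: h.
have [S0 S00 [Ca Ca0 apri]] := model_apriori R d Omega P D X pi p Qa Ma markov irr
  mQa mMa (indep_family_abs _ _ _ _ _ _ _ _ ind) iida alpha f
  (q1 j0)^-1 al0 f_noninc f_gt0 f_le f_rv beta Cb c Cq ab Cb0 HCba c01 Hca Cq_ge0 Qa_tail.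
have mXi : measurable (X 0 @^-1` [set i]) := markov.1 0 i.
have Xi0 : 0 < prob P (X 0 @^-1` [set i]).
  by rewrite (prob_state _ _ _ _ _ _ _ _ markov) (state_prob_gt0 _ _ _ _ _ _ _ _ markov irr).
(* Convergence is established almost surely under the law given [X 0 = i], where the bound on the
   absolute partial sums is directly available. *)
pose PE := condprob P _ mXi.
have PEE A : measurable A -> prob PE A = condP P X A i by move=> mA; exact: condprobE.
pose S n w := perp R d Omega D X Qa Ma 0 n w.
have mS n : measurable_fun setT (S n).
  exact: (measurable_perp R d Omega P D X pi p Qa Ma markov mQa mMa).
pose a (w : Omega) (l : nat) := Q (- l%:Z) (X (- l%:Z) w) w *
  \prod_(k < l) M (- k%:Z) (X (- k%:Z) w) w.
have SE n w : S n w = [normed series (a w)] n.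
  transitivity (\sum_(0 <= l < n) `|a w l|) => //.
  rewrite /S perp_abs_sum big_mkord; apply: eq_bigr => l _.
  by rewrite sub0r; congr `|_ * _|; apply: eq_bigr => k _; rewrite sub0r.
have S_sum n w : S n w = \sum_(0 <= l < n) `|a w l| by rewrite SE.
have ndS w : nondecreasing_seq (S ^~ w).
  by apply/nondecreasing_seqP => n; rewrite !S_sum big_nat_recr//= lerDl.
have S_tail n t : S0 <= t -> prob PE [set w | t < S n w] <= Ca * f t.
  move=> S0t; rewrite PEE; last exact: measurable_gtr.
  rewrite (_ : [set w | _] = [set w | t < `|S n w|]); first exact: apri.
  apply/seteqP; split => w /=; rewrite ger0_norm// S_sum sumr_ge0//.
have f0 := rv_cvg0 alpha f _ al0 f_noninc f_gt0 f_le f_rv.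
(* The exceptional set consists of the points where the absolute partial sums are unbounded. *)
have [mBad PBad] := prob_unbounded PE S f Ca S0 mS ndS Ca0 f0 S_tail.
(* The limit in [Rsol] runs over sums with [n.+1] terms, hence the shift. *)
pose u n w := perp R d Omega D X Q M 0 n.+1 w.
have uE n w : u n w = series (a w) n.+1.
  rewrite /u perp_sum /series/= big_mkord; apply: eq_bigr => l _.
  by rewrite sub0r; congr (_ * _); apply: eq_bigr => k _; rewrite sub0r.
have mu n : measurable_fun setT (u n).
  exact: (measurable_perp R d Omega P D X pi p Q M markov mQ mM).
have RE : Rsol X Q M = fun w => limn (u ^~ w).
  apply/funext => w; rewrite /Rsol; congr (limn _); apply/funext => n.
  by rewrite uE /series/= big_mkord.
have mR : measurable_fun setT (Rsol X Q M) by rewrite RE; exact: measurable_limn.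
have uR w : ~ (\bigcap_k \bigcup_n [set w | k%:R < S n w]) w ->
    u n w @[n --> \oo] --> Rsol X Q M w.
  move=> /existsNP[k /not_implyP[_ nk]].
  have cv : cvgn (series (a w)).
    apply: normed_cvg; apply: nondecreasing_is_cvgn.
      by move=> n m nm; rewrite -!SE; exact: ndS.
    exists k%:R => _ [n _ <-]; rewrite -SE leNgt; apply/negP => kS.
    by apply: nk; exists n.
  rewrite RE; have -> : u ^~ w = fun n => series (a w) n.+1 by apply/funext => n; exact: uE.
  have : series (a w) n.+1 @[n --> \oo] --> limn (series (a w)) by rewrite cvg_shiftS.
  by move=> h; rewrite (cvg_lim _ h).
have f_shift (e : R) : 0 < e -> exists2 dt : R, 0 < dt &
    \forall t \near +oo, (1 - e) * f t <= f ((1 + dt) * t).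
  move=> e0; have [dt /andP[dt0 _] h] := rv_shift alpha f al0 f_noninc f_gt0 f_rv e e0.
  by exists dt => //; apply: filterS h => t [].
have kE : (K1 i + eta * K2 i) / 2 = kk eta i by rewrite /kk; field.
have u_tail (e : R) : 0 < e -> exists N0 : nat, \forall t \near +oo,
    forall N, (N0 <= N)%N -> `|prob PE [set w | t < eta * u N w] - kk eta i * f t| <= e * f t.
  move=> e0; have [N0 h] := tail e e0; exists N0; apply: filterS h => t h N N0N.
  have [h1 h2] := h N.+1 i (leqW N0N).
  rewrite PEE; last by apply: measurable_gtr; exact: measurable_scale.
  case: Heta => ->.
    by under eq_set do rewrite mul1r.
  by under eq_set do rewrite mulN1r.
have euR w : ~ (\bigcap_k \bigcup_n [set w | k%:R < S n w]) w ->
    eta * u n w @[n --> \oo] --> eta * Rsol X Q M w.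
  by move=> h; apply: cvgM; [exact: cvg_cst|exact: uR].
have R_tail := tail_of_limit PE f f_noninc f_gt0 f_shift _ (fun n w => eta * u n w)
  (fun w => eta * Rsol X Q M w) (kk eta i) mBad PBad
  (fun n => measurable_scale _ eta (mu n)) (measurable_scale _ eta mR)
  euR u_tail.
have c_f : condP P X [set w | t < eta * Rsol X Q M w] i / f t @[t --> +oo] --> kk eta i.
  apply/cvgrPdist_le => e e0; have := R_tail e e0; apply: filterS => t.
  rewrite PEE; last by apply: measurable_gtr; exact: measurable_scale.
  have ft := f_gt0 t.
  move=> h; rewrite distrC -(ler_pM2r ft) -[X in _ * X <= _](gtr0_norm ft) -normrM.
  by rewrite mulrBl divfK// gt_eqF.
rewrite kE.
have c_g : condP P X [set w | t < eta * Rsol X Q M w] i / f t *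
    (f t / (t `^ (- alpha) * L t)) @[t --> +oo] --> kk eta i.
  by rewrite -[X in _ --> X]mulr1; exact: cvgM.
apply: cvg_trans c_g; apply: near_eq_cvg; near=> t.
by rewrite /= mulrA divfK// gt_eqF.
Unshelve. all: by end_near. Qed.
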